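(* Let $M\in\mathbb{R}^{d\times d}$ be symmetric with eigenvalues $1\ge\lambda_1\ge\cdots\ge\lambda_d\ge0$, let $k\in\{1,\dots,d\}$ and $\delta_\times,\varepsilon_{\mathsf{pca}},p\in(0,1)$. Then $\mathrm{LazySVD}(\mathcal A,M,k,\delta_\times,\varepsilon_{\mathsf{pca}},p)$ can be implemented to run in time (i) $\widetilde O\Big(\frac{k\,\mathsf{nnz}(M)+k^2d}{\delta_\times^{1/2}}\Big)$ if $\mathcal A$ is accelerated gradient descent (AGD) and $M$ is given explicitly; (ii) $\widetilde O\Big(\frac{k\,\mathsf{nnz}(A)+k^2d}{\delta_\times^{1/2}}\Big)$ if $\mathcal A$ is AGD and $M$ is given as $M=AA^\top$ with $A\in\mathbb{R}^{d\times n}$; (iii) $\widetilde O\Big(knd+\frac{kn^{3/4}d}{\lambda_k^{1/4}\delta_\times^{1/2}}\Big)$ if $\mathcal A$ is accelerated SVRG and $M=\frac1n\sum_{i=1}^na_ia_i^\top$ with each $a_i\in\mathbb{R}^d$, $\|a_i\|_2\le1$. Here $\widetilde O$ hides logarithmic factors with respect to $k,d,1/\delta_\times,1/p,1/\lambda_1,\lambda_1/\lambda_k$ and $1/\varepsilon_{\mathsf{pca}}$.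
   Context: $\mathsf{nnz}(\cdot)$ is the number of nonzero entries. $\mathcal A$ is an approximate matrix inversion method: given $\lambda I-M\succ0$, a vector $b$ and an accuracy $\eta>0$, it returns $x$ with $\|x-(\lambda I-M)^{-1}b\|\le\eta$. Its cost, when $M\succeq 0$ and $\lambda I-M\succeq\delta I$ with $\lambda,\delta>0$, is as follows. AGD: $O\big(\frac{\lambda^{1/2}}{\delta^{1/2}}\log\frac{\lambda}{\eta\delta}\big)$ iterations, each costing $O(d)$ plus the time to multiply $M$ with a vector. Accelerated SVRG (for $M=\frac1n\sum_{i=1}^n a_ia_i^\top$, $\|a_i\|_2\le1$): time $O\big(\max\{nd,\frac{n^{3/4}d\lambda^{1/4}}{\delta^{1/2}}\}\log\frac{\lambda}{\eta\delta}\big)$. Algorithm $\mathrm{AppxPCA}(\mathcal A,M,\delta_\times,\varepsilon,p)$, for symmetric $M\in\mathbb{R}^{d\times d}$ with $0\preceq M\preceq I$, $\delta_\times\in(0,0.5]$, $\varepsilon,p\in(0,1)$: 1. $m_1\leftarrow\lceil4\log(288d/p^2)\rceil$, $m_2\leftarrow\lceil\log(36d/(p^2\varepsilon))\rceil$; $\widetilde\varepsilon_1\leftarrow\frac{1}{64m_1}(\delta_\times/6)^{m_1}$, $\widetilde\varepsilon_2\leftarrow\frac{\varepsilon}{8m_2}(\delta_\times/6)^{m_2}$. 2. $\widehat w_0\leftarrow$ a uniformly random unit vector; $s\leftarrow0$; $\lambda^{(0)}\leftarrow1+\delta_\times$. 3. Repeat: $s\leftarrow s+1$; for $t=1,\dots,m_1$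 apply $\mathcal A$ to find $\widehat w_t$ with $\|\widehat w_t-(\lambda^{(s-1)}I-M)^{-1}\widehat w_{t-1}\|\le\widetilde\varepsilon_1$; set $w\leftarrow\widehat w_{m_1}/\|\widehat w_{m_1}\|$; apply $\mathcal A$ to find $v$ with $\|v-(\lambda^{(s-1)}I-M)^{-1}w\|\le\widetilde\varepsilon_1$; set $\Delta^{(s)}\leftarrow\frac12\cdot\frac{1}{w^\top v-\widetilde\varepsilon_1}$ and $\lambda^{(s)}\leftarrow\lambda^{(s-1)}-\Delta^{(s)}/2$; until $\Delta^{(s)}\le\delta_\times\lambda^{(s)}/3$. 4. $f\leftarrow s$; for $t=1,\dots,m_2$ apply $\mathcal A$ to find $\widehat w_t$ with $\|\widehat w_t-(\lambda^{(f)}I-M)^{-1}\widehat w_{t-1}\|\le\widetilde\varepsilon_2$ (starting again from $\widehat w_0$). Return $w=\widehat w_{m_2}/\|\widehat w_{m_2}\|$. Algorithm $\mathrm{LazySVD}(\mathcal A,M,k,\delta_\times,\varepsilon_{\mathsf{pca}},p)$, for $0\preceq M\preceq I$, $k\in\{1,\dots,d\}$, $\delta_\times,\varepsilon_{\mathsf{pca}},p\in(0,1)$: set $M_0=M$ and $V_0=[\,]$ (empty). For $s=1,\dots,k$: $v_s'\leftarrow\mathrm{AppxPCA}(\mathcal A,M_{s-1},\delta_\times/2,\varepsilon_{\mathsf{pca}},p/k)$; $v_s\leftarrow(I-V_{s-1}V_{s-1}^\top)v_s'/\|(I-V_{s-1}V_{s-1}^\top)v_s'\|$; $V_s\leftarrow[V_{s-1},v_s]$;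 $M_s\leftarrow(I-v_sv_s^\top)M_{s-1}(I-v_sv_s^\top)$. Return $V_k$. *)

(* Defs.v *)
From HB Require Import structures.
From mathcomp Require Import all_boot all_order all_algebra.
From mathcomp Require Import all_classical all_reals all_analysis.

Set Implicit Arguments.
Unset Strict Implicit.
Unset Printing Implicit Defensive.

Import Order.TTheory GRing.Theory Num.Theory.
Import numFieldNormedType.Exports.

Local Open Scope classical_set_scope.
Local Open Scope ring_scope.

Section LinearAlgebra.
Variable R : realType.

Definition dot d (x y : 'cV[R]_d) : R := \sum_i x i 0 * y i 0.

(* The Euclidean norm; the library norm on matrices is the sup norm. *)
Definition l2norm d (x : 'cV[R]_d) : R := Num.sqrt (dot x x).

Definition normalize d (x : 'cV[R]_d) : 'cV[R]_d := (l2norm x)^-1 *: x.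

Definition sym d (N : 'M[R]_d) : Prop := N^T = N.
Definition psd d (N : 'M[R]_d) : Prop :=
  sym N /\ forall x : 'cV[R]_d, 0 <= dot x (N *m x).
Definition posdef d (N : 'M[R]_d) : Prop :=
  sym N /\ forall x : 'cV[R]_d, x != 0 -> 0 < dot x (N *m x).

Definition nnz m n (X : 'M[R]_(m, n)) : nat :=
  #|[set ij : 'I_m * 'I_n | X ij.1 ij.2 != 0]%SET|.

(* The eigenvalues of [M], with multiplicity, in nonincreasing order:
   [lam`_i] is the (i+1)-st largest one. *)
Definition spectrum d (M : 'M[R]_d) (lam : seq R) : Prop :=
  sorted (fun x y => y <= x) lam /\
  char_poly M = \prod_(x <- lam) ('X - x%:P).

Definition cov d n (a : 'I_n -> 'cV[R]_d) : 'M[R]_d :=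
  n%:R^-1 *: \sum_(i < n) a i *m (a i)^T.

(* The matrix [v_0, ..., v_(s-1)]. *)
Definition colmx d (s : nat) (v : nat -> 'cV[R]_d) : 'M[R]_(d, s) :=
  \matrix_(i < d, j < s) v j i 0.

End LinearAlgebra.

Section Methods.
Variables (R : realType) (d : nat).

(* [answer A lam N b eta] is the approximation of (lam I - N)^-1 b returned at
   accuracy [eta]; [count A lam N b eta] is the number of iterations of that call
   for AGD and its running time for accelerated SVRG. *)
Record method := Method {
  answer : R -> 'M[R]_d -> 'cV[R]_d -> R -> 'cV[R]_d ;
  count  : R -> 'M[R]_d -> 'cV[R]_d -> R -> nat }.

Definition accurate (A : method) : Prop :=
  forall lam N b eta, posdef (lam%:M - N) -> 0 < eta ->
    l2norm (answer A lam N b eta - invmx (lam%:M - N) *m b) <= eta.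

(* As usual inside O(.), the logarithm is read as at least 1: otherwise the
   bounds below would be negative for large [eta], and no method would meet
   them. *)
Definition log_factor (lam eta delta : R) : R :=
  Num.max 1 (ln (lam / (eta * delta))).

Definition is_agd (c : nat) (A : method) : Prop :=
  accurate A /\
  forall lam N b eta delta,
    psd N -> 0 < lam -> 0 < delta -> 0 < eta ->
    psd (lam%:M - N - delta%:M) ->
    (count A lam N b eta)%:R <=
      c%:R * (Num.sqrt lam / Num.sqrt delta) * log_factor lam eta delta.

Definition is_svrg (n c : nat) (A : method) : Prop :=
  accurate A /\
  forall lam (a : 'I_n -> 'cV[R]_d) b eta delta,
    (forall i, l2norm (a i) <= 1) ->
    0 < lam -> 0 < delta -> 0 < eta ->
    psd (lam%:M - cov a - delta%:M) ->
    (count A lam (cov a) b eta)%:R <=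
      c%:R * Num.max (n * d)%:R
               (n%:R `^ (3 / 4) * d%:R * lam `^ (1 / 4) / Num.sqrt delta)
      * log_factor lam eta delta.

End Methods.

Section Algorithms.
Variables (R : realType) (d : nat) (A : method R d).

Section AppxPCA.
Variables (M : 'M[R]_d) (delta eps p : R) (w0 : 'cV[R]_d).

Definition pca_m1 : nat := `|Num.ceil (4 * ln (288 * d%:R / p ^+ 2))|%N.
Definition pca_m2 : nat := `|Num.ceil (ln (36 * d%:R / (p ^+ 2 * eps)))|%N.
Definition pca_eps1 : R := (64 * pca_m1%:R)^-1 * (delta / 6) ^+ pca_m1.
Definition pca_eps2 : R := eps / (8 * pca_m2%:R) * (delta / 6) ^+ pca_m2.

Definition pca_power (lam eta : R) (m : nat) : 'cV[R]_d :=
  normalize (iter m (fun w => answer A lam M w eta) w0).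

(* The value of Delta computed in a round that starts from the shift [lam]. *)
Definition pca_gap (lam : R) : R :=
  let w := pca_power lam pca_eps1 pca_m1 in
  let v := answer A lam M w pca_eps1 in
  1 / 2 * (dot w v - pca_eps1)^-1.

Fixpoint pca_shift (s : nat) : R :=
  if s is s'.+1 then pca_shift s' - pca_gap (pca_shift s') / 2 else 1 + delta.

(* The exit test at the end of round [s.+1]. *)
Definition pca_stop (s : nat) : bool :=
  pca_gap (pca_shift s) <= delta * pca_shift s.+1 / 3.

(* The execution of AppxPCA from the start vector [w0] terminates, with
   output [w]. *)
Definition appxpca (w : 'cV[R]_d) : Prop :=
  exists f : nat,
    [/\ pca_stop f, forall i, (i < f)%N -> ~~ pca_stop i &
        w = pca_power (pca_shift f.+1) pca_eps2 pca_m2].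

End AppxPCA.

Section LazySVD.
Variables (M : 'M[R]_d) (k : nat) (delta eps p : R).

(* Columns are numbered from 0: [v s] is v_(s+1), computed from [deflate v s],
   that is M_s, and from the start vector [w0 s]. *)
Fixpoint deflate (v : nat -> 'cV[R]_d) (s : nat) : 'M[R]_d :=
  if s is s'.+1 then
    (1%:M - v s' *m (v s')^T) *m deflate v s' *m (1%:M - v s' *m (v s')^T)
  else M.

Definition new_column (v : nat -> 'cV[R]_d) (s : nat) (v' : 'cV[R]_d) :=
  normalize ((1%:M - colmx s v *m (colmx s v)^T) *m v').

Definition lazysvd_call (w0 v : nat -> 'cV[R]_d) (s : nat) (v' : 'cV[R]_d) :=
  appxpca (deflate v s) (delta / 2) eps (p / k%:R) (w0 s) v'.

(* LazySVD with start vectors [w0 0], ..., [w0 (k-1)] terminates and returns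
   the columns [v 0], ..., [v (k-1)]. *)
Definition lazysvd (w0 v : nat -> 'cV[R]_d) : Prop :=
  forall s, (s < k)%N ->
    exists2 v', lazysvd_call w0 v s v' & v s = new_column v s v'.

End LazySVD.

End Algorithms.

(* A real RAM with scalar registers and registers holding vectors of R^d; the
   costs count arithmetic operations on reals. *)

Section Machine.
Variables (R : realType) (d : nat).

Record state := State { sreg : nat -> R ; vreg : nat -> 'cV[R]_d }.

Definition set_sreg (st : state) (i : nat) (x : R) : state :=
  State (fun j => if j == i then x else sreg st j) (vreg st).
Definition set_vreg (st : state) (i : nat) (x : 'cV[R]_d) : state :=
  State (sreg st) (fun j => if j == i then x else vreg st j).

(* How the input matrix is given: multiplication by it is an instruction with
   its own cost, and some vectors may be available in registers. *)
Record input := Input {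
  in_mul  : 'cV[R]_d -> 'cV[R]_d ;
  in_cost : nat ;
  in_reg  : nat -> 'cV[R]_d }.

Inductive instr :=
  | SConst of nat & R                    (* s_i := c *)
  | SAdd of nat & nat & nat              (* s_i := s_j + s_l *)
  | SMul of nat & nat & nat              (* s_i := s_j * s_l *)
  | SInv of nat & nat                    (* s_i := 1 / s_j *)
  | SSqrt of nat & nat                   (* s_i := sqrt s_j *)
  | VAxpy of nat & nat & nat & nat       (* v_i := s_j * v_l + v_m *)
  | VDot of nat & nat & nat              (* s_i := <v_j, v_l> *)
  | VInMul of nat & nat.                 (* v_i := in_mul v_j *)

Variable inp : input.

Definition step (st : state) (c : instr) : state :=
  match c with
  | SConst i x => set_sreg st i x
  | SAdd i j l => set_sreg st i (sreg st j + sreg st l)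
  | SMul i j l => set_sreg st i (sreg st j * sreg st l)
  | SInv i j => set_sreg st i (sreg st j)^-1
  | SSqrt i j => set_sreg st i (Num.sqrt (sreg st j))
  | VAxpy i j l m => set_vreg st i (sreg st j *: vreg st l + vreg st m)
  | VDot i j l => set_sreg st i (dot (vreg st j) (vreg st l))
  | VInMul i j => set_vreg st i (in_mul inp (vreg st j))
  end.

Definition step_cost (c : instr) : nat :=
  match c with
  | SConst _ _ | SAdd _ _ _ | SMul _ _ _ | SInv _ _ | SSqrt _ _ => 1
  | VAxpy _ _ _ _ | VDot _ _ _ => 2 * d
  | VInMul _ _ => in_cost inp
  end%N.

Definition steps (st : state) (cs : seq instr) : state := foldl step st cs.
Definition steps_cost (cs : seq instr) : nat := \sum_(c <- cs) step_cost c.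

(* [Q] is the type of descriptions of a matrix to the inversion method.
   Registers are addressed statically; a program reads the input matrix and the
   start vectors through its instructions only. *)
Inductive prog (Q : Type) :=
  | Code of seq instr
  | Draw of nat & nat                      (* v_i := s-th start vector *)
  | Invert of nat & Q & nat & nat & nat    (* v_i := A(lam, matrix, b, eta) *)
  | Seq of prog Q & prog Q
  | Repeat of prog Q & nat & nat.          (* repeat until s_i <= s_j *)

(* [call st q lam b eta x t]: in state [st], the inversion method called on the
   matrix described by [q] returns [x] in time [t]. *)
Variables (Q : Type)
  (call : state -> Q -> R -> 'cV[R]_d -> R -> 'cV[R]_d -> nat -> Prop)
  (w0 : nat -> 'cV[R]_d).

Inductive exec : prog Q -> state -> state -> nat -> Prop :=
  | ExecCode cs st :
      exec (Code Q cs) st (steps st cs) (steps_cost cs)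
  | ExecDraw i s st :
      exec (Draw Q i s) st (set_vreg st i (w0 s)) d
  | ExecInvert i q lam b eta st x t :
      call st q (sreg st lam) (vreg st b) (sreg st eta) x t ->
      exec (Invert i q lam b eta) st (set_vreg st i x) t
  | ExecSeq c1 c2 st st1 st2 t1 t2 :
      exec c1 st st1 t1 -> exec c2 st1 st2 t2 ->
      exec (Seq c1 c2) st st2 (t1 + t2)%N
  | ExecExit c i j st st1 t :
      exec c st st1 t -> sreg st1 i <= sreg st1 j ->
      exec (Repeat c i j) st st1 t.+1
  | ExecLoop c i j st st1 st2 t1 t2 :
      exec c st st1 t1 -> ~~ (sreg st1 i <= sreg st1 j) ->
      exec (Repeat c i j) st1 st2 t2 ->
      exec (Repeat c i j) st st2 (t1.+1 + t2)%N.

Definition start : state := State (fun=> 0) (in_reg inp).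

End Machine.

(* To AGD, a matrix is given by a straight-line routine multiplying it with the
   vector of register [inreg] and leaving the result in register [outreg]; the
   routine works on a copy of the state. *)
Record routine (R : realType) := Routine {
  body : seq (instr R) ; inreg : nat ; outreg : nat }.

Definition agd_call (R : realType) d (inp : input R d) (c : nat)
    (A : method R d) (st : state R d) (q : routine R) (lam : R)
    (b : 'cV[R]_d) (eta : R) (x : 'cV[R]_d) (t : nat) : Prop :=
  exists N : 'M[R]_d,
    [/\ forall y, vreg (steps inp (set_vreg st (inreg q) y) (body q)) (outreg q)
                  = N *m y,
        x = answer A lam N b eta &
        t = (count A lam N b eta * (c * d + steps_cost inp (body q)))%N].

(* To accelerated SVRG, the matrix (1/n) sum_i a_i a_i^T is given by the
   registers holding the a_i. *)
Definition svrg_call (R : realType) d n (A : method R d) (st : state R d)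
    (q : 'I_n -> nat) (lam : R) (b : 'cV[R]_d) (eta : R) (x : 'cV[R]_d)
    (t : nat) : Prop :=
  let N := cov (fun i => vreg st (q i)) in
  x = answer A lam N b eta /\ t = count A lam N b eta.

(* One multiplication and one addition per nonzero entry; for [A *m A^T] the
   rows of [A^T] that vanish are skipped. *)
Definition explicit_input (R : realType) d (M : 'M[R]_d) : input R d :=
  Input (fun x => M *m x) (2 * nnz M + d) (fun=> 0).

Definition factored_input (R : realType) d n (A : 'M[R]_(d, n)) : input R d :=
  Input (fun x => A *m (A^T *m x)) (4 * nnz A + d) (fun=> 0).

Definition cov_input (R : realType) d n (a : 'I_n -> 'cV[R]_d) : input R d :=
  Input (fun x => cov a *m x) (4 * (n * d) + d)
        (fun j => if insub j is Some i then a i else 0).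

Section Randomness.
Variables (R : realType) (dsp : measure_display) (T : measurableType dsp).
Variable (P : probability T R).

Definition borel m n : set (set 'M[R]_(m, n)) :=
  <<s [set U : set 'M[R]_(m, n) | open U] >>.

Definition random_mx m n (X : T -> 'M[R]_(m, n)) : Prop :=
  forall B, borel B -> measurable (X @^-1` B).

Definition independent m n m' n' (X : T -> 'M[R]_(m, n))
    (Y : T -> 'M[R]_(m', n')) : Prop :=
  forall B C, borel B -> borel C ->
    P (X @^-1` B `&` Y @^-1` C) = (P (X @^-1` B) * P (Y @^-1` C))%E.

(* The uniform law on the unit sphere is the rotation invariant one. *)
Definition uniform_unit_vector d (X : T -> 'cV[R]_d) : Prop :=
  [/\ random_mx X, forall w, l2norm (X w) = 1 &
      forall Q : 'M[R]_d, Q^T *m Q = 1%:M ->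
      forall B, borel B -> P ((fun w => Q *m X w) @^-1` B) = P (X @^-1` B)].

(* A random run of LazySVD: [A] is the inversion method (it may use internal
   randomness, and its answers may depend on how its argument is presented,
   hence the dependence on the sample point), the start vector of each call to
   AppxPCA is uniform and independent of the columns found before, and the
   columns are those found by LazySVD as long as the calls to AppxPCA terminate;
   if a call does not, its column is arbitrary. *)
Definition random_run d (A : T -> method R d) (M : 'M[R]_d) (k : nat)
    (delta eps p : R) (w0 v : nat -> T -> 'cV[R]_d) : Prop :=
  forall s, (s < k)%N ->
    [/\ uniform_unit_vector (w0 s), random_mx (v s),
        independent (w0 s) (fun w => colmx s (v^~ w)) &
        forall w v', lazysvd_call (A w) M k delta eps p (w0^~ w) (v^~ w) s v' ->
          v s w = new_column (v^~ w) s v'].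

End Randomness.

Section RunningTime.
Variables (R : realType) (d : nat) (inp : input R d) (Q : Type).
Variable call : method R d -> state R d -> Q ->
  R -> 'cV[R]_d -> R -> 'cV[R]_d -> nat -> Prop.
Variables (M : 'M[R]_d) (k : nat) (delta eps p : R).
Variables (code : prog R Q) (out : nat -> nat).

Definition returns (A : method R d) (w0 v : nat -> 'cV[R]_d) (t : nat) : Prop :=
  exists2 st, exec inp (call A) w0 code (start inp) st t
            & forall s, (s < k)%N -> vreg st (out s) = v s.

(* The program computes the output of LazySVD whenever LazySVD terminates. *)
Definition implements_lazysvd : Prop :=
  forall A w0 v, lazysvd A M k delta eps p w0 v -> exists t, returns A w0 v t.

(* With probability at least 1 - p, LazySVD terminates and the program returns
   its output within time [bound]. *)
Definition runs_in_time (is_method : method R d -> Prop) (bound : R) : Prop :=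
  forall (dsp : measure_display) (T : measurableType dsp)
    (P : probability T R) (A : T -> method R d) (w0 v : nat -> T -> 'cV[R]_d),
  (forall w, is_method (A w)) ->
  random_run P A M k delta eps p w0 v ->
  exists E : set T,
    [/\ measurable E, ((1 - p)%:E <= P E)%E &
        forall w, E w ->
          lazysvd (A w) M k delta eps p (w0^~ w) (v^~ w) /\
          exists2 t, returns (A w) (w0^~ w) (v^~ w) t & t%:R <= bound].

End RunningTime.

(* The sum of the logarithms of the quantities hidden by the soft O. *)
Definition hidden_log (R : realType) (k d : nat) (delta eps p lam1 lamk : R) : R :=
  1 + ln k%:R + ln d%:R + ln delta^-1 + ln p^-1 + ln lam1^-1
    + ln (lam1 / lamk) + ln eps^-1.

(* Main.v *)
Require Import Defs.
From HB Require Import structures.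
From mathcomp Require Import all_boot all_order all_algebra.
From mathcomp Require Import all_classical all_reals all_analysis.
From mathcomp Require Import measurable_realfun.
From mathcomp Require Import ring lra zify.

Set Implicit Arguments.
Unset Strict Implicit.
Unset Printing Implicit Defensive.

Import Order.TTheory GRing.Theory Num.Theory.
Import numFieldNormedType.Exports.

Local Open Scope classical_set_scope.
Local Open Scope ring_scope.

(* AppxPCA started at [w0] on a matrix [N] with top eigenvalue [mu] is governed by
   [B = (lam - N)^-1].  The norms [|B^j w0|] are log-convex in [j], so if [w0] is
   not nearly orthogonal to a top eigenvector, the Rayleigh quotient of [B^m1 w0]
   is a constant fraction of [1 / (lam - mu)], and one round shrinks [lam - mu] by
   a factor between 3/8 and 3/4.  Hence there are O(log (1 / (delta mu))) rounds,
   and [lam - mu] is of order at least [delta lam] whenever [A] is called, which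
   bounds the cost of each call.

   In LazySVD, Courant-Fischer gives [mu >= lam_k] for every deflated matrix,
   however bad the columns found before.  A start vector is good with probability
   at least [1 - p / k]: it is independent of the deflated matrix, and by rotation
   invariance the probability that a uniform unit vector is nearly orthogonal to a
   fixed direction is the average of this probability over the directions of a
   fine cubic grid, where it is small for every fixed vector.

   The program unrolls the [k] calls to AppxPCA; the deflated matrix is presented
   to AGD as a product of [2 s] projections and [M], and to SVRG by projecting the
   vectors [a_i] after each call. *)

(** * Inner products and reflections *)

(** Only running time and exact agreement with LazySVD are at stake, so nothing is shown about the
    quality of the columns: geometrically, only [l2norm (v j) <= 1] is used. No eigenvector of a
    deflated matrix is chosen either, since it would have to depend measurably on the earlier
    columns. Instead [mu] is the supremum of the Rayleigh quotient, and the vector [q] compared with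
    the start vector only has to reach it up to the factor [1 - sigma ^+ 2], with [sigma] so small
    that [m1] applications of [B] hardly tell [q] from an eigenvector. The lower bound on [lam - mu]
    comes from the exit test: a round that does not stop has [gap > delta lam / 3], and [gap] is
    comparable to [lam - mu]. The fourth power of the hidden logarithm has two sources: rounds times
    [m1] gives two factors, and the logarithm of the accuracy, of order [m1] times
    [log (1 / delta)], gives two more. *)

Section InnerProduct.
Variable R : realType.
Implicit Types d : nat.

Lemma dotE d (x y : 'cV[R]_d) : dot x y = (x^T *m y) 0 0.
Proof. by rewrite mxE; apply: eq_bigr => i _; rewrite mxE. Qed.

Lemma dotC d (x y : 'cV[R]_d) : dot x y = dot y x.
Proof. by apply: eq_bigr => i _; rewrite mulrC. Qed.

Lemma dotDr d (x y z : 'cV[R]_d) : dot x (y + z) = dot x y + dot x z.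
Proof. by rewrite !dotE mulmxDr mxE. Qed.

Lemma dotDl d (x y z : 'cV[R]_d) : dot (y + z) x = dot y x + dot z x.
Proof. by rewrite dotC dotDr !(dotC x). Qed.

Lemma dotZr d c (x y : 'cV[R]_d) : dot x (c *: y) = c * dot x y.
Proof. by rewrite !dotE -scalemxAr mxE. Qed.

Lemma dotZl d c (x y : 'cV[R]_d) : dot (c *: x) y = c * dot x y.
Proof. by rewrite dotC dotZr dotC. Qed.

Lemma dotNr d (x y : 'cV[R]_d) : dot x (- y) = - dot x y.
Proof. by rewrite !dotE mulmxN mxE. Qed.

Lemma dotNl d (x y : 'cV[R]_d) : dot (- x) y = - dot x y.
Proof. by rewrite dotC dotNr dotC. Qed.

Lemma dot0r d (x : 'cV[R]_d) : dot x 0 = 0.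
Proof. by rewrite dotE mulmx0 mxE. Qed.

Lemma dot_mulmxr d n (x : 'cV[R]_d) (N : 'M[R]_(d, n)) y :
  dot x (N *m y) = dot (N^T *m x) y.
Proof. by rewrite !dotE trmx_mul trmxK mulmxA. Qed.

Lemma dot_outer d (x u w y : 'cV[R]_d) :
  dot x (u *m w^T *m y) = dot u x * dot w y.
Proof.
rewrite -mulmxA (_ : w^T *m y = (dot w y)%:M) ?mul_mx_scalar ?dotZr 1?mulrC 1?(dotC x) //.
by apply/matrixP => i j; rewrite !ord1 dotE [RHS]mxE eqxx mulr1n.
Qed.

Lemma outer_mulmx d (u w y : 'cV[R]_d) : u *m w^T *m y = dot w y *: u.
Proof.
rewrite -mulmxA (_ : w^T *m y = (dot w y)%:M) ?mul_mx_scalar //.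
by apply/matrixP => i j; rewrite !ord1 dotE [RHS]mxE eqxx mulr1n.
Qed.

Lemma dot_ge0 d (x : 'cV[R]_d) : 0 <= dot x x.
Proof. by apply: sumr_ge0 => i _; rewrite -expr2 sqr_ge0. Qed.

Lemma dot_eq0 d (x : 'cV[R]_d) : (dot x x == 0) = (x == 0).
Proof.
apply/eqP/eqP => [h|->]; last by rewrite dot0r.
apply/colP => i; rewrite mxE; apply/eqP.
move: h; rewrite /dot => h.
have : \sum_i x i 0 ^+ 2 == 0 by apply/eqP; rewrite -[RHS]h; apply: eq_bigr => j _; rewrite expr2.
rewrite psumr_eq0; last by move=> j _; rewrite sqr_ge0.
by move=> /allP/(_ i); rewrite mem_index_enum sqrf_eq0 => /(_ isT).
Qed.

Lemma dot_gt0 d (x : 'cV[R]_d) : (0 < dot x x) = (x != 0).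
Proof. by rewrite lt_def dot_ge0 andbT dot_eq0. Qed.

Lemma l2norm_ge0 d (x : 'cV[R]_d) : 0 <= l2norm x.
Proof. exact: sqrtr_ge0. Qed.

Lemma sqr_l2norm d (x : 'cV[R]_d) : l2norm x ^+ 2 = dot x x.
Proof. by rewrite sqr_sqrtr ?dot_ge0. Qed.

Lemma l2norm0 d : l2norm (0 : 'cV[R]_d) = 0.
Proof. by rewrite /l2norm dot0r sqrtr0. Qed.

Lemma l2norm_eq0 d (x : 'cV[R]_d) : (l2norm x == 0) = (x == 0).
Proof. by rewrite -dot_eq0 -sqr_l2norm sqrf_eq0. Qed.

Lemma l2norm_gt0 d (x : 'cV[R]_d) : (0 < l2norm x) = (x != 0).
Proof. by rewrite lt_def l2norm_ge0 andbT l2norm_eq0. Qed.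

Lemma l2normZ d c (x : 'cV[R]_d) : l2norm (c *: x) = `|c| * l2norm x.
Proof.
by rewrite /l2norm dotZl dotZr mulrA -expr2 sqrtrM ?sqr_ge0 // sqrtr_sqr.
Qed.

Lemma l2normN d (x : 'cV[R]_d) : l2norm (- x) = l2norm x.
Proof. by rewrite -scaleN1r l2normZ normrN1 mul1r. Qed.

Lemma l2norm_normalize d (x : 'cV[R]_d) : x != 0 -> l2norm (normalize x) = 1.
Proof.
rewrite -l2norm_gt0 => x0.
by rewrite l2normZ ger0_norm ?invr_ge0 ?l2norm_ge0 // mulVf // gt_eqF.
Qed.

Lemma l2norm_normalize_le1 d (x : 'cV[R]_d) : l2norm (normalize x) <= 1.
Proof.
have [->|/l2norm_normalize -> //] := eqVneq x 0.
by rewrite /normalize scaler0 l2norm0.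
Qed.

(** The form at [x + t *: y] is a nonnegative polynomial in [t]. For [c > 0] it is evaluated at its
    minimizer [- b / c]; for [c = 0] it is affine, and if [b != 0] its value at [- (a + 1) / b]
    would be [- a - 2 < 0]. *)
Lemma psd_cauchy_schwarz d (N : 'M[R]_d) (x y : 'cV[R]_d) : psd N ->
  dot x (N *m y) ^+ 2 <= dot x (N *m x) * dot y (N *m y).
Proof.
move=> [sN pN].
have sy u w : dot u (N *m w) = dot w (N *m u) by rewrite dot_mulmxr sN dotC.
set a := dot x (N *m x); set b := dot x _; set c := dot y _.
have q t : 0 <= a + t * b * 2 + t ^+ 2 * c.
  have := pN (x + t *: y).
  rewrite mulmxDr -scalemxAr !(dotDl, dotDr, dotZl, dotZr) (sy y x).
  by rewrite -/a -/b -/c (_ : _ + _ = a + t * b * 2 + t ^+ 2 * c) //; ring.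
have c0 : 0 <= c by apply: pN.
have a0 : 0 <= a by apply: pN.
move: c0; rewrite le_eqVlt => /orP[/eqP c0|c0]; last first.
  have := q (- (b / c)); rewrite (_ : _ + _ = a - b ^+ 2 / c); last by field; rewrite gt_eqF.
  by rewrite subr_ge0 ler_pdivrMr.
rewrite -c0 mulr0.
have [->|b0] := eqVneq b 0; first by rewrite expr0n.
have b20 : 0 < b ^+ 2 by rewrite lt_def sqrf_eq0 b0 sqr_ge0.
have := q (- ((a + 1) / b)); rewrite -c0 mulr0 addr0.
rewrite (_ : _ + _ = - a - 2); last by field.
by move=> ?; lra.
Qed.

Lemma psd1 d : psd (1%:M : 'M[R]_d).
Proof. by split => [|x]; rewrite ?mul1mx ?dot_ge0 // /sym trmx1. Qed.

Lemma cauchy_schwarz d (x y : 'cV[R]_d) : `|dot x y| <= l2norm x * l2norm y.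
Proof.
rewrite -(@ler_pXn2r _ 2) ?nnegrE ?mulr_ge0 ?l2norm_ge0 //.
by rewrite real_normK ?num_real // exprMn !sqr_l2norm; have := psd_cauchy_schwarz x y (psd1 d);
  rewrite !mul1mx.
Qed.

Lemma dot_le d (x y : 'cV[R]_d) : dot x y <= l2norm x * l2norm y.
Proof. exact: le_trans (ler_norm _) (cauchy_schwarz x y). Qed.

Lemma l2normD d (x y : 'cV[R]_d) : l2norm (x + y) <= l2norm x + l2norm y.
Proof.
rewrite -(@ler_pXn2r _ 2) ?nnegrE ?addr_ge0 ?l2norm_ge0 //.
rewrite sqrrD !sqr_l2norm dotDl !dotDr (dotC y x).
have := dot_le x y; move: (_ * _) => u; move: (dot x y) => v h.
lra.
Qed.

(** This is [N^2 <= b N] without diagonalizing: Cauchy-Schwarz for the form of [N] at [N x] and [x]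
    gives [|N x|^4 <= (N x, N N x) (x, N x) <= b |N x|^2 (x, N x)], and [|N x|^2] is cancelled. *)
Lemma psd_sqr_le d (N : 'M[R]_d) (b : R) (x : 'cV[R]_d) :
  psd N -> (forall y, dot y (N *m y) <= b * dot y y) ->
  dot (N *m x) (N *m x) <= b * dot x (N *m x).
Proof.
move=> pN hb.
have := psd_cauchy_schwarz (N *m x) x pN.
rewrite -[dot (N *m x) (N *m x) in X in X -> _]/(dot _ _).
set u := dot (N *m x) (N *m x); set w := dot x _ => h.
have w0 : 0 <= w by apply: pN.2.
have h2 : u ^+ 2 <= b * u * w by apply: le_trans h _; rewrite ler_wpM2r // hb.
have [u0|u0] := ltP 0 u; first by rewrite -(ler_pM2l u0); move: h2; rewrite expr2; lra.
have u00 : u = 0 by apply/eqP; rewrite eq_le u0 dot_ge0.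
rewrite u00.
have [x0|x0] := eqVneq x 0; first by rewrite /w x0 mulmx0 dot0r mulr0.
have := le_trans (pN.2 x) (hb x); rewrite pmulr_lge0 ?dot_gt0 // => b0.
exact: mulr_ge0.
Qed.

(** For [h = 0] division by zero gives 0 and this is the identity, so [householder (u - w)] also
    covers [u = w]. *)
Definition householder d (h : 'cV[R]_d) : 'M[R]_d :=
  1%:M - (2 / dot h h) *: (h *m h^T).

Lemma householder_sym d (h : 'cV[R]_d) : (householder h)^T = householder h.
Proof. by rewrite /householder linearB /= linearZ /= trmx1 trmx_mul trmxK. Qed.

Lemma householder_invol d (h : 'cV[R]_d) :
  householder h *m householder h = 1%:M.
Proof.
rewrite /householder; have [->|h0] := eqVneq h 0.
  by rewrite trmx0 mulmx0 scaler0 subr0 mul1mx.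
rewrite mulmxBl mul1mx mulmxBr mulmx1 -scalemxAl -scalemxAr mulmxA.
rewrite outer_mulmx -scalemxAl !scalerA.
rewrite (_ : _ * _ * _ = 2 / dot h h + 2 / dot h h); last by field; rewrite dot_eq0.
by rewrite scalerDl opprB addrK subrK.
Qed.

Lemma householder_map d (u w : 'cV[R]_d) : dot u u = 1 -> dot w w = 1 ->
  householder (u - w) *m u = w.
Proof.
move=> u1 w1; rewrite /householder mulmxBl mul1mx -scalemxAl outer_mulmx scalerA.
have [->|uw] := eqVneq u w; first by rewrite subrr scaler0 subr0.
have -> : 2 / dot (u - w) (u - w) * dot (u - w) u = 1; last by rewrite scale1r subKr.
have uw0 : dot (u - w) (u - w) != 0 by rewrite dot_eq0 subr_eq0.
apply: (mulIf uw0); rewrite mul1r mulrAC divfK //.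
by rewrite !(dotDl, dotDr, dotNl, dotNr) (dotC w u) u1 w1; ring.
Qed.

End InnerProduct.

(** * Spectral theorem and min-max principle *)

Section Spectral.
Variable R : realType.

Lemma char_poly_conj_invol n (H M : 'M[R]_n) : H *m H = 1%:M ->
  char_poly (H *m M *m H) = char_poly M.
Proof.
move=> HH; rewrite /char_poly /char_poly_mx.
have HHp : map_mx polyC H *m map_mx polyC H = 1%:M.
  by rewrite -map_mxM HH map_mx1.
rewrite (_ : _ - _ = map_mx polyC H *m ('X%:M - map_mx polyC M) *m map_mx polyC H).
  by rewrite !det_mulmx mulrAC -det_mulmx HHp det1 mul1r.
rewrite mulmxBr mulmxBl !map_mxM; congr (_ - _).
by rewrite -scalemx1 -scalemxAr -scalemxAl mulmx1 HHp.
Qed.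

(* A Householder reflection moves an eigenvector to the first basis vector. *)
Lemma sym_spectral n (M : 'M[R]_n) (lam : seq R) : sym M ->
  char_poly M = \prod_(x <- lam) ('X - x%:P) ->
  exists2 U : 'M[R]_n, U^T *m U = 1%:M &
    M = U *m diag_mx (\row_i lam`_i) *m U^T.
Proof.
elim: n M lam => [|n IH] M lam sM cM.
  by exists 1%:M; [rewrite trmx1 mulmx1|apply/matrixP => -[]].
have : size lam = n.+1.
  by have := size_char_poly M; rewrite cM size_prod_XsubC => -[].
case: lam cM => // x lam cM [slam].
have /eigenvalueP[v vM v0] : eigenvalue M x.
  by rewrite eigenvalue_root_char cM big_cons rootM root_XsubC eqxx.
pose u := normalize v^T.
have Mu : M *m u = x *: u.
  rewrite /u /normalize -scalemxAr -[M in M *m _]sM -trmx_mul vM linearZ /=.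
  by rewrite scalerA mulrC -scalerA.
have u1 : dot u u = 1.
  rewrite -sqr_l2norm l2norm_normalize ?expr1n //.
  by apply: contra v0 => /eqP h; rewrite -(trmxK v) h trmx0.
pose e : 'cV[R]_(1 + n) := delta_mx 0 0.
have e1 : dot e e = 1.
  by rewrite /dot (bigD1 ord0) //= big1 => [|i /negPf i0]; rewrite ?addr0 !mxE ?i0 !eqxx ?mulr1 ?mulr0.
pose H : 'M[R]_(1 + n) := householder (e - u).
have HH : H *m H = 1%:M by apply: householder_invol.
have He : H *m e = u by apply: householder_map.
have Hu : H *m u = e by rewrite -He mulmxA HH mul1mx.
have HT : H^T = H by apply: householder_sym.
have [M' defM'] : exists M' : 'M[R]_(1 + n), M' = H *m M *m H by exists (H *m M *m H).
have sM' : M'^T = M' by rewrite defM' !trmx_mul HT sM mulmxA.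
have M'e : M' *m e = x *: e by rewrite defM' -mulmxA He -mulmxA Mu -scalemxAr Hu.
have c0 (i : 'I_(1 + n)) : M' i 0 = x * (i == 0)%:R.
  by move/matrixP/(_ i 0): M'e; rewrite -colE !mxE eqxx andbT.
have dl : dlsubmx M' = 0.
  apply/matrixP => i j; rewrite ord1 !mxE.
  have -> : lshift n (0 : 'I_1) = 0 by apply: val_inj.
  by rewrite c0 -val_eqE /= mulr0.
have M'b : M' = block_mx x%:M 0 0 (drsubmx M').
  rewrite -{1}[M']submxK dl; congr (block_mx _ _ _ _).
    apply/matrixP => i j; rewrite !ord1 !mxE.
    have -> : lshift n (0 : 'I_1) = 0 by apply: val_inj.
    by rewrite c0 !eqxx mulr1 mulr1n.
  by rewrite -[ursubmx M']trmxK trmx_ursub sM' dl trmx0.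
have sM'' : sym (drsubmx M') by rewrite /sym trmx_drsub sM'.
have cM'' : char_poly (drsubmx M') = \prod_(x <- lam) ('X - x%:P).
  have : char_poly M' = char_poly M by rewrite defM' char_poly_conj_invol.
  rewrite cM big_cons {1}M'b /char_poly char_block_diag_mx det_ublock.
  rewrite {1}/char_poly_mx map_scalar_mx -raddfB /= det_scalar1.
  by move/mulfI; apply; rewrite polyXsubC_eq0.
have [U UU dM] := IH _ _ sM'' cM''.
pose W : 'M[R]_(1 + n) := block_mx 1%:M 0 0 U.
have WT : W^T = block_mx 1%:M 0 0 U^T by rewrite /W tr_block_mx !trmx0 trmx1.
exists (H *m W).
  rewrite trmx_mul HT mulmxA -(mulmxA _ H H) HH mulmx1 WT.
  rewrite (@mulmx_block R 1 n 1 n 1 n) !(mulmx0, mul0mx, mulmx1, addr0, add0r) UU.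
  by rewrite -scalar_mx_block.
have -> : M = H *m M' *m H.
  by rewrite defM' !mulmxA HH mul1mx -mulmxA HH mulmx1.
rewrite trmx_mul HT !mulmxA; congr (_ *m _); rewrite -!mulmxA; congr (_ *m _).
set D := diag_mx _.
have DE : D = (block_mx x%:M 0 0 (diag_mx (\row_i lam`_i)) : 'M[R]_(1 + n)).
  apply/matrixP => i j; rewrite /D; case: (@split_ordP 1 n i) => i' ->;
    case: (@split_ordP 1 n j) => j' ->.
  - apply: etrans (esym (block_mxEul _ _ _ _ i' j')); rewrite !mxE !ord1 eqxx //.
  - apply: etrans (esym (block_mxEur _ _ _ _ i' j')); rewrite !mxE -val_eqE /= ?ord1 //.
  - apply: etrans (esym (block_mxEdl _ _ _ _ i' j')); rewrite !mxE -val_eqE /= ?ord1 //.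
  - apply: etrans (esym (block_mxEdr _ _ _ _ i' j')); rewrite !mxE -!val_eqE /= eqSS //.
rewrite M'b WT DE /W.
by rewrite !(@mulmx_block R 1 n 1 n 1 n) !(mulmx0, mul0mx, mulmx1, mul1mx, addr0, add0r) mulmxA -dM.
Qed.

Lemma spectrum_size n (M : 'M[R]_n) lam : spectrum M lam -> size lam = n.
Proof. by case=> _ cM; have := size_char_poly M; rewrite cM size_prod_XsubC => -[]. Qed.

Lemma dot_diag n (U : 'M[R]_n) (l : 'rV[R]_n) (x : 'cV[R]_n) :
  dot x (U *m diag_mx l *m U^T *m x) = \sum_i l 0 i * (U^T *m x) i 0 ^+ 2.
Proof.
rewrite -!mulmxA dot_mulmxr; apply: eq_bigr => i _.
by rewrite mul_diag_mx [X in _ * X = _]mxE mulrCA expr2.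
Qed.

Lemma spectrum_bounds n (M : 'M[R]_n) lam : sym M -> spectrum M lam ->
  all (fun x => 0 <= x <= 1) lam ->
  forall x : 'cV[R]_n, 0 <= dot x (M *m x) <= dot x x.
Proof.
move=> sM sp /all_nthP-/(_ 0) lam01 x.
have [U UU ->] := sym_spectral sM sp.2.
have lb (i : 'I_n) : 0 <= lam`_i <= 1 by apply: lam01; rewrite (spectrum_size sp).
rewrite dot_diag; apply/andP; split.
  by apply: sumr_ge0 => i _; rewrite mxE mulr_ge0 ?sqr_ge0 //; case/andP: (lb i).
have -> : dot x x = dot (U^T *m x) (U^T *m x).
  by rewrite dot_mulmxr trmxK mulmxA (mulmx1C UU) mul1mx.
apply: ler_sum => i _; rewrite mxE -expr2 ler_piMl ?sqr_ge0 //.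
by case/andP: (lb i).
Qed.

(* The first [k] eigenvectors span a space of dimension [k > s]. *)
Lemma spectrum_minmax n (M : 'M[R]_n) lam k s (W : 'M[R]_(s, n)) :
  sym M -> spectrum M lam -> (s < k <= n)%N ->
  exists2 y : 'cV[R]_n, y != 0 &
    W *m y = 0 /\ lam`_k.-1 * dot y y <= dot y (M *m y).
Proof.
move=> sM sp /andP[sk kn].
have [U UU dM] := sym_spectral sM sp.2.
pose P : 'M[R]_(n, k) := \matrix_(i, j) (i == j :> nat)%:R.
(* [kermx] is a left kernel, hence the transposes; [W U P] has [s] rows and [k > s] columns. *)
have /rowV0Pn[z zker z0] : kermx (W *m U *m P)^T != 0.
  rewrite -mxrank_eq0 mxrank_ker -lt0n subn_gt0.
  exact: leq_ltn_trans (rank_leq_col _) sk.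
have Wz : W *m U *m P *m z^T = 0.
  by move/sub_kermxP: zker => h; rewrite -[LHS]trmxK trmx_mul trmxK h trmx0.
pose c := P *m z^T.
have cE (i : 'I_n) (j : 'I_k) : i = j :> nat -> c i 0 = z 0 j.
  move=> ij; rewrite mxE (bigD1 j) //= big1 => [|l lj].
    by rewrite !mxE ij eqxx mul1r addr0.
  by rewrite !mxE ij eq_sym (inj_eq (@ord_inj _)) (negPf lj) mul0r.
have cE0 (i : 'I_n) : (k <= i)%N -> c i 0 = 0.
  move=> ki; rewrite mxE big1 // => l _; rewrite mxE.
  by rewrite gtn_eqF ?mul0r //; apply: leq_trans ki.
have cy : U^T *m (U *m c) = c by rewrite mulmxA UU mul1mx.
exists (U *m c).
  apply: contraNneq z0 => h; apply/eqP/rowP => j.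
  by rewrite -(cE (widen_ord kn j)) // -cy h mulmx0 !mxE.
split; first by rewrite /c !mulmxA.
rewrite {1}dM dot_diag cy dot_mulmxr cy mulr_sumr.
apply: ler_sum => i _; rewrite [X in _ <= X * _]mxE -expr2.
have [ki|ik] := leqP k i; first by rewrite cE0 // expr0n !mulr0.
rewrite ler_wpM2r ?sqr_ge0 //.
have k0 : (0 < k)%N by apply: leq_ltn_trans ik.
apply: (sorted_leq_nth _ _ 0 sp.1); rewrite ?inE ?(spectrum_size sp) //.
- by move=> a b e ab be; apply: le_trans be ab.
- by rewrite prednK.
by rewrite -ltnS prednK.
Qed.

End Spectral.

(** * Inverse power iterations *)

Section Resolvent.
Variables (R : realType) (d : nat) (N : 'M[R]_d) (mu lam : R).
Hypotheses (pN : psd N) (Nmu : forall y : 'cV[R]_d, dot y (N *m y) <= mu * dot y y).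
Hypothesis mulam : mu < lam.

Local Notation D := (lam - mu).
Local Notation T := (lam%:M - N).
Local Notation B := (invmx T).

Let D0 : 0 < D. Proof. by rewrite subr_gt0. Qed.

Lemma shift_sym : sym T.
Proof. by rewrite /sym linearB /= tr_scalar_mx pN.1. Qed.

Lemma dot_shift (x : 'cV[R]_d) : D * dot x x <= dot x (T *m x).
Proof.
rewrite mulmxBl mul_scalar_mx dotDr dotNr dotZr.
by have := Nmu x; move: (dot x x) (dot x _) => u w; lra.
Qed.

Lemma shift_posdef : posdef T.
Proof.
split=> [|x x0]; first exact: shift_sym.
by apply: lt_le_trans (dot_shift x); rewrite mulr_gt0 // dot_gt0.
Qed.

Lemma shift_gap_psd : psd (T - D%:M).
Proof.
split=> [|x].
  by rewrite /sym linearB /= tr_scalar_mx shift_sym.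
by rewrite mulmxBl mul_scalar_mx dotDr dotNr dotZr subr_ge0 dot_shift.
Qed.

Lemma shift_unit : T \in unitmx.
Proof.
rewrite -row_free_unit -kermx_eq0; apply/rowV0P => v /sub_kermxP vT.
apply/eqP; apply: contraTT isT => v0.
have vT0 : v^T != 0 by apply: contra v0 => /eqP h; rewrite -(trmxK v) h trmx0.
have := shift_posdef.2 _ vT0.
by rewrite -[T in dot _ (T *m _)]shift_sym -trmx_mul vT trmx0 dot0r ltxx.
Qed.

Lemma mul_shift_inv (x : 'cV[R]_d) : T *m (B *m x) = x.
Proof. by rewrite mulmxA mulmxV ?shift_unit // mul1mx. Qed.

Lemma dot_inv_shift (x y : 'cV[R]_d) : dot (B *m x) y = dot x (B *m y).
Proof. by rewrite dot_mulmxr trmx_inv shift_sym. Qed.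

(** This is [D B^2 <= B], the bound [T >= D] taken at [B x]. It bounds the norm of [B], and in a
    round it turns a lower bound on [|B x|] into one on the Rayleigh quotient of [B]. *)
Lemma inv_shift_form (x : 'cV[R]_d) :
  D * dot (B *m x) (B *m x) <= dot x (B *m x).
Proof.
by apply: le_trans (dot_shift _) _; rewrite mul_shift_inv dotC.
Qed.

Lemma l2norm_inv_shift (x : 'cV[R]_d) : l2norm (B *m x) <= D^-1 * l2norm x.
Proof.
rewrite mulrC ler_pdivlMr //.
have [->|y0] := eqVneq (B *m x) 0; first by rewrite l2norm0 mul0r l2norm_ge0.
have := le_trans (inv_shift_form x) (dot_le _ _).
rewrite -sqr_l2norm expr2 mulrA ler_pM2r ?l2norm_gt0 //.
by rewrite mulrC.
Qed.

Lemma dot_inv_shift_le (x : 'cV[R]_d) :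
  dot x (B *m x) <= D^-1 * l2norm x ^+ 2.
Proof.
apply: le_trans (dot_le _ _) _; rewrite expr2 mulrCA.
by rewrite ler_wpM2l ?l2norm_ge0 // l2norm_inv_shift.
Qed.

Definition resolvent_iter (j : nat) (x : 'cV[R]_d) := iter j (mulmx B) x.
Local Notation BB := resolvent_iter.

(** [B] is symmetric, so [|B^(j+1) x|^2 = (B^j x, B^(j+2) x)]. *)
Lemma resolvent_iter_logconvex j x :
  l2norm (BB j.+1 x) ^+ 2 <= l2norm (BB j x) * l2norm (BB j.+2 x).
Proof.
by rewrite sqr_l2norm /= dot_inv_shift; apply: dot_le.
Qed.

Lemma dot_resolvent_iter j x y : dot (BB j x) y = dot x (BB j y).
Proof.
elim: j x y => // j IH x y.
by rewrite /= dot_inv_shift IH /BB -iterSr.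
Qed.

(* As [T = D + G] with [G = mu - N], [B q - q / D = - B G q / D], and
   [G^2 <= mu G]. *)
Lemma resolvent_near_eigen (sigma : R) q : 0 <= mu -> 0 <= sigma ->
  l2norm q = 1 -> (1 - sigma ^+ 2) * mu <= dot q (N *m q) ->
  l2norm (B *m q - D^-1 *: q) <= D^-1 * (D^-1 * (sigma * mu)).
Proof.
move=> mu0 s0 q1 hq.
pose G := mu%:M - N.
have GE x : dot x (G *m x) = mu * dot x x - dot x (N *m x).
  by rewrite mulmxBl mul_scalar_mx dotDr dotNr dotZr.
have pG : psd G.
  split=> [|x]; first by rewrite /sym linearB /= tr_scalar_mx pN.1.
  by rewrite GE subr_ge0.
have Gmu x : dot x (G *m x) <= mu * dot x x.
  by rewrite GE gerBl pN.2.
have Gq : l2norm (G *m q) <= sigma * mu.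
  rewrite -(@ler_pXn2r _ 2) ?nnegrE ?mulr_ge0 ?l2norm_ge0 //.
  rewrite sqr_l2norm; apply: le_trans (psd_sqr_le _ pG Gmu) _.
  rewrite GE -sqr_l2norm q1 expr1n mulr1 exprMn expr2 mulrCA.
  by rewrite ler_wpM2l //; move: hq; rewrite mulrBl mul1r expr2; lra.
have -> : B *m q - D^-1 *: q = - (D^-1 *: (B *m (G *m q))).
  have e : G *m q = T *m q - D *: q.
    rewrite /G !mulmxBl !mul_scalar_mx scalerBl.
    by rewrite opprB [RHS]addrC subrKA.
  rewrite e mulmxBr mulmxA mulVmx ?shift_unit // mul1mx -scalemxAr.
  by rewrite scalerBr scalerA mulVf ?gt_eqF // scale1r opprB.
rewrite l2normN l2normZ ger0_norm ?invr_ge0 ?(ltW D0) //.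
rewrite ler_pM2l ?invr_gt0 //; apply: le_trans (l2norm_inv_shift _) _.
by rewrite ler_pM2l ?invr_gt0.
Qed.

(** With [b = D^-1], [B^(j+1) q - b^(j+1) q = B (B^j q - b^j q) + b^j (B q - b q)]; since
    [|B| <= b], each step adds at most [e] to the error relative to [b^j]. *)
Lemma resolvent_iter_near_eigen (e : R) q j : 0 <= e ->
  l2norm (B *m q - D^-1 *: q) <= D^-1 * e ->
  l2norm (BB j q - D^-1 ^+ j *: q) <= j%:R * e * D^-1 ^+ j.
Proof.
move=> e0 hq; elim: j => [|j IH].
  by rewrite expr0 scale1r subrr l2norm0 !mul0r.
have -> : BB j.+1 q - D^-1 ^+ j.+1 *: q =
    B *m (BB j q - D^-1 ^+ j *: q) + D^-1 ^+ j *: (B *m q - D^-1 *: q).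
  rewrite mulmxBr -scalemxAr scalerBr scalerA -exprSr addrA subrK.
  by [].
apply: le_trans (l2normD _ _) _.
have b0 : 0 < D^-1 by rewrite invr_gt0.
rewrite l2normZ ger0_norm ?exprn_ge0 ?(ltW b0) //.
apply: le_trans (lerD (l2norm_inv_shift _) (lexx _)) _.
apply: le_trans (lerD (ler_wpM2l (ltW b0) IH) (ler_wpM2l (exprn_ge0 _ (ltW b0)) hq)) _.
by rewrite -natr1 exprS le_eqVlt; apply/orP; left; apply/eqP; ring.
Qed.

(** In [(B^m x, q)] the power is moved onto [q], where it acts as [D^-1 ^+ m] up to relative error
    [m e]; this error costs at most half of the overlap [t]. *)
Lemma resolvent_iter_lower (e t : R) q x m : 0 <= e ->
  l2norm (B *m q - D^-1 *: q) <= D^-1 * e -> l2norm q = 1 -> l2norm x = 1 ->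
  t <= `|dot x q| -> m%:R * e <= t / 2 ->
  D^-1 ^+ m * (t / 2) <= l2norm (BB m x).
Proof.
move=> e0 hq q1 x1 tx me.
have b0 : 0 <= D^-1 ^+ m by rewrite exprn_ge0 // invr_ge0 ltW.
have h1 : `|dot x (D^-1 ^+ m *: q)| <=
   `|dot x (BB m q)| + `|dot x (BB m q - D^-1 ^+ m *: q)|.
  by rewrite dotDr dotNr -[X in `|X| <= _](subKr (dot x (BB m q))) ler_normB.
have h2 : `|dot x (BB m q)| <= l2norm (BB m x).
  rewrite -dot_resolvent_iter; apply: le_trans (cauchy_schwarz _ _) _.
  by rewrite q1 mulr1.
have h3 : `|dot x (BB m q - D^-1 ^+ m *: q)| <= m%:R * e * D^-1 ^+ m.
  apply: le_trans (cauchy_schwarz _ _) _; rewrite x1 mul1r.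
  exact: resolvent_iter_near_eigen.
move: h1; rewrite dotZr normrM (ger0_norm b0) => h1.
have h4 : D^-1 ^+ m * t <= D^-1 ^+ m * `|dot x q| by rewrite ler_wpM2l.
have h5 : m%:R * e * D^-1 ^+ m <= t / 2 * D^-1 ^+ m by rewrite ler_wpM2r.
by move: h1 h2 h3 h4 h5; set u := D^-1 ^+ m; lra.
Qed.

(** The error obeys [e' <= eps + D^-1 e]. Enlarging the rate to [r = 3 / 2 * D^-1], which is at
    least 1 when [D <= 3 / 2], allows each fresh [eps] to be bounded by [eps r^(j+1)], so that the
    errors simply add up. *)
Lemma noisy_iter (eps : R) (f : 'cV[R]_d -> 'cV[R]_d) x j : 0 <= eps ->
  (forall y, l2norm (f y - B *m y) <= eps) -> 1 <= 3 / 2 * D^-1 ->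
  l2norm (iter j f x - BB j x) <= j%:R * eps * (3 / 2 * D^-1) ^+ j.
Proof.
move=> e0 hf r1; set r := 3 / 2 * D^-1; elim: j => [|j IH].
  by rewrite subrr l2norm0 !mul0r.
have b0 : 0 < D^-1 by rewrite invr_gt0.
have -> : iter j.+1 f x - BB j.+1 x =
    (f (iter j f x) - B *m iter j f x) + B *m (iter j f x - BB j x).
  by rewrite mulmxBr addrA subrK.
apply: le_trans (l2normD _ _) _.
apply: le_trans (lerD (hf _) (l2norm_inv_shift _)) _.
have rj : 1 <= r ^+ j.+1 by rewrite exprn_ege1.
have r0 : 0 <= r ^+ j by rewrite exprn_ge0 // (le_trans ler01).
have h1 : D^-1 * l2norm (iter j f x - BB j x) <= r * (j%:R * eps * r ^+ j).
  rewrite ler_pM ?l2norm_ge0 ?(ltW b0) // /r; lra.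
have h2 : eps <= eps * r ^+ j.+1 by rewrite ler_peMr.
rewrite -natr1 mulrDl mul1r mulrDl; move: h1 h2; rewrite exprS.
by move=> h1 h2; apply: le_trans (lerD h2 h1) _; rewrite addrC le_eqVlt;
  apply/orP; left; apply/eqP; ring.
Qed.

End Resolvent.

(** The ratios [a j.+1 / a j] are nondecreasing. If the one at [m] were below [r], all earlier ones
    would be too, and their product would give [a m < r ^+ m]. *)
Lemma logconvex_ratio (R : realType) (a : nat -> R) (r : R) m : (0 < m)%N ->
  (forall j, 0 <= a j) -> (forall j, a j.+1 ^+ 2 <= a j * a j.+2) ->
  a 0%N <= 1 -> 0 < r -> r ^+ m <= a m -> r * a m <= a m.+1.
Proof.
move=> m0 a0 lc a01 r0 rm; rewrite leNgt; apply/negP => lt.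
have am : 0 < a m by apply: lt_le_trans rm; rewrite exprn_gt0.
(* The ratios make sense because a zero before [m] would, by log-convexity, make its successor
   vanish. *)
have ap j : (j <= m)%N -> 0 < a (m - j)%N.
  elim: j => [|j IH] jm; first by rewrite subn0.
  have := IH (ltnW jm); rewrite -subnSK // => h.
  rewrite lt_def a0 andbT; apply: contraTneq (lc (m - j.+1)%N) => ->.
  by rewrite mul0r -ltNge exprn_gt0.
have dec j : (j <= m)%N -> a (m - j).+1 < r * a (m - j)%N.
  elim: j => [|j IH] jm; first by rewrite subn0.
  have h1 := IH (ltnW jm); have h2 := ap _ (ltnW jm); have h3 := ap _ jm.
  move: h1 h2 h3 (lc (m - j.+1)%N); rewrite -(subnSK jm).
  set x := a _; set y := a _; set z := a _ => h1 h2 h3 h4.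
  rewrite -(ltr_pM2r h2) -expr2; apply: le_lt_trans h4 _.
  by rewrite (mulrC r) -mulrA ltr_pM2l.
have up j : (0 < j <= m)%N -> a j < r ^+ j.
  elim: j => // -[|j] IH /andP[_ jm].
    have := dec m (leqnn _); rewrite subnn expr1 => h.
    by apply: lt_le_trans h _; rewrite ger_pMr.
  have := dec (m - j.+1)%N (leq_subr _ _); rewrite subKn ?(ltnW jm) // => h.
  by apply: lt_trans h _; rewrite exprS ltr_pM2l // IH //= ltnW.
by have := up m; rewrite m0 leqnn => /(_ isT); rewrite ltNge rm.
Qed.

(** * Rounds of AppxPCA *)

Section AppxPCA.
Variable R : realType.

Lemma natr_absz_ceil (x : R) : 0 <= x -> x <= `|Num.ceil x|%N%:R < x + 1.
Proof.
move=> x0; have c0 : 0 <= Num.ceil x by rewrite ceil_ge0 (lt_le_trans _ x0) ?ltrN10.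
rewrite natr_absz ger0_norm // real_ceil_ge ?num_real //=.
by have := real_ceilB1_lt (num_real x); rewrite intrB; lra.
Qed.

Lemma exprn_le_inv (x y : R) m : 0 <= x <= 1 -> 0 < y -> ln y <= x * m%:R ->
  (1 - x) ^+ m <= y^-1.
Proof.
move=> /andP[x0 x1] y0 h.
have h1 : (1 - x) ^+ m <= expR (- x) ^+ m.
  by rewrite lerXn2r ?nnegrE ?expR_ge0 ?subr_ge0 //; apply: expR_ge1Dx.
apply: le_trans h1 _; rewrite -expRM_natl -[y in y^-1]lnK ?posrE // -expRN ler_expR.
by rewrite mulrN lerN2 mulrC.
Qed.

Variables (d : nat) (A : method R d) (N : 'M[R]_d) (mu : R).
Hypotheses (accA : accurate A) (pN : psd N).
Hypothesis Nmu : forall y : 'cV[R]_d, dot y (N *m y) <= mu * dot y y.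
Variables (delta eps p : R) (w0 : 'cV[R]_d).
Hypotheses (d0 : (0 < d)%N) (delta_gt0 : 0 < delta) (delta_le : delta <= 1 / 2).
Hypotheses (p0 : 0 < p) (p1 : p <= 1) (w01 : l2norm w0 = 1).
Hypotheses (mu0 : 0 < mu) (mu1 : mu <= 1).

Local Notation m1 := (pca_m1 d p).
Local Notation eps1 := (pca_eps1 d delta p).
Local Notation gap := (pca_gap A N delta p w0).
Local Notation shift := (pca_shift A N delta p w0).
Local Notation stop := (pca_stop A N delta p w0).

Let y1 : 1 <= 288 * d%:R / p ^+ 2.
Proof.
have hp : p ^+ 2 <= 1 by rewrite exprn_ile1 // ltW.
rewrite ler_pdivlMr ?exprn_gt0 // mul1r; apply: le_trans hp _.
have : (1 : R) <= d%:R by rewrite ler1n.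
by move=> ?; lra.
Qed.

Lemma pca_m1_bounds :
  4 * ln (288 * d%:R / p ^+ 2) <= m1%:R < 4 * ln (288 * d%:R / p ^+ 2) + 1.
Proof. by apply: natr_absz_ceil; rewrite mulr_ge0 // ln_ge0. Qed.

Lemma pca_m1_gt0 : (0 < m1)%N.
Proof.
rewrite -(ltr0n R); case/andP: pca_m1_bounds => h _; apply: lt_le_trans h.
rewrite mulr_gt0 // ln_gt0 // ltr_pdivlMr ?exprn_gt0 // mul1r.
apply: (@le_lt_trans _ _ 1); first by rewrite exprn_ile1 // ltW.
have : (1 : R) <= d%:R by rewrite ler1n.
by move=> ?; lra.
Qed.

(** The choice of [m1] pushes the loss [(2 / 3) ^+ m1] below [p / (4 d)], half the overlap
    [p / (2 d)] that a good start vector provides. *)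
Lemma pca_m1_power : (2 / 3) ^+ m1 <= p / (4 * d%:R).
Proof.
have pp0 := p0; have pp1 := p1; have d1 : (1 : R) <= d%:R by rewrite ler1n.
have -> : p / (4 * d%:R) = (4 * d%:R / p)^-1 by rewrite invf_div.
have -> : (2 / 3 : R) = 1 - 1 / 3 by field.
apply: exprn_le_inv; first by apply/andP; split; lra.
  by rewrite divr_gt0 //; lra.
have l0 : 0 <= ln (288 * d%:R / p ^+ 2) by rewrite ln_ge0.
have : ln (4 * d%:R / p) <= ln (288 * d%:R / p ^+ 2).
  have h1 : 0 < 4 * d%:R / p by rewrite divr_gt0 //; lra.
  have h2 : 0 < 288 * d%:R / p ^+ 2 by apply: lt_le_trans y1.
  rewrite ler_ln ?posrE //.
  rewrite ler_pdivlMr ?exprn_gt0 // expr2 mulrA mulfVK ?gt_eqF //.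
  have : 4 * d%:R * p <= 4 * d%:R * 1 by rewrite ler_wpM2l //; lra.
  by lra.
by case/andP: pca_m1_bounds; lra.
Qed.

Lemma pca_eps1_gt0 : 0 < eps1.
Proof.
rewrite /pca_eps1 mulr_gt0 ?invr_gt0 ?mulr_gt0 ?ltr0n ?pca_m1_gt0 //.
by rewrite exprn_gt0 // divr_gt0.
Qed.

Lemma pca_eps1_le : eps1 <= 1 / 768.
Proof.
have dl0 := delta_gt0; have dl1 := delta_le.
have m0 : (1 : R) <= m1%:R by rewrite ler1n pca_m1_gt0.
rewrite /pca_eps1 (_ : 1 / 768 = 64^-1 * (1 / 12)); last by field.
have dl6 : 0 <= delta / 6 by lra.
have m64 : 64 <= 64 * m1%:R :> R by rewrite ler_peMr.
apply: ler_pM; first by rewrite invr_ge0 mulr_ge0.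
- exact: exprn_ge0.
- by rewrite lef_pV2 ?posrE // (lt_le_trans _ m64).
rewrite -(prednK pca_m1_gt0) exprS.
have E1 : (delta / 6) ^+ m1.-1 <= 1.
  by apply: exprn_ile1; lra.
move: (_ ^+ m1.-1) E1 => E E1.
by apply: (le_trans (ler_wpM2l dl6 E1)); lra.
Qed.

(** The accuracy is tuned for this: [1 / (64 m1)] cancels the factor [m1] of [noisy_iter], and
    [(delta / 6)^m1] brings the rate [3 / 2 * b] down to [delta b / 4], below [2 / 3 * b]. *)
Lemma pca_eps1_noise (b : R) : 0 <= b ->
  m1%:R * eps1 * (3 / 2 * b) ^+ m1 <= (2 / 3 * b) ^+ m1 / 64.
Proof.
move=> b0.
have dl0 := delta_gt0; have dl1 := delta_le.
have m0 : 0 < m1%:R :> R by rewrite ltr0n pca_m1_gt0.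
have -> : m1%:R * eps1 * (3 / 2 * b) ^+ m1 =
    (delta / 6 * (3 / 2 * b)) ^+ m1 / 64.
  rewrite /pca_eps1 [in RHS]exprMn; move: m1 m0 => m m0.
  by move: (_ ^+ m) (_ ^+ m) => u w; field; rewrite gt_eqF.
rewrite ler_pM2r ?invr_gt0 //.
have : delta * b <= 1 / 2 * b by rewrite ler_wpM2r.
have : 0 <= delta * b by rewrite mulr_ge0 // ltW.
by move=> h1 h2; rewrite lerXn2r ?nnegrE; lra.
Qed.

Section Round.
Variable lam : R.
Hypotheses (mulam : mu < lam) (lam32 : lam <= 3 / 2).
Hypothesis lower : (2 / 3 * (lam - mu)^-1) ^+ m1 <=
  l2norm (resolvent_iter N lam m1 w0).

(** With [z = B^m1 w0] and [a = |z|], log-convexity gives [|B z| >= 2/3 b a], and the computed [x]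
    is within [a / 64] of [z]. The Rayleigh quotient of [B] at [x] is at least [D |B x|^2 / |x|^2],
    slightly more than [2/5 b], and at most [b]. Subtracting [eps1] keeps [dot w v - eps1] below [b]
    although [v] is inexact; inverting the interval from [2/5 b] to [b] gives the claim. *)
Lemma pca_gap_bounds : (lam - mu) / 2 <= gap lam <= 5 / 4 * (lam - mu).
Proof.
have mu0' := mu0; have l32 := lam32; have ml := mulam.
set D := lam - mu; set B := invmx (lam%:M - N).
have D0 : 0 < D by rewrite subr_gt0.
have D32 : D <= 3 / 2 by rewrite /D; lra.
set b := D^-1; have b0 : 0 < b by rewrite invr_gt0.
have b23 : 2 / 3 <= b.
  by rewrite -[2 / 3]invf_div lef_pV2 ?posrE //; lra.
pose f w := answer A lam N w eps1.
have hf y : l2norm (f y - B *m y) <= eps1.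
  by apply: accA pca_eps1_gt0; apply: shift_posdef pN Nmu mulam.
have a_eps0 := ltW pca_eps1_gt0; have e1 := pca_eps1_le.
set x := iter m1 f w0; set z := resolvent_iter N lam m1 w0.
set a := l2norm z.
have noise : l2norm (x - z) <= a / 64.
  have b32 : 1 <= 3 / 2 * D^-1 by rewrite -/b; lra.
  apply: le_trans (noisy_iter pN Nmu mulam _ _ a_eps0 hf b32) _.
  apply: le_trans (pca_eps1_noise (ltW b0)) _.
  by rewrite ler_pM2r ?invr_gt0.
have a0 : 0 < a by apply: lt_le_trans lower; rewrite exprn_gt0 // mulr_gt0 // divr_gt0.
have ratio : 2 / 3 * b * a <= l2norm (B *m z).
  apply: (@logconvex_ratio _ (fun j => l2norm (resolvent_iter N lam j w0))) => //.
  - exact: pca_m1_gt0.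
  - by move=> j; apply: l2norm_ge0.
  - by move=> j; exact: resolvent_iter_logconvex.
  - by rewrite /= w01.
  - by rewrite mulr_gt0 // divr_gt0.
have xa : l2norm x <= 65 / 64 * a.
  by have := l2normD (x - z) z; rewrite subrK -/a; lra.
have xa' : 63 / 64 * a <= l2norm x.
  have := l2normD x (- (x - z)); rewrite l2normN opprB addrCA subrr addr0 -/a; lra.
(* [125 / 192 = 2 / 3 - 1 / 64]: the ratio minus the noise. *)
have Bx : 125 / 192 * b * a <= l2norm (B *m x).
  have h1 : l2norm (B *m (x - z)) <= b * (a / 64).
    apply: le_trans (l2norm_inv_shift pN Nmu mulam _) _.
    by rewrite ler_pM2l.
  have := l2normD (B *m x) (- (B *m (x - z))).
  rewrite -mulmxBr (_ : x - (x - z) = z) ?l2normN; last by rewrite opprB addrCA subrr addr0.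
  by lra.
have x0 : 0 < l2norm x by apply: lt_le_trans xa'; rewrite mulr_gt0 // divr_gt0.
set w := normalize x.
have w1 : l2norm w = 1 by apply: l2norm_normalize; rewrite -l2norm_gt0.
have wB_le : dot w (B *m w) <= b.
  by apply: le_trans (dot_inv_shift_le pN Nmu mulam _) _; rewrite w1 expr1n mulr1.
(* [(125 / 192)^2 / (65 / 64)^2] is about 0.411. The surplus [b / 128] pays for [2 * eps1], as
   [b >= 2 / 3] and [eps1 <= 1 / 768]. *)
have wB_ge : 2 / 5 * b + b / 128 <= dot w (B *m w).
  have -> : dot w (B *m w) = dot x (B *m x) / l2norm x ^+ 2.
    by rewrite /w /normalize -scalemxAr dotZl dotZr; field; rewrite gt_eqF.
  rewrite ler_pdivlMr ?exprn_gt0 //.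
  have h := inv_shift_form pN Nmu mulam x.
  have h2 : (125 / 192 * b * a) ^+ 2 <= b * dot x (B *m x).
    apply: (@le_trans _ _ (l2norm (B *m x) ^+ 2)).
      by rewrite lerXn2r ?nnegrE ?l2norm_ge0 // !mulr_ge0 // ltW.
    by rewrite sqr_l2norm mulrC ler_pdivlMr // mulrC.
  have h3 : l2norm x ^+ 2 <= (65 / 64 * a) ^+ 2.
    by rewrite lerXn2r ?nnegrE ?l2norm_ge0 // mulr_ge0 // ltW.
  have h4 : (125 / 192) ^+ 2 * a ^+ 2 * b <= dot x (B *m x).
    by rewrite -(ler_pM2l b0); apply: le_trans h2; rewrite !exprMn expr2; lra.
  apply: le_trans h4; apply: le_trans (ler_wpM2l _ h3) _; first by lra.
  have : 0 <= a ^+ 2 * b by rewrite mulr_ge0 ?sqr_ge0 // ltW.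
  by rewrite exprMn !expr2; lra.
set v := answer A lam N w eps1.
have wv : `|dot w v - dot w (B *m w)| <= eps1.
  rewrite -dotNr -dotDr; apply: le_trans (cauchy_schwarz _ _) _.
  by rewrite w1 mul1r; apply: hf.
have g1 : 2 / 5 * b <= dot w v - eps1.
  by move: wv; rewrite ler_norml => /andP[]; lra.
have g2 : dot w v - eps1 <= b.
  by move: wv; rewrite ler_norml => /andP[]; lra.
have g0 : 0 < dot w v - eps1 by apply: lt_le_trans g1; rewrite mulr_gt0 // divr_gt0.
have -> : gap lam = 1 / 2 * (dot w v - eps1)^-1 by [].
have i1 : D <= (dot w v - eps1)^-1 by rewrite -[D]invrK lef_pV2 ?posrE.
have i2 : (dot w v - eps1)^-1 <= 5 / 2 * D.
  have -> : 5 / 2 * D = (2 / 5 * b)^-1 by rewrite invfM invrK invf_div.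
  by rewrite lef_pV2 ?posrE // mulr_gt0 // divr_gt0.
by apply/andP; split; lra.
Qed.
End Round.

(* [1 - pca_sigma ^+ 2] is how close to [mu] the Rayleigh quotient of [q] has to be
   for [q] to replace a top eigenvector. *)
Definition pca_sigma : R := delta * p / (40 * d%:R * m1%:R).

Variable q : 'cV[R]_d.
Hypotheses (q1 : l2norm q = 1) (qN : (1 - pca_sigma ^+ 2) * mu <= dot q (N *m q)).
Hypothesis qw0 : p / (2 * d%:R) <= `|dot w0 q|.

Lemma pca_lower lam : mu < lam -> delta * lam / 10 <= lam - mu ->
  (2 / 3 * (lam - mu)^-1) ^+ m1 <= l2norm (resolvent_iter N lam m1 w0).
Proof.
move=> mulam gaplam; have D0 : 0 < lam - mu by rewrite subr_gt0.
have hb : (lam - mu)^-1 * (delta * mu) <= 10.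
  rewrite mulrC ler_pdivrMr //.
  have : delta * mu <= delta * lam by rewrite ler_pM2l // ltW.
  by move: gaplam; lra.
have b0 : 0 < (lam - mu)^-1 by rewrite invr_gt0.
have d1 : 0 < d%:R :> R by rewrite ltr0n.
have m0 : 0 < m1%:R :> R by rewrite ltr0n pca_m1_gt0.
have s0 : 0 <= pca_sigma.
  by rewrite /pca_sigma divr_ge0 ?mulr_ge0 // ltW.
have e0 : 0 <= (lam - mu)^-1 * (pca_sigma * mu).
  by rewrite mulr_ge0 ?mulr_ge0 // ltW.
have hq := resolvent_near_eigen pN Nmu mulam (ltW mu0) s0 q1 qN.
have := resolvent_iter_lower (m := m1) pN Nmu mulam e0 hq q1 w01 qw0.
have -> : p / (2 * d%:R) / 2 = p / (4 * d%:R) by field; rewrite gt_eqF.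
move=> h; rewrite exprMn mulrC; apply: le_trans (h _); last first.
  (* The constant 40 of [pca_sigma] comes from here: since [delta mu / (lam - mu) <= 10], the
     relative error is at most [10 p / (40 d) = p / (4 d)], half of the overlap. *)
  have -> : m1%:R * ((lam - mu)^-1 * (pca_sigma * mu)) =
      (lam - mu)^-1 * (delta * mu) * (p / (40 * d%:R)).
    rewrite /pca_sigma; move: m1 m0 => m m0; field.
    by rewrite !gt_eqF.
  have h40 : 0 <= p / (40 * d%:R) by rewrite divr_ge0 ?mulr_ge0 // ltW.
  apply: le_trans (ler_wpM2r h40 hb) _.
  by rewrite le_eqVlt; apply/orP; left; apply/eqP; field; rewrite gt_eqF.
by rewrite ler_wpM2l ?exprn_ge0 ?(ltW b0) // pca_m1_power.
Qed.

Lemma pca_round lam : mu < lam -> lam <= 3 / 2 -> delta * lam / 10 <= lam - mu ->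
  (lam - mu) / 2 <= gap lam <= 5 / 4 * (lam - mu).
Proof. by move=> *; apply: pca_gap_bounds => //; apply: pca_lower. Qed.

(** Write [D] for [shift - mu]. As [gap] lies between [D / 2] and [5/4 D], the new
    [D' = D - gap / 2] lies between [3/8 D] and [3/4 D]. A round that does not stop has
    [gap > delta lam' / 3] for the new shift [lam'], hence
    [D' >= 3/8 * 4/5 * gap > delta lam' / 10], which is what the next round requires. *)
Lemma pca_shift_inv s : (forall i, (i < s)%N -> ~~ stop i) ->
  [/\ mu < shift s, shift s <= 3 / 2, delta * shift s / 10 <= shift s - mu &
      shift s - mu <= (3 / 4) ^+ s * (3 / 2)].
Proof.
have dl0 := delta_gt0; have dl1 := delta_le; have mm0 := mu0; have mm1 := mu1.
elim: s => [_|s IH ns].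
  by rewrite /= expr0 mul1r; split; nra.
have [h1 h2 h3 h4] := IH (fun i h => ns i (ltnW h)).
have /andP[g1 g2] := pca_round h1 h2 h3.
have := ns s (leqnn _); rewrite /pca_stop -ltNge /=; move: g1 g2.
set g := gap _ => g1 g2 g3; rewrite exprS; split; lra.
Qed.

(** After [F] rounds [D <= 4/15 delta l], so that [gap <= 5/4 D <= delta l / 3] and the exit test
    succeeds. *)
Lemma pca_terminates (l : R) F : l <= mu ->
  (3 / 4) ^+ F * (3 / 2) <= 4 / 15 * (delta * l) ->
  exists f, [/\ (f <= F)%N, stop f, forall i, (i < f)%N -> ~~ stop i &
    forall i, (i <= f.+1)%N ->
      [/\ mu < shift i, shift i <= 3 / 2 & delta * shift i / 27 <= shift i - mu]].
Proof.
move=> lmu hF; have dl0 := delta_gt0; have dl1 := delta_le; have m0 := mu0.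
(* The disjunct [i == F] provides a least index before any round is known to stop; if that index is
   [F], the test is shown to succeed there. *)
have ex : exists i, stop i || (i == F) by exists F; rewrite eqxx orbT.
have : forall i, (i < ex_minn ex)%N -> ~~ stop i /\ i != F.
  case: ex_minnP => f _ fmin i; rewrite ltnNge; apply: contraNP.
  by move=> h; apply: fmin; case: (stop i) h => //=; case: eqP => // _ [].
case: ex_minnP => f hf fmin ns; exists f.
have nst i : (i < f)%N -> ~~ stop i by case/ns.
have fF : (f <= F)%N by apply: fmin; rewrite eqxx orbT.
have [h1 h2 h3 h4] := pca_shift_inv nst.
have /andP[g1 g2] := pca_round h1 h2 h3.
have sf : stop f.
  case/orP: hf => // /eqP fE; rewrite /pca_stop /=; move: g1 g2 h4; rewrite fE in h1 h2 h3 *.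
  set g := gap _ => g1 g2 h4.
  have : delta * l <= delta * mu by rewrite ler_pM2l.
  have : delta * mu <= delta * (shift F - g / 2) by rewrite ler_pM2l //; lra.
  by move: h4 hF; set u := _ ^+ F; lra.
split=> // i; rewrite leq_eqVlt => /orP[/eqP ->|]; last first.
  rewrite ltnS => fi; have [|k1 k2 k3 _] := @pca_shift_inv i.
    by move=> j ji; apply: nst; apply: leq_trans fi.
  split=> //; have : 0 < shift i by apply: lt_trans k1.
  by move=> h; have := mulr_gt0 dl0 h; lra.
(* The stopping round gives no lower bound on [gap] from its test; what remains is
   [D' >= 3/8 D >= 3/80 delta lam], and [3 / 80 >= 1 / 27]. *)
rewrite /=; move: g1 g2; set g := gap _ => g1 g2; split; try lra.
have : delta * (shift f - g / 2) <= delta * shift f by rewrite ler_pM2l //; lra.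
by lra.
Qed.

End AppxPCA.

(** * Anti-concentration on the sphere *)

Section SlabCounting.
Variable R : realType.

Lemma card_near_diam L (P : pred 'I_L) (W : R) : 0 <= W ->
  (forall a b : 'I_L, P a -> P b -> (a <= b)%N -> (b - a)%:R <= W) ->
  #|P|%:R <= W + 1.
Proof.
move=> W0 diam; have [a0 Pa0|P0] := pickP P; last first.
  by rewrite eq_card0 // addr_ge0.
have [a Pa amin] := arg_minnP (fun i : 'I_L => i : nat) Pa0.
have [b Pb bmax] := arg_maxnP (fun i : 'I_L => i : nat) Pa0.
have ab : (a <= b)%N by apply: amin.
apply: le_trans (_ : ((b - a).+1)%:R <= _); last first.
  by rewrite -natr1 lerD2r diam.
rewrite ler_nat -(size_iota a (b - a).+1) cardE -(size_map val).
apply: uniq_leq_size; first by rewrite map_inj_uniq ?enum_uniq //; apply: val_inj.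
move=> j /mapP[i]; rewrite mem_enum => Pi ->.
by rewrite mem_iota addnS ltnS subnKC // amin //=; apply: bmax.
Qed.

(** Overwriting coordinate [i] by every [b] hits each grid point [L + 1] times. With [b = Y i + c]
    in the cyclic group ['I_L.+1], the overwriting becomes, for fixed [c], a permutation of the
    grid. *)
Lemma sum_coord_shift d L i (f : {ffun 'I_d -> 'I_L.+1} -> nat) :
  (\sum_(Y : {ffun 'I_d -> 'I_L.+1}) \sum_(b < L.+1)
     f [ffun j => if j == i then b else Y j] =
   L.+1 * \sum_Y f Y)%N.
Proof.
pose sh (c : 'I_L.+1) (Y : {ffun 'I_d -> 'I_L.+1}) :=
  [ffun j => if j == i then (Y j + c)%R else Y j].
have shi c : injective (sh c).
  move=> Y Z /ffunP h; apply/ffunP => j; have := h j; rewrite !ffunE.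
  by case: eqP => // _ /addIr.
transitivity (\sum_Y \sum_(c < L.+1) f (sh c Y))%N.
  apply: eq_bigr => Y _; rewrite (reindex_inj (addrI (Y i))) /=.
  apply: eq_bigr => c _; congr f; apply/ffunP => j; rewrite !ffunE.
  by case: eqP => // ->.
rewrite exchange_big /= (eq_bigr (fun=> \sum_Y f Y)%N).
  by rewrite sum_nat_const card_ord.
by move=> c _; rewrite [RHS](reindex_inj (shi c)).
Qed.

(** Coordinates start at 1, so that in positive dimension no grid vector is 0 and each has a
    direction. *)
Definition grid_vector d L (Y : {ffun 'I_d -> 'I_L}) : 'cV[R]_d :=
  \col_i (Y i).+1%:R.

Lemma grid_vector_norm d L (Y : {ffun 'I_d -> 'I_L}) :
  l2norm (grid_vector Y) <= L%:R * Num.sqrt d%:R.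
Proof.
rewrite -(@ler_pXn2r _ 2) ?nnegrE ?l2norm_ge0 ?mulr_ge0 ?sqrtr_ge0 //.
rewrite sqr_l2norm exprMn sqr_sqrtr //.
apply: (@le_trans _ _ (\sum_(i < d) L%:R ^+ 2)).
  by apply: ler_sum => i _; rewrite mxE -expr2 lerXn2r ?nnegrE // ler_nat.
by rewrite sumr_const card_ord mulr_natr.
Qed.

Lemma coord_large d (x : 'cV[R]_d) : (0 < d)%N -> dot x x = 1 ->
  exists i, 1 <= Num.sqrt d%:R * `|x i 0|.
Proof.
move=> d0 x1; apply/not_existsP => small.
have : \sum_i d%:R * x i 0 ^+ 2 < \sum_(i < d) 1.
  apply: ltr_sum => [|i _]; first by apply/hasP; exists (Ordinal d0); rewrite // mem_index_enum.
  have /negP := small i; rewrite -ltNge => h.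
  have : (Num.sqrt d%:R * `|x i 0|) ^+ 2 < 1 by rewrite exprn_ilt1 ?mulr_ge0 ?sqrtr_ge0.
  by rewrite exprMn sqr_sqrtr // real_normK ?num_real.
rewrite -mulr_sumr sumr_const card_ord (eq_bigr (fun i => x i 0 * x i 0)); last first.
  by move=> i _; rewrite expr2.
by rewrite [\sum_i _]x1 mulr1 ltxx.
Qed.

(* Along the lines parallel to a coordinate axis where [x] is large, the slab
   contains few grid points. *)
Lemma slab_count d L (x : 'cV[R]_d) (t : R) : (0 < d)%N -> dot x x = 1 -> 0 < t ->
  (\sum_(Y : {ffun 'I_d -> 'I_L.+1})
     (`|dot x (grid_vector Y)| < t * l2norm (grid_vector Y))%R)%N%:R * L.+1%:R
  <= (2 * t * d%:R * L.+1%:R + 1) * #|{ffun 'I_d -> 'I_L.+1}|%:R :> R.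
Proof.
move=> d0 x1 t0; have [i xi] := coord_large d0 x1.
pose f (Y : {ffun 'I_d -> 'I_L.+1}) : nat :=
  (`|dot x (grid_vector Y)| < t * l2norm (grid_vector Y))%R.
rewrite -[(\sum_Y _)%N]/(\sum_Y f Y)%N.
rewrite -natrM mulnC -(sum_coord_shift i f) natr_sum mulr_natr.
rewrite -sumr_const; apply: ler_sum => Y _.
pose Z b : {ffun 'I_d -> 'I_L.+1} := [ffun j => if j == i then b else Y j].
(* Two points of the slab on one line have inner products differing by at most [2 t (L + 1) sqrt d],
   while one step along the line changes the inner product by at least [1 / sqrt d]. *)
set W := 2 * t * d%:R * L.+1%:R.
pose P := [pred b | `|dot x (grid_vector (Z b))| < t * l2norm (grid_vector (Z b))].
have -> : (\sum_(b < L.+1) f (Z b))%N = #|P|.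
  by rewrite -sum1_card [RHS]big_mkcond; apply: eq_bigr => b _; rewrite /f inE; case: ifP.
have W0 : 0 <= W by rewrite !mulr_ge0 // ltW.
apply: card_near_diam => // a b; rewrite !inE => Pa Pb ab.
have dab : dot x (grid_vector (Z b)) - dot x (grid_vector (Z a)) = x i 0 * (b - a)%:R.
  rewrite -dotNr -dotDr /dot (bigD1 i) //= big1 ?addr0 => [|j ji].
    by rewrite !mxE !ffunE eqxx -natrB // subSS.
  by rewrite !mxE !ffunE (negPf ji) subrr mulr0.
have gb c : t * l2norm (grid_vector (Z c)) <= t * (L.+1%:R * Num.sqrt d%:R).
  by rewrite ler_pM2l // grid_vector_norm.
have h1 : `|x i 0| * (b - a)%:R <= 2 * (t * (L.+1%:R * Num.sqrt d%:R)).
  rewrite -[(b - a)%:R]ger0_norm // -normrM -dab.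
  apply: le_trans (ler_normB _ _) _.
  by have := gb a; have := gb b; move: Pa Pb; lra.
apply: le_trans (_ : Num.sqrt d%:R * `|x i 0| * (b - a)%:R <= _).
  by rewrite ler_peMl.
rewrite -mulrA; apply: le_trans (ler_wpM2l (sqrtr_ge0 _) h1) _.
rewrite [leLHS](_ : _ = 2 * t * (Num.sqrt d%:R ^+ 2) * L.+1%:R).
  by rewrite sqr_sqrtr.
by move: (Num.sqrt _) => u; ring.
Qed.

End SlabCounting.

(** * Continuity of matrix expressions, and slabs under a rotation invariant law *)

Section EntrywiseContinuity.
Variable R : realType.
Variable V : topologicalType.

Definition mx_continuous m n (F : V -> 'M[R]_(m, n)) :=
  forall i j, continuous (fun x => F x i j).

Lemma continuous_sumr (I : finType) (F : I -> V -> R) :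
  (forall i, continuous (F i)) -> continuous (fun x => \sum_i F i x).
Proof.
move=> cF; elim: (index_enum I) => [|i s IH].
  rewrite (_ : (fun x => _) = cst 0); first exact: cst_continuous.
  by apply/funext => x; rewrite big_nil.
rewrite (_ : (fun x => _) = (fun x => F i x + \sum_(j <- s) F j x)).
  by move=> x; apply: cvgD; [apply: cF|apply: IH].
by apply/funext => x; rewrite big_cons.
Qed.

Lemma mx_continuous_cst m n (M : 'M[R]_(m, n)) : mx_continuous (fun=> M).
Proof. by move=> i j; apply: cst_continuous. Qed.

Lemma mx_continuousB m n (F G : V -> 'M[R]_(m, n)) :
  mx_continuous F -> mx_continuous G -> mx_continuous (fun x => F x - G x).
Proof.
move=> cF cG i j; under eq_fun do rewrite !mxE.
by move=> x; apply: cvgB; [apply: cF|apply: cG].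
Qed.

Lemma mx_continuousM m n p (F : V -> 'M[R]_(m, n)) (G : V -> 'M[R]_(n, p)) :
  mx_continuous F -> mx_continuous G -> mx_continuous (fun x => F x *m G x).
Proof.
move=> cF cG i j; under eq_fun do rewrite mxE.
by apply: continuous_sumr => k x; apply: cvgM; [apply: cF|apply: cG].
Qed.

Lemma mx_continuousT m n (F : V -> 'M[R]_(m, n)) :
  mx_continuous F -> mx_continuous (fun x => (F x)^T).
Proof. by move=> cF i j; under eq_fun do rewrite mxE; apply: cF. Qed.

Lemma dot_continuous n (F G : V -> 'cV[R]_n) :
  mx_continuous F -> mx_continuous G -> continuous (fun x => dot (F x) (G x)).
Proof.
move=> cF cG; under eq_fun do rewrite dotE.
by apply: mx_continuousM => //; apply: mx_continuousT.
Qed.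

End EntrywiseContinuity.

Lemma mx_continuous_id (R : realType) m n : mx_continuous (@id 'M[R]_(m, n)).
Proof. by move=> i j; apply: coord_continuous. Qed.

Section Slab.
Variables (R : realType) (dsp : measure_display) (T : measurableType dsp).
Variables (P : probability T R) (d : nat) (X : T -> 'cV[R]_d).
Hypothesis uX : uniform_unit_vector P X.
Hypothesis d0 : (0 < d)%N.

Definition slab (q : 'cV[R]_d) (t : R) : set 'cV[R]_d :=
  [set x | `|dot x q| < t].

Lemma borel_slab q t : borel (slab q t).
Proof.
apply: sub_sigma_algebra => /=.
have -> : slab q t = (fun x => dot x q) @^-1` (ball (0 : R) t).
  by apply/seteqP; split=> x; rewrite /slab /ball /= sub0r normrN.
apply: open_comp; last exact: ball_open.
move=> x _; apply: dot_continuous; [exact: mx_continuous_id|].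
exact: mx_continuous_cst.
Qed.

Lemma measurable_slab q t : measurable (X @^-1` slab q t).
Proof. by case: uX => mX _ _; apply: mX; exact: borel_slab. Qed.

(** The reflection exchanging [q] and [u] is orthogonal and maps one slab onto the other. *)
Lemma slab_rotation q u t : l2norm q = 1 -> l2norm u = 1 ->
  P (X @^-1` slab q t) = P (X @^-1` slab u t).
Proof.
move=> q1 u1; case: uX => _ _ inv.
have H2 := householder_invol (q - u).
rewrite -(inv (householder (q - u))) ?householder_sym //; last exact: borel_slab.
congr (P _); apply/seteqP; split=> w; rewrite /slab /= => h; move: h.
all: suff -> : dot (householder (q - u) *m X w) q = dot (X w) u by [].
all: rewrite dotC dot_mulmxr householder_sym householder_map 1?dotC //.
all: by rewrite -sqr_l2norm ?q1 ?u1 expr1n.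
Qed.

(* Averaging over the directions of the grid and letting its mesh tend to 0. *)
Lemma slab_probability q t : l2norm q = 1 -> 0 < t ->
  (P (X @^-1` slab q t) <= (2 * t * d%:R)%:E)%E.
Proof.
move=> q1 t0; pose r := fine (P (X @^-1` slab q t)).
have Pr : P (X @^-1` slab q t) = r%:E by rewrite /r fineK // fin_num_measure //; exact: measurable_slab.
rewrite Pr lee_fin.
(* [L] is arbitrary: dividing by [L + 1] and letting [L] grow leaves [r <= 2 t d]. *)
suff hL L : r * L.+1%:R <= 2 * t * d%:R * L.+1%:R + 1.
  rewrite leNgt; apply/negP => lt.
  have D0 : 0 < r - 2 * t * d%:R by rewrite subr_gt0.
  have : (r - 2 * t * d%:R)^-1 < (Num.bound (r - 2 * t * d%:R)^-1)%:R.
    by apply: archi_boundP; rewrite invr_ge0 ltW.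
  have := hL (Num.bound (r - 2 * t * d%:R)^-1).
  set B := Num.bound _; rewrite -natr1 -[_^-1]mul1r ltr_pdivrMr //.
  by move=> h1 h2; move: D0 h1 h2; set c := 2 * t * d%:R; lra.
pose Om := {ffun 'I_d -> 'I_L.+1}.
pose u (Y : Om) := normalize (grid_vector R Y).
have g0 (Y : Om) : grid_vector R Y != 0.
  apply/eqP => /colP/(_ (Ordinal d0)); rewrite !mxE => /eqP.
  by rewrite pnatr_eq0.
pose f (Y : Om) w : \bar R := (\1_(X @^-1` slab (u Y) t) w)%:E.
have f0 Y w : (0 <= f Y w)%E by rewrite lee_fin indicE.
have mf Y : measurable_fun setT (f Y).
  rewrite (_ : f Y = EFin \o \1_(X @^-1` slab (u Y) t)) //.
  by apply/measurable_EFinP; apply: measurable_indic; apply: measurable_slab.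
(* All these slabs have the same probability [r], so the expected number of grid directions whose
   slab contains [X] is [r] times the size of the grid; [slab_count] bounds that number at every
   sample point. *)
have intf : (\int[P]_w (\sum_Y f Y w) = (r *+ #|Om|)%:E)%E.
  rewrite ge0_integral_sum //.
  rewrite (eq_bigr (fun=> r%:E)) => [|Y _].
    by rewrite sumEFin sumr_const.
  rewrite integral_indic //; last exact: measurable_slab.
  by rewrite setIT -Pr; apply: slab_rotation => //; apply: l2norm_normalize.
pose K := (2 * t * d%:R * L.+1%:R + 1) / L.+1%:R * #|Om|%:R.
have lef : (\int[P]_w (\sum_Y f Y w) <= K%:E)%E.
  apply: (@le_trans _ _ (\int[P]_w (cst K%:E) w)%E); last first.
    by rewrite integral_cst // [X in (_ * X)%E](probability_setT P) mule1.
  apply: ge0_le_integral => //.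
  - by move=> w _; apply: sume_ge0 => Y _; apply: f0.
  - exact: emeasurable_sum.
  move=> w _; rewrite sumEFin lee_fin /K -mulrA [_^-1 * _]mulrC mulrA ler_pdivlMr //.
  have Xw : dot (X w) (X w) = 1 by case: uX => _ X1 _; rewrite -sqr_l2norm X1 expr1n.
  apply: le_trans (slab_count L d0 Xw t0); rewrite ler_pM2r // natr_sum.
  rewrite le_eqVlt; apply/orP; left; apply/eqP; apply: eq_bigr => Y _.
  rewrite indicE; congr ((nat_of_bool _)%:R).
  have -> : dot (X w) (grid_vector R Y) = dot (X w) (u Y) * l2norm (grid_vector R Y).
    rewrite /u /normalize dotZr mulrAC mulVf ?mul1r //.
    by rewrite l2norm_eq0.
  rewrite normrM [`|l2norm _|]ger0_norm ?l2norm_ge0 // ltr_pM2r ?l2norm_gt0 //.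
  by apply/idP/idP; rewrite inE.
move: lef; rewrite intf lee_fin /K -[r *+ _]mulr_natr.
rewrite ler_pM2r; last by rewrite ltr0n; apply/card_gt0P; exists [ffun=> ord0].
by rewrite ler_pdivlMr.
Qed.
End Slab.

(** * Good start vectors *)

Section RationalMatrices.
Variable R : realType.

Lemma rational_approx m n (A : 'M[R]_(m, n)) (e : R) : 0 < e ->
  exists c : 'M[rat]_(m, n), forall i j, `|A i j - ratr (c i j)| < e.
Proof.
move=> e0; have ex (x : R) : {r : rat | `|x - ratr r| < e}.
  apply: cid; have /rat_in_itvoo[r] : x - e < x + e by lra.
  rewrite in_itv /= => /andP[h1 h2]; exists r.
  by rewrite ltr_distlC -ltrBlDr h1 ltrBlDr.
exists (\matrix_(i, j) sval (ex (A i j))) => i j; rewrite mxE.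
exact: (svalP (ex (A i j))).
Qed.

Lemma rational_dense m n (A : 'M[R]_(m, n)) (U : set 'M[R]_(m, n)) :
  nbhs A U -> exists c : 'M[rat]_(m, n), U (map_mx ratr c).
Proof.
move=> /nbhs_ballP[e /= e0 eU]; have [c hc] := rational_approx A e0.
by exists c; apply: eU; split=> // i j; rewrite mxE /ball /=; apply: hc.
Qed.

(** An open set is a countable union of boxes with rational centres and radii [1 / (k + 1)], and a
    box is a finite intersection of conditions on single entries. This makes the matrix of all
    earlier columns measurable once each column is. *)
Lemma measurable_random_mx (dsp : measure_display) (T : measurableType dsp) m n
    (Y : T -> 'M[R]_(m, n)) :
  (forall i j, measurable_fun setT (fun w => Y w i j)) -> random_mx Y.
Proof.
move=> mY B; rewrite /borel => sB.
have : image_set_system setT Y measurable B.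
  apply: (smallest_sub _ _ sB).
    exact: sigma_algebra_image (sigma_algebra_measurable T).
  move=> U oU; rewrite /image_set_system /= setTI.
  pose box (c : 'M[rat]_(m, n)) k : set T :=
    [set w | forall i j, `|Y w i j - ratr (c i j)| < k.+1%:R^-1].
  pose F l : set T := if unpickle l is Some (c, k) then
    (if `[< box c k `<=` Y @^-1` U >] then box c k else set0) else set0.
  have -> : Y @^-1` U = \bigcup_l F l.
    apply/seteqP; split=> w; last first.
      case=> l _; rewrite /F; case: unpickle => // -[c k].
      by case: asboolP => // h; apply: h.
    move=> Uw; have /nbhs_ballP[e /= e0 eU] : nbhs (Y w) U by apply: open_nbhs_nbhs.
    have [k ke] : exists k, k.+1%:R^-1 < e / 2.
      have e20 : 0 < (e / 2)^-1 by rewrite invr_gt0 divr_gt0.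
      have lt := archi_boundP (ltW e20); exists (Num.bound (e / 2)^-1).
      move: lt; set K := Num.bound _ => lt; rewrite -[e / 2]invrK ltf_pV2 ?posrE //.
      by apply: lt_trans lt _; rewrite ltr_nat.
    have k0 : 0 < k.+1%:R^-1 :> R by rewrite invr_gt0.
    have [c hc] := rational_approx (Y w) k0.
    exists (pickle (c, k)) => //; rewrite /F pickleK; case: asboolP => // [[]].
    move=> w' hw'; apply: eU; split=> // i j; rewrite /ball /=.
    have -> : Y w i j - Y w' i j =
      (Y w i j - ratr (c i j)) - (Y w' i j - ratr (c i j)) by ring.
    apply: le_lt_trans (ler_normB _ _) _.
    have h1 := hc i j; have h2 := hw' i j; move: h1 h2 ke.
    by move: (_^-1) `|_| `|_| => u v z; lra.
  apply: bigcupT_measurable => l; rewrite /F; case: unpickle => // -[c k].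
  case: asboolP => // _.
  have -> : box c k = \bigcap_(i in [set: 'I_m]) \bigcap_(j in [set: 'I_n])
     (fun w => Y w i j) @^-1` (ball (ratr (c i j) : R) k.+1%:R^-1).
    apply/seteqP; split=> w h.
      by move=> i _ j _; rewrite /ball /= distrC; apply: h.
    by move=> i j; have := h i I j I; rewrite /ball /= distrC; apply.
  apply: fin_bigcap_measurable => // i _; apply: fin_bigcap_measurable => // j _.
  rewrite -[X in measurable X]setTI; apply: mY => //.
  exact: measurable_ball.
by rewrite /image_set_system /= setTI.
Qed.

Lemma random_mx_entry (dsp : measure_display) (T : measurableType dsp) m n
    (Y : T -> 'M[R]_(m, n)) i j :
  random_mx Y -> measurable_fun setT (fun w => Y w i j).
Proof.
move=> mY; apply: (measurability _ (RGenOpens.measurableE R)).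
move=> _ [_ [a [b ->] <-]]; rewrite setTI.
apply: (mY [set M | `]a, b[%classic (M i j)]).
apply: sub_sigma_algebra => /=.
apply: (@open_comp _ _ (fun M : 'M[R]_(m, n) => M i j) (`]a, b[%classic)).
  by move=> ? _; apply: coord_continuous.
exact: interval_open.
Qed.

End RationalMatrices.

Section GoodStart.
Variable R : realType.

Lemma quadratic_bound d (N : 'M[R]_d) :
  exists K, forall y : 'cV[R]_d, dot y (N *m y) <= K * dot y y.
Proof.
exists (\sum_i \sum_j `|N i j|) => y.
have yi i : `|y i 0| <= l2norm y.
  rewrite -(@ler_pXn2r _ 2) ?nnegrE ?l2norm_ge0 // real_normK ?num_real //.
  rewrite sqr_l2norm /dot (bigD1 i) //= -expr2 lerDl.
  by apply: sumr_ge0 => j _; rewrite -expr2 sqr_ge0.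
rewrite mulr_suml; apply: ler_sum => i _; rewrite mxE mulr_sumr mulr_suml.
apply: ler_sum => j _; apply: le_trans (ler_norm _) _.
rewrite !normrM mulrCA -sqr_l2norm expr2 ler_wpM2l //.
by rewrite ler_pM.
Qed.

(** The top eigenvalue is introduced as a supremum with approximate maximizers; the rest of the
    proof works with these instead of an eigenvector. *)
Lemma rayleigh_sup d (N : 'M[R]_d) : (0 < d)%N -> psd N ->
  exists2 mu, 0 <= mu & (forall y : 'cV[R]_d, dot y (N *m y) <= mu * dot y y) /\
    forall e, 0 < e -> exists2 u : 'cV[R]_d, dot u u = 1 & mu - e < dot u (N *m u).
Proof.
move=> d0 [_ pN]; have [K hK] := quadratic_bound N.
pose S := [set z | exists2 u : 'cV[R]_d, dot u u = 1 & z = dot u (N *m u)].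
have S0 : S !=set0.
  pose u : 'cV[R]_d := delta_mx (Ordinal d0) 0.
  exists (dot u (N *m u)), u => //.
  rewrite /dot (bigD1 (Ordinal d0)) //= big1 => [|i /negPf i0].
    by rewrite !mxE !eqxx mulr1 addr0.
  by rewrite mxE i0 mul0r.
have bS : has_ubound S by exists K => _ [u u1 ->]; have := hK u; rewrite u1 mulr1.
have hS : has_sup S by split.
have ubS := sup_upper_bound hS.
have mu0 : 0 <= sup S by case: S0 => z Sz; apply: le_trans (ubS _ Sz); case: Sz => u _ ->.
exists (sup S) => //; split=> [y|e e0].
  have [->|y0] := eqVneq y 0; first by rewrite !mulmx0 !dot0r mulr0.
  have yy : 0 < dot y y by rewrite dot_gt0.
  rewrite -ler_pdivrMr //; apply: ubS; exists (normalize y).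
    by rewrite -sqr_l2norm l2norm_normalize // expr1n.
  rewrite /normalize -scalemxAr dotZl dotZr -sqr_l2norm; field.
  by rewrite l2norm_eq0.
by have [_ [u u1 ->] h] := sup_adherent e0 hS; exists u.
Qed.

(** Nearness to the top is tested against every [y] instead of the top eigenvalue, with denominators
    cleared: for fixed nonzero [c] it is a closed condition on [N]. *)
Definition near_top d (tau : R) (c : 'cV[R]_d) (N : 'M[R]_d) : Prop :=
  c != 0 /\ forall y : 'cV[R]_d,
    (1 - tau) * dot y (N *m y) * dot c c <= dot c (N *m c) * dot y y.

(** Exceeding [(1 - tau) mu] strictly is an open condition on the vector, so an approximate
    maximizer can be moved to a rational one. If [tau >= 1] or [mu = 0], any nonzero vector
    qualifies. *)
Lemma rational_near_top d (N : 'M[R]_d) tau : (0 < d)%N -> psd N -> 0 < tau ->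
  exists c : 'cV[rat]_d, near_top tau (map_mx ratr c) N.
Proof.
move=> d0 pN tau0.
have [tau1|tau1] := leP 1 tau.
  exists (delta_mx (Ordinal d0) 0); split=> [|y].
    apply/eqP => /matrixP/(_ (Ordinal d0) 0); rewrite !mxE !eqxx rmorph1 => /eqP.
    by rewrite oner_eq0.
  apply: (@le_trans _ _ 0); last by rewrite mulr_ge0 ?dot_ge0 ?pN.2.
  by rewrite mulr_le0_ge0 ?dot_ge0 // mulr_le0_ge0 ?pN.2 // subr_le0.
have [mu mu0 [Nmu hmu]] := rayleigh_sup d0 pN.
have [mu00|mu00] := eqVneq mu 0.
  exists (delta_mx (Ordinal d0) 0); split=> [|y].
    apply/eqP => /matrixP/(_ (Ordinal d0) 0); rewrite !mxE !eqxx rmorph1 => /eqP.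
    by rewrite oner_eq0.
  apply: (@le_trans _ _ 0); last by rewrite mulr_ge0 ?dot_ge0 ?pN.2.
  rewrite mulr_le0_ge0 ?dot_ge0 // mulr_ge0_le0 ?subr_ge0 ?(ltW tau1) //.
  by have := Nmu y; rewrite mu00 mul0r.
have mup : 0 < mu by rewrite lt_def mu00.
have [u u1 hu] := hmu _ (mulr_gt0 tau0 mup).
pose g (x : 'cV[R]_d) := dot x (N *m x) - (1 - tau) * mu * dot x x.
have cg : continuous g.
  have cid : mx_continuous (@id 'cV[R]_d) by exact: mx_continuous_id.
  have c1 : continuous (fun x : 'cV[R]_d => dot x (N *m x)).
    by apply: dot_continuous => //; apply: mx_continuousM => //; apply: mx_continuous_cst.
  have c2 : continuous (fun x : 'cV[R]_d => dot x x) by apply: dot_continuous.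
  by move=> x; exact: (cvgB (c1 x) (cvgM (cvg_cst _) (c2 x))).
have gu : 0 < g u by rewrite /g u1 mulr1 mulrBl mul1r subr_gt0.
have nu : nbhs u (g @^-1` [set z | 0 < z]).
  by apply: cg; apply: open_nbhs_nbhs; split=> //; exact: open_gt.
have [c hc] := rational_dense nu; exists c; split=> [|y].
  by apply: contraTneq hc => ->; rewrite /= /g mulmx0 !dot0r mulr0 subrr ltxx.
have h1 : (1 - tau) * mu * dot (map_mx ratr c) (map_mx ratr c : 'cV[R]_d) <=
    dot (map_mx ratr c) (N *m map_mx ratr c) by rewrite -subr_ge0 ltW.
have h2 : (1 - tau) * dot y (N *m y) <= (1 - tau) * (mu * dot y y).
  by rewrite ler_wpM2l // subr_ge0 ltW.
apply: le_trans (ler_wpM2r (dot_ge0 _) h2) _.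
apply: le_trans (ler_wpM2r (dot_ge0 y) h1).
by rewrite le_eqVlt; apply/orP; left; apply/eqP; ring.
Qed.

(** The intersection runs over uncountably many [y], but over closed sets. *)
Lemma borel_near_top m n d tau (c : 'cV[R]_d) (F : 'M[R]_(m, n) -> 'M[R]_d) :
  mx_continuous F -> borel [set V | near_top tau c (F V)].
Proof.
move=> cF; have [c0|c0] := eqVneq c 0.
  rewrite (_ : [set V | _] = set0); last first.
    by apply/seteqP; split=> V //= -[]; rewrite c0 eqxx.
  exact: sigma_algebra0.
have -> : [set V | near_top tau c (F V)] =
    \bigcap_(y in [set: 'cV[R]_d]) (fun V => dot c (F V *m c) * dot y y -
      (1 - tau) * dot y (F V *m y) * dot c c) @^-1` [set z | 0 <= z].
  apply/seteqP; split=> V /=; first by case=> _ h y _ /=; rewrite subr_ge0.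
  by move=> h; split=> // y; rewrite -subr_ge0; apply: h.
rewrite -[X in borel X]setCK.
apply: sigma_algebraC; apply: sub_sigma_algebra => /=; apply: closed_openC.
apply: closed_bigI => y _; apply: preimage_closed; last exact: closed_ge.
have cq (z : 'cV[R]_d) : continuous (fun V => dot z (F V *m z)).
  apply: dot_continuous; first exact: mx_continuous_cst.
  by apply: mx_continuousM => //; exact: mx_continuous_cst.
move=> V _; exact: (cvgB (cvgM (cq c V) (cvg_cst _))
  (cvgM (cvgM (cvg_cst _) (cq y V)) (cvg_cst _))).
Qed.

End GoodStart.

Section GoodEvent.
Variables (R : realType) (dsp : measure_display) (T : measurableType dsp).
Variable P : probability T R.

Lemma borelC m n (B : set 'M[R]_(m, n)) : borel B -> borel (~` B).
Proof. exact: sigma_algebraC. Qed.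

(* The top eigenvector of [F (Y w)] is replaced by the first rational vector that
   is close to it, so that only countably many values have to be considered. *)
Lemma good_start_event d m n (X : T -> 'cV[R]_d) (Y : T -> 'M[R]_(m, n))
    (F : 'M[R]_(m, n) -> 'M[R]_d) (tau t : R) :
  (0 < d)%N -> uniform_unit_vector P X -> random_mx Y -> independent P X Y ->
  mx_continuous F -> (forall V, psd (F V)) -> 0 < tau -> 0 < t ->
  2 * t * d%:R <= 1 ->
  exists E : set T, [/\ measurable E, ((1 - 2 * t * d%:R)%:E <= P E)%E &
    forall w, E w -> exists q : 'cV[R]_d,
      [/\ l2norm q = 1, t <= `|dot (X w) q| &
          forall y : 'cV[R]_d, (1 - tau) * dot y (F (Y w) *m y) <=
            dot q (F (Y w) *m q) * dot y y]].
Proof.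
move=> d0 uX mY indep cF pF tau0 t0 t1.
pose c j : 'cV[R]_d := if unpickle j is Some c then map_mx ratr (c : 'cV[rat]_d) else 0.
pose C j : set 'M[R]_(m, n) := [set V | near_top tau (c j) (F V)].
pose q j := normalize (c j).
have bC j : borel (C j) by apply: borel_near_top.
have covC : \bigcup_j C j = setT.
  apply/seteqP; split=> // V _; have [v hv] := rational_near_top d0 (pF V) tau0.
  by exists (pickle v) => //; rewrite /C /= /c pickleK.
pose D := seqDU C.
have bD j : borel (D j).
  rewrite /D /seqDU.
  apply: (@measurableD _ (g_sigma_algebraType [set U : set 'M[R]_(m, n) | open U])); first exact: bC.
  by apply: bigsetU_measurable => i _; apply: bC.
have mD j : measurable (Y @^-1` D j) by apply: mY.
pose G j := ~` (X @^-1` slab (q j) t).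
have mG j : measurable (G j) by apply: measurableC; apply: measurable_slab uX _ _.
pose A j := Y @^-1` D j `&` G j.
have mA j : measurable (A j) by apply: measurableI.
have tD : trivIset setT (fun j => Y @^-1` D j).
  by move=> i j _ _ [w [Di Dj]]; apply: (@trivIset_seqDU _ C) => //; exists (Y w).
exists (\bigcup_j A j); split.
- exact: bigcupT_measurable.
- have -> : P (\bigcup_j A j) = (\sum_(j <oo) P (A j))%E.
    rewrite measure_bigcup //; last exact: trivIset_setIr.
    by apply: eq_eseriesl => j; rewrite in_setT.
  (* On the event that [Y] lies in [D j] the vector [q j] is fixed, so independence factors the
     probability and the slab bound applies. *)
  have PA j : ((1 - 2 * t * d%:R)%:E * P (Y @^-1` D j) <= P (A j))%E.
    have -> : P (A j) = (P (Y @^-1` D j) * P (G j))%E.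
      rewrite /A setIC (indep (~` slab (q j) t) (D j)) //; first by rewrite muleC.
      by apply: borelC; exact: borel_slab.
    (* For empty [D j] the vector [c j] may be 0, which has no direction; both sides then vanish. *)
    have [->|/set0P[V DV]] := eqVneq (D j) set0.
      by rewrite preimage_set0 measure0 mule0 mul0e.
    rewrite muleC lee_wpmul2l // probability_setC; last exact: measurable_slab uX _ _.
    rewrite EFinB; apply: leeB => //; apply: slab_probability => //.
    by apply: l2norm_normalize; case: DV => -[].
  apply: le_trans (lee_nneseries _ (fun j _ => PA j)); last first.
    by move=> j _ _; rewrite mule_ge0 // lee_fin subr_ge0.
  rewrite nneseriesZl //.
  have -> : (\sum_(j <oo) P (Y @^-1` D j) = 1)%E.
    rewrite -(probability_setT P).
    have -> : [set: T] = \bigcup_j Y @^-1` D j.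
      by rewrite -preimage_bigcup -seqDU_bigcup_eq covC preimage_setT.
    rewrite measure_bigcup //.
    by apply: eq_eseriesl => j; rewrite in_setT.
  by rewrite mule1.
move=> w [j _ [Dj /negP]]; rewrite -leNgt => tq; exists (q j).
have [c0 h] : near_top tau (c j) (F (Y w)) by case: Dj.
split=> //; first exact: l2norm_normalize.
move=> y; rewrite /q /normalize -scalemxAr dotZl dotZr.
have l0 : 0 < l2norm (c j) by rewrite l2norm_gt0.
rewrite -(ler_pM2r (_ : 0 < dot (c j) (c j))) ?dot_gt0 //.
apply: le_trans (h y) _; rewrite -(sqr_l2norm (c j)) le_eqVlt; apply/orP; left; apply/eqP.
by field; rewrite gt_eqF.
Qed.

End GoodEvent.

(** * Deflation *)

Section Deflation.
Variables (R : realType) (d : nat).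
Implicit Types (M : 'M[R]_d) (v : nat -> 'cV[R]_d).

Lemma deflate_ext M v v' s : (forall j, (j < s)%N -> v j = v' j) ->
  deflate M v s = deflate M v' s.
Proof.
elim: s => //= s IH h; rewrite h // IH // => j js; apply: h.
exact: ltnW.
Qed.

Definition project_out (u x : 'cV[R]_d) : 'cV[R]_d := x - dot u x *: u.

Lemma project_outE (u x : 'cV[R]_d) :
  (1%:M - u *m u^T) *m x = project_out u x.
Proof. by rewrite mulmxBl mul1mx outer_mulmx. Qed.

Lemma complement_sym (u : 'cV[R]_d) :
  (1%:M - u *m u^T)^T = 1%:M - u *m u^T.
Proof. by rewrite linearB /= trmx1 trmx_mul trmxK. Qed.

Lemma dot_deflateS M v s x : dot x (deflate M v s.+1 *m x) =
  dot (project_out (v s) x) (deflate M v s *m project_out (v s) x).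
Proof.
by rewrite /= -!mulmxA dot_mulmxr complement_sym !project_outE.
Qed.

(** With [a = (u, x)] and [b = |u|^2] the left side is [|x|^2 - 2 a^2 + a^2 b]. The bound [|u| <= 1]
    also admits the column 0, which is the value of [normalize 0]. *)
Lemma dot_project_out (u x : 'cV[R]_d) : l2norm u <= 1 ->
  dot (project_out u x) (project_out u x) <= dot x x.
Proof.
move=> u1; have u2 : dot u u <= 1 by rewrite -sqr_l2norm exprn_ile1 ?l2norm_ge0.
rewrite /project_out !(dotDl, dotDr, dotNl, dotNr, dotZl, dotZr) (dotC x u).
set a := dot u x; set b := dot u u in u2 *.
have : a ^+ 2 * b <= a ^+ 2 by rewrite ler_piMr ?sqr_ge0.
have : 0 <= a ^+ 2 by rewrite sqr_ge0.
by rewrite expr2; lra.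
Qed.

Lemma deflate_psd M v s : psd M -> psd (deflate M v s).
Proof.
move=> pM; elim: s => // s [sN pN]; split=> [|x]; last by rewrite dot_deflateS.
by rewrite /sym /= !trmx_mul complement_sym sN mulmxA.
Qed.

Lemma deflate_le1 M v s : (forall x : 'cV[R]_d, dot x (M *m x) <= dot x x) ->
  (forall j, (j < s)%N -> l2norm (v j) <= 1) ->
  forall x : 'cV[R]_d, dot x (deflate M v s *m x) <= dot x x.
Proof.
move=> M1; elim: s => // s IH v1 x; rewrite dot_deflateS.
apply: le_trans (IH _ _) _; last by apply: dot_project_out; apply: v1.
by move=> j js; apply: v1; apply: ltnW.
Qed.

(** The projections do not touch vectors orthogonal to the columns. Together with min-max under
    fewer than [k] constraints, this keeps the top of every deflated matrix above [lam_k]. *)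
Lemma dot_deflate_orth M v s (y : 'cV[R]_d) :
  (forall j, (j < s)%N -> dot (v j) y = 0) ->
  dot y (deflate M v s *m y) = dot y (M *m y).
Proof.
elim: s => // s IH h; rewrite dot_deflateS /project_out h // scale0r subr0.
by apply: IH => j js; apply: h; apply: ltnW.
Qed.

Fixpoint project_out_all v s (x : 'cV[R]_d) : 'cV[R]_d :=
  if s is s'.+1 then project_out (v s') (project_out_all v s' x) else x.

Lemma l2norm_project_out_all v s x : (forall j, (j < s)%N -> l2norm (v j) <= 1) ->
  l2norm (project_out_all v s x) <= l2norm x.
Proof.
elim: s => //= s IH v1; apply: le_trans (IH _); last first.
  by move=> j js; apply: v1; apply: ltnW.
by apply: ler_wsqrtr; apply: dot_project_out; apply: v1.
Qed.

(** A deflated covariance is again a covariance, which is the form that accelerated SVRG accepts. *)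
Lemma deflate_cov n (a : 'I_n -> 'cV[R]_d) v s :
  deflate (cov a) v s = cov (fun i => project_out_all v s (a i)).
Proof.
elim: s => //= s ->; rewrite /cov -scalemxAr -scalemxAl; congr (_ *: _).
rewrite mulmx_sumr mulmx_suml; apply: eq_bigr => i _.
by rewrite -project_outE trmx_mul complement_sym !mulmxA.
Qed.

(** A left inverse of [colmx]. It makes the deflated matrix a continuous function of a single random
    matrix, the one that is independent of the start vector. *)
Definition columns s (V : 'M[R]_(d, s)) (j : nat) : 'cV[R]_d :=
  if insub j is Some i then col i V else 0.

Lemma columns_colmx s v j : (j < s)%N -> columns (colmx s v) j = v j.
Proof.
move=> js; rewrite /columns insubT; apply/colP => i.
by rewrite !mxE.
Qed.

Lemma deflate_columns M s v : deflate M (columns (colmx s v)) s = deflate M v s.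
Proof. by apply: deflate_ext => j js; apply: columns_colmx. Qed.

Lemma deflate_continuous M s r : mx_continuous (fun V : 'M[R]_(d, r) =>
  deflate M (columns V) s).
Proof.
have cc j : mx_continuous (fun V : 'M[R]_(d, r) => columns V j).
  rewrite /columns; case: insubP => [i _ _|_]; last exact: mx_continuous_cst.
  by move=> a b; under eq_fun do rewrite mxE; apply: mx_continuous_id.
elim: s => [|s IH]; first exact: mx_continuous_cst.
have cP : mx_continuous (fun V : 'M[R]_(d, r) =>
    1%:M - columns V s *m (columns V s)^T).
  apply: mx_continuousB; first exact: mx_continuous_cst.
  by apply: mx_continuousM => //; apply: mx_continuousT.
by apply: mx_continuousM => //; apply: mx_continuousM.
Qed.

End Deflation.

(** * Termination of all calls with high probability *)

Section Run.
Variables (R : realType) (dsp : measure_display) (T : measurableType dsp).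
Variable P : probability T R.

Lemma probability_bigcap_ge (E : nat -> set T) (a : R) k : 0 <= a ->
  (forall s, (s < k)%N -> measurable (E s) /\ ((1 - a)%:E <= P (E s))%E) ->
  exists B : set T, [/\ measurable B, ((1 - a *+ k)%:E <= P B)%E &
    forall w, B w -> forall s, (s < k)%N -> E s w].
Proof.
move=> a0; elim: k => [|k IH] hE.
  exists setT; split=> //; first by rewrite mulr0n subr0 probability_setT.
have [|B [mB PB BE]] := IH; first by move=> s sk; apply: hE; apply: ltnW.
have [mk Pk] := hE k (leqnn _).
have PC (A : set T) x : measurable A -> ((1 - x)%:E <= P A)%E -> (P (~` A) <= x%:E)%E.
  move=> mA; rewrite probability_setC // => h; rewrite leeBlDr ?fin_num_measure //.
  by rewrite -leeBlDl // -EFinB.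
exists (B `&` E k); split.
- exact: measurableI.
- rewrite -[B `&` E k]setCK setCI probability_setC; last first.
    by apply: measurableU; apply: measurableC.
  rewrite EFinB leeB // mulrSr EFinD.
  apply: le_trans (measureU2 _ _ _) _; try exact: measurableC.
  by apply: leeD; apply: PC.
move=> w [Bw Ew] s; rewrite ltnS leq_eqVlt => /orP[/eqP -> //|sk].
exact: BE.
Qed.

(* What the running time of AppxPCA depends on: few rounds, and a gap of order
   [delta * lam] at every shift [lam] at which [A] is called. *)
Definition fast_pca d (A : method R d) (N : 'M[R]_d) (delta p : R)
    (w0 : 'cV[R]_d) (l : R) (F f : nat) : Prop :=
  [/\ (f <= F)%N, pca_stop A N delta p w0 f,
      forall i, (i < f)%N -> ~~ pca_stop A N delta p w0 i &
      exists mu, l <= mu /\ forall i, (i <= f.+1)%N ->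
        let lam := pca_shift A N delta p w0 i in
        [/\ mu < lam, lam <= 3 / 2, delta * lam / 27 <= lam - mu &
            psd (lam%:M - N - (lam - mu)%:M)]].

(** On the intersection of the good events, norms and termination are proved together by induction:
    [random_run] leaves a column arbitrary if its call does not terminate, and termination of call
    [s] uses that the earlier columns have norm at most 1, so that the deflated matrix stays below
    the identity. *)
Lemma lazysvd_good_event d (A : T -> method R d) (M : 'M[R]_d) k
    (delta eps p l : R) F (w0 v : nat -> T -> 'cV[R]_d) :
  (0 < k <= d)%N -> 0 < delta < 1 -> 0 < p < 1 -> 0 < l ->
  psd M -> (forall x : 'cV[R]_d, dot x (M *m x) <= dot x x) ->
  (forall s (W : 'M[R]_(s, d)), (s < k)%N -> exists2 y : 'cV[R]_d, y != 0 &
     W *m y = 0 /\ l * dot y y <= dot y (M *m y)) ->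
  (3 / 4) ^+ F * (3 / 2) <= 4 / 15 * (delta / 2 * l) ->
  (forall w, accurate (A w)) ->
  random_run P A M k delta eps p w0 v ->
  exists E : set T, [/\ measurable E, ((1 - p)%:E <= P E)%E &
    forall w, E w ->
      lazysvd (A w) M k delta eps p (w0^~ w) (v^~ w) /\
      forall s, (s < k)%N -> exists f,
        fast_pca (A w) (deflate M (v^~ w) s) (delta / 2) (p / k%:R) (w0 s w) l F f].
Proof.
move=> /andP[k0 kd] /andP[dl0 dl1] /andP[p0 p1] l0 pM M1 mm hF accA run.
have d0 : (0 < d)%N by apply: leq_trans kd.
have kR : 1 <= k%:R :> R by rewrite ler1n.
have dR : 1 <= d%:R :> R by rewrite ler1n.
have kp : 0 < k%:R :> R by rewrite ltr0n.
have dp : 0 < d%:R :> R by rewrite ltr0n.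
set p' := p / k%:R; have p'0 : 0 < p' by rewrite divr_gt0.
have p'1 : p' <= 1 by rewrite ler_pdivrMr // mul1r (le_trans (ltW p1)).
pose sigma := pca_sigma d (delta / 2) p'.
pose t := p' / (2 * d%:R).
have t0 : 0 < t by apply: divr_gt0 => //; apply: mulr_gt0.
have td : 2 * t * d%:R = p'.
  by rewrite /t; move: (p') => x; field; rewrite gt_eqF.
have s0 : 0 < sigma.
  rewrite /sigma /pca_sigma; apply: divr_gt0; first by apply: mulr_gt0 => //; apply: divr_gt0.
  by rewrite !mulr_gt0 // ltr0n pca_m1_gt0.
(* The condition [s < k] is placed under the existential so that [choice] yields one family of
   events. *)
have good s : exists E : set T, (s < k)%N -> [/\ measurable E, ((1 - p')%:E <= P E)%E &
    forall w, E w -> exists q : 'cV[R]_d,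
      [/\ l2norm q = 1, t <= `|dot (w0 s w) q| &
          forall y : 'cV[R]_d, (1 - sigma ^+ 2) * dot y (deflate M (v^~ w) s *m y) <=
            dot q (deflate M (v^~ w) s *m q) * dot y y]].
  have [sk|] := ltnP s k; last by exists set0.
  have [uX mv ind _] := run s sk.
  have mY : random_mx (fun w => colmx s (v^~ w)).
    apply: measurable_random_mx => i j; under eq_fun do rewrite mxE.
    have [_ mvj _ _] := run j (ltn_trans (ltn_ord j) sk).
    exact: random_mx_entry.
  have [||E [mE PE hE]] := @good_start_event _ _ _ P d d s (w0 s) _
    (fun V => deflate M (columns V) s) (sigma ^+ 2) t d0 uX mY ind
    (@deflate_continuous R d M s s) (fun V => @deflate_psd R d M _ s pM) _ t0.
  - by rewrite exprn_gt0.
  - by rewrite td.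
  exists E => _; split=> // [|w Ew]; first by rewrite -td.
  have [q [q1 qt hq]] := hE w Ew; exists q; split=> // y.
  by have := hq y; rewrite deflate_columns.
have [E0 hE0] := choice good.
have [|s sk|B [mB PB hB]] := @probability_bigcap_ge E0 p' k; first exact: ltW.
  by have [] := hE0 s sk.
exists B; split=> //.
  by move: PB; rewrite -[p' *+ k]mulr_natr /p' divfK // gt_eqF.
move=> w Bw.
have step s : (s < k)%N -> (forall j, (j < s)%N -> l2norm (v j w) <= 1) ->
    exists f, fast_pca (A w) (deflate M (v^~ w) s) (delta / 2) p' (w0 s w) l F f.
  move=> sk v1; set N := deflate _ _ _.
  have [_ _ hE] := hE0 s sk; have [q [q1 qt hq]] := hE _ (hB _ Bw s sk).
  have pN : psd N by apply: deflate_psd.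
  have [mu mu0 [Nmu hmu]] := rayleigh_sup d0 pN.
  have N1 := deflate_le1 M1 v1.
  have lmu : l <= mu.
    have [y y0 [Wy hy]] := mm s (colmx s (v^~ w))^T sk.
    rewrite -(ler_pM2r (_ : 0 < dot y y)) ?dot_gt0 //.
    apply: le_trans hy _; apply: le_trans (Nmu y).
    rewrite dot_deflate_orth // => j js.
    move/matrixP/(_ (Ordinal js) 0): Wy; rewrite !mxE => Wy; rewrite -[RHS]Wy.
    by apply: eq_bigr => i _; rewrite !mxE.
  have mu1 : mu <= 1.
    apply/ler_addgt0Pr => e e0; have [u u1 hu] := hmu e e0.
    by have := N1 u; rewrite u1 -/N; lra.
  have mup : 0 < mu by apply: lt_le_trans lmu.
  (* [q] is only known to compete with every [y]; approximate maximizers carry this over to the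
     supremum [mu]. *)
  have qN : (1 - sigma ^+ 2) * mu <= dot q (N *m q).
    have [h|h] := leP (1 - sigma ^+ 2) 0.
      by apply: (@le_trans _ _ 0); [rewrite mulr_le0_ge0|apply: pN.2].
    apply/ler_addgt0Pr => e e0; have [u u1 hu] := hmu (e / (1 - sigma ^+ 2)) (divr_gt0 e0 h).
    have : (1 - sigma ^+ 2) * dot u (N *m u) + e <= dot q (N *m q) + e.
      by rewrite lerD2r; have := hq u; rewrite u1 mulr1.
    apply: le_trans.
    have : (1 - sigma ^+ 2) * (mu - e / (1 - sigma ^+ 2)) <=
           (1 - sigma ^+ 2) * dot u (N *m u) by rewrite ler_pM2l // ltW.
    by rewrite mulrBr [_ * (e / _)]mulrC divfK ?gt_eqF // lerBlDr.
  have uw : l2norm (w0 s w) = 1 by case: (run s sk) => -[].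
  have dl2 : delta / 2 <= 1 / 2 by lra.
  have dl2' : 0 < delta / 2 by lra.
  have [f [fF sf nsf hf]] := pca_terminates (accA w) pN Nmu d0 dl2' dl2 p'0 p'1 uw mup mu1 q1 qN qt lmu hF.
  exists f; split=> //; exists mu; split=> // i ifl /=.
  have [h1 h2 h3] := hf i ifl; split=> //.
  exact: shift_gap_psd.
have vstep s : (s < k)%N -> (exists f, fast_pca (A w) (deflate M (v^~ w) s) (delta / 2) p' (w0 s w) l F f) ->
    exists2 v', lazysvd_call (A w) M k delta eps p (w0^~ w) (v^~ w) s v' & v s w = new_column (v^~ w) s v'.
  move=> sk [f [_ sf nsf _]].
  pose v' := pca_power (A w) (deflate M (v^~ w) s) (w0 s w)
    (pca_shift (A w) (deflate M (v^~ w) s) (delta / 2) p' (w0 s w) f.+1)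
    (pca_eps2 d (delta / 2) eps p') (pca_m2 d eps p').
  have call : lazysvd_call (A w) M k delta eps p (w0^~ w) (v^~ w) s v' by exists f.
  by exists v' => //; have [_ _ _] := run s sk; apply.
have v1 s : (s <= k)%N -> forall j, (j < s)%N -> l2norm (v j w) <= 1.
  elim: s => // s IH sk j; rewrite ltnS leq_eqVlt => /orP[/eqP ->|]; last exact: IH (ltnW sk) _.
  have [v' _ ->] := vstep s sk (step s sk (IH (ltnW sk))).
  exact: l2norm_normalize_le1.
by split=> s sk; [apply: vstep|]; rewrite ?sk //; apply: step => //; apply: v1 (ltnW sk).
Qed.

End Run.

(** * The program *)

Ltac regs := repeat match goal with
  | |- context [@eq_op _ ?x ?x] => rewrite eqxx
  | |- context [@eq_op _ ?x ?y] => rewrite (_ : (x == y) = false); last by lia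
  end.

Section Program.
Variables (R : realType) (d : nat) (inp : input R d) (Q : Type).
Variable call : method R d -> state R d -> Q ->
  R -> 'cV[R]_d -> R -> 'cV[R]_d -> nat -> Prop.
Variables (M : 'M[R]_d) (k n : nat) (a : 'I_n -> 'cV[R]_d).
Variables (delta eps p : R) (desc : nat -> Q) (tcall : nat -> nat).
Implicit Types (st : state R d) (s : nat) (v : nat -> 'cV[R]_d).

(* Vector registers: [0 .. n - 1] hold the deflated input vectors, [n] the zero
   vector, [n + 1] the start vector, [n + 2] and [n + 3] the vectors [w] and [v] of
   AppxPCA, [n + 6 + s] the column [v_s]; [n + 4] and [n + 5] are left to the
   routines given to AGD.  Scalar registers: 0 is the shift, 1 the accuracy, 3 the
   gap, 4 the exit threshold. *)
Local Notation rw0 := n.+1.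
Local Notation rw := n.+2.
Local Notation rv := n.+3.
Definition out_reg s := (n + s).+4.+2.
Local Notation dl := (delta / 2).
Local Notation pp := (p / k%:R).

(** There is no copy instruction: this is a [VAxpy] whose scaled vector is the zero vector kept in
    register [n]. *)
Definition code_copy (i j : nat) : seq (instr R) := [:: VAxpy R i 0 n j].

Definition code_normalize (i j : nat) : seq (instr R) :=
  [:: VDot R 2 j j; SSqrt R 2 2; SInv R 2 2; VAxpy R i 2 j n].

(* [v_i := v_i - <v_j, v_l> v_j] *)
Definition code_project (i j l : nat) : seq (instr R) :=
  [:: VDot R 2 j l; SConst 5 (-1); SMul R 2 2 5; VAxpy R i 2 j i].

Definition code_gap : seq (instr R) :=
  [:: VDot R 2 rw rv; SConst 5 (-1); SMul R 6 5 1; SAdd R 2 2 6; SInv R 2 2;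
      SConst 6 (1 / 2); SMul R 3 6 2; SConst 6 (- (1 / 2)); SMul R 6 6 3;
      SAdd R 0 0 6; SConst 6 (dl / 3); SMul R 4 6 0].

(** The lengths [m1] and [m2] depend on the parameters and not on the matrix, so these loops are
    unrolled; only the number of rounds needs a [Repeat]. *)
Fixpoint inverts s m : prog R Q :=
  if m is m'.+1 then Seq (inverts s m') (Invert R rw (desc s) 0 rw 1)
  else Code Q [::].

Definition pca_round_prog s : prog R Q :=
  Seq (Code Q (code_copy rw rw0)) (Seq (inverts s (pca_m1 d pp))
    (Seq (Code Q (code_normalize rw rw))
      (Seq (Invert R rv (desc s) 0 rw 1) (Code Q code_gap)))).

Definition column_code s : seq (instr R) :=
  code_copy rv rw ++ flatten [seq code_project rv (out_reg j) rw | j <- iota 0 s]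
  ++ code_normalize (out_reg s) rv.

(** For AGD [n = 0] and this code is empty: there the projections take place inside the
    multiplication routine. *)
Definition deflate_code s : seq (instr R) :=
  flatten [seq code_project i (out_reg s) i | i <- iota 0 n].

Definition column_prog s : prog R Q :=
  Seq (Draw R Q rw0 s)
  (Seq (Code Q [:: SConst 0 (1 + dl); SConst 1 (pca_eps1 d dl pp)])
  (Seq (Repeat (pca_round_prog s) 3 4)
  (Seq (Code Q (SConst 1 (pca_eps2 d dl eps pp) :: code_copy rw rw0))
  (Seq (inverts s (pca_m2 d eps pp))
       (Code Q (code_normalize rw rw ++ column_code s ++ deflate_code s)))))).

Fixpoint lazysvd_prog s : prog R Q :=
  if s is s'.+1 then Seq (lazysvd_prog s') (column_prog s') else Code Q [::].

Definition holds_columns v s st : Prop :=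
  [/\ vreg st n = 0, forall j, (j < s)%N -> vreg st (out_reg j) = v j &
      forall i : 'I_n, vreg st i = project_out_all v s (a i)].

(** Registers [n + 1] to [n + 5] are scratch; the others carry the invariant [holds_columns]. *)
Definition agree st st' : Prop :=
  forall r, (r <= n)%N || (n.+4.+1 < r)%N -> vreg st' r = vreg st r.

Lemma agree_trans st1 st2 st3 : agree st1 st2 -> agree st2 st3 -> agree st1 st3.
Proof. by move=> h1 h2 r hr; rewrite h2 ?h1. Qed.

Lemma agree_set st r x : (n < r <= n.+4.+1)%N -> agree st (set_vreg st r x).
Proof. by move=> hr r' hr' /=; regs. Qed.

Lemma agree_holds v s st st' :
  agree st st' -> holds_columns v s st -> holds_columns v s st'.
Proof.
move=> h [h1 h2 h3]; split=> [|j js|i]; rewrite h ?h2 //.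
- by rewrite leqnn.
- by rewrite /out_reg; lia.
by rewrite ltnW.
Qed.

Lemma steps_cat st c1 c2 :
  steps inp st (c1 ++ c2) = steps inp (steps inp st c1) c2.
Proof. exact: foldl_cat. Qed.

Lemma steps_cost_cat (c1 c2 : seq (instr R)) :
  steps_cost inp (c1 ++ c2) = (steps_cost inp c1 + steps_cost inp c2)%N.
Proof. exact: big_cat. Qed.

Lemma steps_project st i j l : vreg (steps inp st (code_project i j l)) =
  fun r => if r == i then vreg st i - dot (vreg st j) (vreg st l) *: vreg st j
           else vreg st r.
Proof.
apply/funext => r /=; case: eqP => // _.
by rewrite mulrN1 scaleNr addrC.
Qed.

Lemma steps_copy st i j : vreg st n = 0 ->
  vreg (steps inp st (code_copy i j)) =
  fun r => if r == i then vreg st j else vreg st r.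
Proof. by move=> z; apply/funext => r /=; rewrite z scaler0 add0r. Qed.

Lemma steps_normalize st i j : vreg st n = 0 ->
  vreg (steps inp st (code_normalize i j)) =
  fun r => if r == i then normalize (vreg st j) else vreg st r.
Proof. by move=> z; apply/funext => r /=; rewrite z addr0. Qed.

Lemma steps_gap st : let st' := steps inp st code_gap in
  let g := 1 / 2 * (dot (vreg st rw) (vreg st rv) - sreg st 1)^-1 in
  let lam := sreg st 0 - g / 2 in
  [/\ vreg st' = vreg st, sreg st' 1 = sreg st 1, sreg st' 3 = g,
      sreg st' 0 = lam & sreg st' 4 = dl * lam / 3].
Proof.
move=> st' g lam.
have gE : 1 / 2 * (dot (vreg st rw) (vreg st rv) + -1 * sreg st 1)^-1 = g.
  by rewrite mulN1r.
have lE : sreg st 0 + - (1 / 2) * g = lam by rewrite mulNr mulrAC mul1r.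
have l3 : dl / 3 * lam = dl * lam / 3 by rewrite mulrAC.
clearbody g lam; split; [by []|by []|exact: gE| |].
  by rewrite -lE -gE.
by rewrite -l3 -lE -gE.
Qed.

(** The coefficients are taken against [rw], which stays unchanged, and not against the partially
    projected [rv]: the result is exactly [(1 - V V^T) w], whether or not the columns are
    orthonormal. *)
Lemma column_code_spec v s st : holds_columns v s st ->
  vreg (steps inp st (column_code s)) =
  fun r => if r == out_reg s then new_column v s (vreg st rw)
           else if r == rv then (1%:M - colmx s v *m (colmx s v)^T) *m vreg st rw
           else vreg st r.
Proof.
move=> [z ho _]; rewrite !steps_cat.
set st1 := steps inp st (code_copy rv rw).
have st1E := steps_copy rv rw z; rewrite -/st1 in st1E.
set st2 := steps inp st1 _.
suff st2E : vreg st2 = fun r =>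
    if r == rv then (1%:M - colmx s v *m (colmx s v)^T) *m vreg st rw else vreg st r.
  rewrite steps_normalize st2E; last by regs.
  by apply/funext => r; regs.
have -> : (1%:M - colmx s v *m (colmx s v)^T) *m vreg st rw =
    vreg st rw - \sum_(j <- iota 0 s) dot (v j) (vreg st rw) *: v j.
  rewrite mulmxBl mul1mx -mulmxA; congr (_ - _).
  rewrite -[s in iota 0 s]subn0 -/(index_iota 0 s) big_mkord.
  apply/colP => i; rewrite mxE summxE; apply: eq_bigr => j _.
  rewrite !mxE mulrC; congr (_ * _).
  by apply: eq_bigr => l _; rewrite !mxE.
rewrite /st2; have : forall j, j \in iota 0 s -> vreg st (out_reg j) = v j.
  by move=> j; rewrite mem_iota => /ho.
elim/last_ind: (iota 0 s) => [_|js j IH hj] /=.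
  by transitivity (vreg st1) => //; rewrite st1E; apply/funext => r; rewrite big_nil subr0.
rewrite map_rcons flatten_rcons steps_cat steps_project IH; last first.
  by move=> i ij; apply: hj; rewrite mem_rcons inE ij orbT.
have vj : vreg st (out_reg j) = v j by apply: hj; rewrite mem_rcons inE eqxx.
have ne1 : (rw == rv) = false by lia.
have ne2 : (out_reg j == rv) = false by rewrite /out_reg; lia.
rewrite ne1 ne2 eqxx vj -cats1 big_cat big_seq1 /=; apply/funext => r.
by case: eqP => //; rewrite opprD addrA.
Qed.

Lemma steps_cost_flatten (f : nat -> seq (instr R)) (js : seq nat) q :
  (forall j, steps_cost inp (f j) = q) ->
  steps_cost inp (flatten [seq f j | j <- js]) = (size js * q)%N.
Proof.
by move=> fq; elim: js => [|j js IH] /=; rewrite ?steps_cost_cat ?fq ?IH /steps_cost ?big_nil.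
Qed.

Lemma deflate_code_spec v s st : holds_columns v s st ->
  vreg st (out_reg s) = v s ->
  holds_columns v s.+1 (steps inp st (deflate_code s)).
Proof.
move=> [z ho ha] hs.
suff E i : (i <= n)%N -> vreg (steps inp st
     (flatten [seq code_project i (out_reg s) i | i <- iota 0 i])) =
   fun r => if (r < i)%N then project_out (v s) (vreg st r) else vreg st r.
  rewrite /deflate_code; split; rewrite E // ?ltnn //; last first.
    by move=> i; rewrite ltn_ord ha.
  move=> j; rewrite ltnS leq_eqVlt => js.
  have -> : (out_reg j < n)%N = false by rewrite /out_reg; lia.
  by case/orP: js => [/eqP ->|/ho].
elim: i => [_|i IH ni]; first by apply/funext.
rewrite (_ : iota 0 i.+1 = iota 0 i ++ [:: i]); last by rewrite -addn1 iotaD.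
rewrite map_cat flatten_cat steps_cat [flatten [:: _]]cats0 steps_project.
rewrite (IH (ltnW ni)); apply/funext => r.
have -> : (out_reg s < i)%N = false by rewrite /out_reg; lia.
have -> : (r < i.+1)%N = (r == i) || (r < i)%N by rewrite ltnS leq_eqVlt.
by rewrite ltnn hs /project_out; case: eqP => [->|].
Qed.

Section Call.
Variables (A : method R d) (w0 v : nat -> 'cV[R]_d) (s : nat).
Local Notation N := (deflate M v s).
Hypothesis call_spec : forall st lam b eta, holds_columns v s st ->
  call A st (desc s) lam b eta (answer A lam N b eta)
    (Defs.count A lam N b eta * tcall s)%N.
Local Notation m1 := (pca_m1 d pp).
Local Notation m2 := (pca_m2 d eps pp).
Local Notation eps1 := (pca_eps1 d dl pp).
Local Notation eps2 := (pca_eps2 d dl eps pp).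
Local Notation shift := (pca_shift A N dl pp (w0 s)).
Local Notation gap := (pca_gap A N dl pp (w0 s)).
Local Notation stop := (pca_stop A N dl pp (w0 s)).

Definition call_bound (lam eta : R) (K : nat) : Prop :=
  forall x, (Defs.count A lam N x eta * tcall s <= K)%N.

Lemma exec_inverts st m : holds_columns v s st -> exists st' t,
  [/\ exec inp (call A) w0 (inverts s m) st st' t, agree st st',
      sreg st' = sreg st, vreg st' rw0 = vreg st rw0 &
      vreg st' rw = iter m (fun x => answer A (sreg st 0) N x (sreg st 1)) (vreg st rw) /\
      forall K, call_bound (sreg st 0) (sreg st 1) K -> (t <= m * K)%N].
Proof.
move=> hs; elim: m => [|m [st1 [t1 [e1 ag1 sr1 w01 [rw1 b1]]]]].
  exists st, (steps_cost inp [::]); split=> //; first exact: ExecCode.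
  by rewrite /steps_cost big_nil; split.
have hs1 := agree_holds ag1 hs.
have c1 := call_spec (sreg st1 0) (vreg st1 rw) (sreg st1 1) hs1.
exists (set_vreg st1 rw (answer A (sreg st1 0) N (vreg st1 rw) (sreg st1 1))).
exists (t1 + Defs.count A (sreg st1 0) N (vreg st1 rw) (sreg st1 1) * tcall s)%N.
split=> //.
- by apply: ExecSeq e1 _; apply: ExecInvert.
- by apply: agree_trans ag1 _; apply: agree_set; lia.
- by rewrite /=; regs.
split; first by rewrite /= eqxx sr1 rw1.
move=> K hK; rewrite mulSn addnC leq_add ?b1 //.
by have := hK (vreg st1 rw); rewrite sr1.
Qed.

Lemma exec_round st i : holds_columns v s st ->
  vreg st rw0 = w0 s -> sreg st 0 = shift i -> sreg st 1 = eps1 ->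
  exists st' t,
  [/\ exec inp (call A) w0 (pca_round_prog s) st st' t, agree st st',
      vreg st' rw0 = w0 s /\ sreg st' 1 = eps1,
      [/\ sreg st' 0 = shift i.+1, sreg st' 3 = gap (shift i) &
          sreg st' 4 = dl * shift i.+1 / 3] &
      forall K, call_bound (shift i) eps1 K ->
        (t <= m1.+1 * K + (8 * d + 14))%N].
Proof.
move=> hs hw s0 s1.
have [z _ _] := hs.
pose st1 := steps inp st (code_copy rw rw0).
have v1 := steps_copy rw rw0 z; rewrite -/st1 in v1.
have sr1 : sreg st1 = sreg st by [].
have ag1 : agree st st1 by move=> r hr; rewrite v1; regs.
have hs1 := agree_holds ag1 hs.
have [st2 [t2 [e2 ag2 sr2 w2 [rw2 b2]]]] := exec_inverts m1 hs1.
have hs2 := agree_holds ag2 hs1; have [z2 _ _] := hs2.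
pose st3 := steps inp st2 (code_normalize rw rw).
have v3 := steps_normalize rw rw z2; rewrite -/st3 in v3.
have ag3 : agree st2 st3 by move=> r hr; rewrite v3; regs.
have hs3 := agree_holds ag3 hs2.
have lam2 : sreg st2 0 = shift i by rewrite sr2 sr1.
have eta2 : sreg st2 1 = eps1 by rewrite sr2 sr1.
have lam3 : sreg st3 0 = shift i by [].
have eta3 : sreg st3 1 = eps1 by [].
have w3 : vreg st3 rw = pca_power A N (w0 s) (shift i) eps1 m1.
  rewrite v3 eqxx rw2 v1 eqxx sr1 s0 s1 hw //.
set w := pca_power _ _ _ _ _ _ in w3.
have c3 := call_spec (sreg st3 0) (vreg st3 rw) (sreg st3 1) hs3.
rewrite lam3 eta3 w3 in c3.
pose x := answer A (shift i) N w eps1.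
pose st4 := set_vreg st3 rv x.
have e4 : exec inp (call A) w0 (Invert R rv (desc s) 0 rw 1) st3 st4
   (Defs.count A (shift i) N w eps1 * tcall s)%N.
  by apply: ExecInvert; rewrite lam3 eta3 w3.
pose st5 := steps inp st4 code_gap.
have rw4 : vreg st4 rw = w.
  have -> : vreg st4 rw = if rw == rv then x else vreg st3 rw by [].
  by regs.
have rv4 : vreg st4 rv = x by rewrite /st4 /set_vreg /= eqxx.
have [v5 s51 s53 s50 s54] := steps_gap st4; rewrite -/st5 in v5 s51 s53 s50 s54.
have gapE : pca_gap A N dl pp (w0 s) (shift i) = 1 / 2 * (dot w x - eps1)^-1 by [].
rewrite rw4 rv4 [sreg st4 1]eta3 -gapE in s53.
rewrite rw4 rv4 [sreg st4 1]eta3 [sreg st4 0]lam3 -gapE in s50 s54.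
exists st5; eexists; split.
- apply: ExecSeq; first exact: ExecCode.
  apply: ExecSeq e2 _; apply: ExecSeq; first exact: ExecCode.
  by apply: ExecSeq e4 _; apply: ExecCode.
- apply: (agree_trans ag1); apply: (agree_trans ag2); apply: (agree_trans ag3).
  have : agree st3 st4 by apply: agree_set; lia.
  by move=> h r hr; rewrite v5 h.
- split; last by rewrite s51.
  rewrite v5; have -> : vreg st4 rw0 = if rw0 == rv then x else vreg st3 rw0 by [].
  by regs; rewrite v3; regs; rewrite w2 v1; regs.
- by [].
move=> K hK; rewrite /steps_cost !(big_cons, big_nil) /=.
have h2 : (t2 <= m1 * K)%N by apply: b2; rewrite sr1 s0 s1.
have := hK w; rewrite mulSn; lia.
Qed.

(** Induction on the number [j] of rounds that follow the current one, so that the loop is entered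
    at round [f - j]. The constant rises from 14 to 15 to pay for the exit test. *)
Lemma exec_loop f j st : stop f -> (forall i, (i < f)%N -> ~~ stop i) ->
  (j <= f)%N -> holds_columns v s st ->
  vreg st rw0 = w0 s -> sreg st 0 = shift (f - j) -> sreg st 1 = eps1 ->
  exists st' t,
  [/\ exec inp (call A) w0 (Repeat (pca_round_prog s) 3 4) st st' t, agree st st',
      vreg st' rw0 = w0 s, sreg st' 0 = shift f.+1 &
      forall K, (forall i, (i <= f)%N -> call_bound (shift i) eps1 K) ->
        (t <= j.+1 * (m1.+1 * K + (8 * d + 15)))%N].
Proof.
move=> sf nsf; elim: j st => [|j IH] st jf hs hw s0 s1.
  have [st1 [t1 [e1 ag1 [w1 _] [l1 g1 b1] c1]]] := exec_round hs hw s0 s1.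
  exists st1, t1.+1; split=> //.
  - apply: ExecExit e1 _; rewrite g1 b1 subn0; exact: sf.
  - by rewrite l1 subn0.
  move=> K hK; have := c1 K (hK _ (leq_subr _ _)); lia.
have [st1 [t1 [e1 ag1 [w1 z1] [l1 g1 b1] c1]]] := exec_round hs hw s0 s1.
have ji : (f - j.+1).+1 = (f - j)%N by rewrite subnSK.
rewrite ji in l1.
have [st2 [t2 [e2 ag2 w2 l2 c2]]] := IH st1 (ltnW jf) (agree_holds ag1 hs) w1 l1 z1.
exists st2, (t1.+1 + t2)%N; split=> //.
- apply: ExecLoop e1 _ e2; rewrite g1 b1; apply: (nsf (f - j.+1)%N).
  by rewrite ltn_subrL; lia.
- exact: agree_trans ag1 ag2.
move=> K hK; have := c1 K (hK _ (leq_subr _ _)); have := c2 K hK.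
by rewrite [(j.+2 * _)%N]mulSn; lia.
Qed.

Lemma exec_column f st : stop f -> (forall i, (i < f)%N -> ~~ stop i) ->
  v s = new_column v s (pca_power A N (w0 s) (shift f.+1) eps2 m2) ->
  holds_columns v s st ->
  exists st' t,
  [/\ exec inp (call A) w0 (column_prog s) st st' t, holds_columns v s.+1 st' &
      forall K, (forall i, (i <= f)%N -> call_bound (shift i) eps1 K) ->
        call_bound (shift f.+1) eps2 K ->
        (t <= f.+1 * (m1.+1 * K + (8 * d + 15)) + m2 * K
              + (13 * d + 7 + (s + n) * (4 * d + 2)))%N].
Proof.
move=> sf nsf vs hs.
pose st1 := steps inp (set_vreg st rw0 (w0 s)) [:: SConst 0 (1 + dl); SConst 1 eps1].
have v1 : vreg st1 = vreg (set_vreg st rw0 (w0 s)) by [].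
have ag1 : agree st st1.
  have : agree st (set_vreg st rw0 (w0 s)) by apply: agree_set; lia.
  by move=> h r hr; rewrite v1 h.
have w1 : vreg st1 rw0 = w0 s by rewrite v1 /= eqxx.
have hs1 := agree_holds ag1 hs.
have l1 : sreg st1 0 = shift (f - f) by rewrite subnn.
have [st2 [t2 [e2 ag2 w2 l2 c2]]] := exec_loop sf nsf (leqnn f) hs1 w1 l1 erefl.
have hs2 := agree_holds ag2 hs1; have [z2 _ _] := hs2.
pose st3 := steps inp st2 (SConst 1 eps2 :: code_copy rw rw0).
have v3 : vreg st3 = fun r => if r == rw then w0 s else vreg st2 r.
  rewrite -w2 -(steps_copy rw rw0 z2); apply/funext => r.
  by rewrite /= z2 !scaler0.
have ag3 : agree st2 st3 by move=> r hr; rewrite v3; regs.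
have hs3 := agree_holds ag3 hs2.
have l3 : sreg st3 0 = shift f.+1 by rewrite -l2.
have z3 : sreg st3 1 = eps2 by [].
have [st4 [t4 [e4 ag4 sr4 _ [rw4 c4]]]] := exec_inverts m2 hs3.
have hs4 := agree_holds ag4 hs3; have [z4 _ _] := hs4.
pose st5 := steps inp st4 (code_normalize rw rw).
have v5 := steps_normalize rw rw z4; rewrite -/st5 in v5.
have ag5 : agree st4 st5 by move=> r hr; rewrite v5; regs.
have hs5 := agree_holds ag5 hs4.
have rw5 : vreg st5 rw = pca_power A N (w0 s) (shift f.+1) eps2 m2.
  by rewrite v5 eqxx rw4 v3 eqxx l3 z3.
pose st6 := steps inp st5 (column_code s).
have v6 := column_code_spec hs5; rewrite -/st6 in v6.
have o6 : vreg st6 (out_reg s) = v s by rewrite v6 eqxx rw5 -vs.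
have hs6 : holds_columns v s st6.
  have [g1 g2 g3] := hs5; split; rewrite v6.
  - by rewrite /out_reg; regs.
  - by move=> j js; rewrite -g2 // /out_reg; regs.
  by move=> i; have := ltn_ord i; rewrite -g3 /out_reg => ?; regs.
have hs7 := deflate_code_spec hs6 o6.
exists (steps inp st6 (deflate_code s)); eexists; split.
- apply: ExecSeq; first exact: ExecDraw.
  apply: ExecSeq; first exact: ExecCode.
  apply: ExecSeq e2 _; apply: ExecSeq; first exact: ExecCode.
  apply: ExecSeq e4 _; rewrite /st6 /st5 -!steps_cat -catA; exact: ExecCode.
- by [].
move=> K hK hK2; have := c2 K hK.
have : (t4 <= m2 * K)%N by apply: c4; rewrite l3 z3.
have P i j l : steps_cost inp (code_project i j l) = (4 * d + 2)%N.
  by rewrite /steps_cost !(big_cons, big_nil) /=; lia.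
have E (i j l : nat -> nat) js : steps_cost inp
    (flatten [seq code_project (i x) (j x) (l x) | x <- js]) = (size js * (4 * d + 2))%N.
  exact: (@steps_cost_flatten (fun x => code_project (i x) (j x) (l x))).
rewrite /column_code /deflate_code !steps_cost_cat.
rewrite (E (fun=> rv) out_reg (fun=> rw)) (E id (fun=> out_reg s) id) !size_iota.
rewrite mulnDl /steps_cost /code_normalize /code_copy !(big_cons, big_nil) /=.
move: (f.+1 * _)%N (m2 * K)%N (s * _)%N (n * _)%N => x1 x2 x3 x4; lia.
Qed.
End Call.

Section Whole.
Variables (A : method R d) (w0 v : nat -> 'cV[R]_d) (f : nat -> nat).
Local Notation N s := (deflate M v s).
Hypothesis call_spec : forall s st lam b eta, (s < k)%N -> holds_columns v s st ->
  call A st (desc s) lam b eta (answer A lam (N s) b eta)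
    (Defs.count A lam (N s) b eta * tcall s)%N.
Local Notation shift s := (pca_shift A (N s) dl pp (w0 s)).
Hypothesis f_stop : forall s, (s < k)%N -> pca_stop A (N s) dl pp (w0 s) (f s).
Hypothesis f_first : forall s, (s < k)%N -> forall i, (i < f s)%N ->
  ~~ pca_stop A (N s) dl pp (w0 s) i.
Hypothesis v_new : forall s, (s < k)%N -> v s = new_column v s
  (pca_power A (N s) (w0 s) (shift s (f s).+1) (pca_eps2 d dl eps pp) (pca_m2 d eps pp)).
Hypotheses (in0 : in_reg inp n = 0) (ina : forall i : 'I_n, in_reg inp i = a i).

Lemma exec_lazysvd : exists st t,
  [/\ exec inp (call A) w0 (lazysvd_prog k) (start inp) st t,
      forall s, (s < k)%N -> vreg st (out_reg s) = v s &
      forall (K : nat -> nat), (forall s, (s < k)%N ->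
        (forall i, (i <= f s)%N -> call_bound A v s (shift s i) (pca_eps1 d dl pp) (K s)) /\
        call_bound A v s (shift s (f s).+1) (pca_eps2 d dl eps pp) (K s)) ->
      (t <= \sum_(s < k) ((f s).+1 * ((pca_m1 d pp).+1 * K s + (8 * d + 15))
         + pca_m2 d eps pp * K s + (13 * d + 7 + (s + n) * (4 * d + 2))))%N].
Proof.
suff E r : (r <= k)%N -> exists st t,
  [/\ exec inp (call A) w0 (lazysvd_prog r) (start inp) st t,
      holds_columns v r st &
      forall (K : nat -> nat), (forall s, (s < r)%N ->
        (forall i, (i <= f s)%N -> call_bound A v s (shift s i) (pca_eps1 d dl pp) (K s)) /\
        call_bound A v s (shift s (f s).+1) (pca_eps2 d dl eps pp) (K s)) ->
      (t <= \sum_(s < r) ((f s).+1 * ((pca_m1 d pp).+1 * K s + (8 * d + 15))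
         + pca_m2 d eps pp * K s + (13 * d + 7 + (s + n) * (4 * d + 2))))%N].
  have [st [t [e [_ h _] b]]] := E k (leqnn k).
  by exists st, t.
elim: r => [_|r IH rk].
  exists (start inp); eexists; split; first exact: ExecCode.
    by split=> // i; rewrite /start /= ina.
  by move=> K _; rewrite big_ord0 /steps_cost big_nil.
have [st [t [e h b]]] := IH (ltnW rk).
have [st' [t' [e' h' b']]] := @exec_column A w0 v r
  (fun st lam b eta => call_spec lam b eta rk) (f r) st (f_stop rk) (f_first rk)
  (v_new rk) h.
exists st', (t + t')%N; split=> //; first exact: ExecSeq e e'.
move=> K hK; rewrite big_ord_recr /= leq_add //.
  by apply: b => s sr; apply: hK; apply: ltnW.
by have [k1 k2] := hK r (leqnn _); apply: b'.
Qed.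
End Whole.

End Program.

(** * Running time *)

Section Bounds.
Variable R : realType.

Lemma ln_le (x : R) : 0 < x -> ln x <= x.
Proof. by move=> x0; apply/ltW/ln_sublinear. Qed.

Lemma ln_div (x y : R) : 0 < x -> 0 < y -> ln (x / y) = ln x + ln y^-1.
Proof. by move=> x0 y0; rewrite lnM ?posrE ?invr_gt0. Qed.

Lemma ln_mul_div (x y z : R) : 0 < x -> 0 < y -> 0 < z ->
  ln (x * y / z) = ln x + ln y + ln z^-1.
Proof.
move=> x0 y0 z0; rewrite ln_div ?lnM ?posrE //.
exact: mulr_gt0.
Qed.

Variables (k d : nat) (delta eps p lam1 l : R).
Hypotheses (k0 : (0 < k)%N) (d0 : (0 < d)%N).
Hypotheses (delta0 : 0 < delta) (delta1 : delta < 1) (eps0 : 0 < eps) (eps1 : eps < 1).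
Hypotheses (p0 : 0 < p) (p1 : p < 1) (l0 : 0 < l) (ll : l <= lam1) (lam11 : lam1 <= 1).

Local Notation H := (hidden_log k d delta eps p lam1 l).
Local Notation pp := (p / k%:R).
Local Notation dl := (delta / 2).

(** All terms of [hidden_log] are nonnegative, and [ln l^-1] is covered because it splits into
    [ln lam1^-1 + ln (lam1 / l)]. *)
Lemma hidden_log_bounds : [/\ 1 <= H, ln d%:R + 2 * ln k%:R + 2 * ln p^-1 + ln eps^-1 <= 2 * H,
  0 <= ln eps^-1, ln delta^-1 + ln l^-1 <= H & ln delta^-1 + ln eps^-1 <= H].
Proof.
have invge (x : R) : 0 < x -> x <= 1 -> 0 <= ln x^-1.
  by move=> x0 x1; rewrite ln_ge0 // -[1]invr1 lef_pV2 ?posrE.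
have lam10 : 0 < lam1 by apply: lt_le_trans ll.
have h1 : 0 <= ln (k%:R : R) by rewrite ln_ge0 // ler1n.
have h2 : 0 <= ln (d%:R : R) by rewrite ln_ge0 // ler1n.
have h3 : 0 <= ln delta^-1 by apply: invge => //; apply: ltW.
have h4 : 0 <= ln p^-1 by apply: invge => //; apply: ltW.
have h5 : 0 <= ln lam1^-1 by apply: invge.
have h6 : 0 <= ln (lam1 / l) by rewrite ln_ge0 // ler_pdivlMr // mul1r.
have h7 : 0 <= ln eps^-1 by apply: invge => //; apply: ltW.
have h8 : ln l^-1 = ln lam1^-1 + ln (lam1 / l).
  rewrite -lnM ?posrE ?invr_gt0 ?divr_gt0 //; congr ln; field.
  by rewrite !gt_eqF.
by rewrite /hidden_log h8; split; lra.
Qed.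

Lemma pp_gt0 : 0 < pp. Proof. by rewrite divr_gt0 ?ltr0n. Qed.

Lemma pp_le1 : pp <= 1.
Proof. by rewrite ler_pdivrMr ?ltr0n // mul1r (le_trans (ltW p1)) // ler1n. Qed.

Lemma ln_inv_pp2 : ln (pp ^+ 2)^-1 = 2 * ln k%:R + 2 * ln p^-1.
Proof.
rewrite -exprVn lnXn ?invr_gt0 ?pp_gt0 // invf_div ln_div ?ltr0n //.
by rewrite mulr2n -mulrDr -[2]/(1 + 1) mulrDl !mul1r.
Qed.

(** Constants are crude here and below: [ln 288] is bounded by 288, and [1 <= H] absorbs additive
    constants. *)
Lemma pca_m1_le : (pca_m1 d pp)%:R <= 10 ^+ 4 * H.
Proof.
have [h1 h2 h3 _ _] := hidden_log_bounds.
have d0R : 0 < d%:R :> R by rewrite ltr0n.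
have p20 : 0 < pp ^+ 2 by rewrite exprn_gt0 // pp_gt0.
case/andP: (pca_m1_bounds d0 pp_gt0 pp_le1) => _.
have -> : ln (288 * d%:R / pp ^+ 2) = ln 288 + ln d%:R + ln (pp ^+ 2)^-1.
  have c0 : (0 : R) < 288 by rewrite ltr0n.
  exact: (ln_mul_div c0 d0R p20).
rewrite ln_inv_pp2; move: (pca_m1 d pp) => m1.
have : ln (288 : R) <= 288 by apply: ln_le; rewrite ltr0n.
by move=> *; lra.
Qed.

Lemma pca_m2_bounds : ln (36 * d%:R / (pp ^+ 2 * eps)) <= (pca_m2 d eps pp)%:R <= 10 ^+ 4 * H.
Proof.
have [h1 h2 h3 _ _] := hidden_log_bounds.
have d0R : 0 < d%:R :> R by rewrite ltr0n.
have d1R : 1 <= d%:R :> R by rewrite ler1n.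
have p20 : 0 < pp ^+ 2 by rewrite exprn_gt0 // pp_gt0.
have p21 : pp ^+ 2 <= 1 by rewrite exprn_ile1 ?pp_le1 // ltW // pp_gt0.
have pe : pp ^+ 2 * eps <= 1 by rewrite mulr_ile1 // ltW.
have : 0 <= ln (36 * d%:R / (pp ^+ 2 * eps)).
  rewrite ln_ge0 // ler_pdivlMr; last exact: mulr_gt0.
  rewrite mul1r; apply: le_trans pe _.
  by lra.
move=> /natr_absz_ceil /andP[-> /ltW h] /=; apply: le_trans h _.
have pi : 0 < (pp ^+ 2)^-1 by rewrite invr_gt0.
have ei : 0 < eps^-1 by rewrite invr_gt0.
have -> : 36 * d%:R / (pp ^+ 2 * eps) = 36 * (d%:R * ((pp ^+ 2)^-1 * eps^-1)).
  by rewrite invfM; ring.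
have h4 : 0 < (pp ^+ 2)^-1 * eps^-1 by exact: mulr_gt0.
rewrite lnM ?posrE //; last exact: mulr_gt0.
rewrite lnM // lnM // ln_inv_pp2.
have : ln (36 : R) <= 36 by apply: ln_le.
by move=> *; lra.
Qed.

Lemma pca_m2_gt0 : (0 < pca_m2 d eps pp)%N.
Proof.
rewrite -(ltr0n R); case/andP: pca_m2_bounds => h _; apply: lt_le_trans h.
have d1R : 1 <= d%:R :> R by rewrite ler1n.
have p20 : 0 < pp ^+ 2 by rewrite exprn_gt0 // pp_gt0.
have p21 : pp ^+ 2 <= 1 by rewrite exprn_ile1 ?pp_le1 // ltW // pp_gt0.
have pe : pp ^+ 2 * eps <= 1 by rewrite mulr_ile1 // ltW.
rewrite ln_gt0 // ltr_pdivlMr; last exact: mulr_gt0.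
rewrite mul1r; apply: le_lt_trans pe _.
by lra.
Qed.

(** With [F] this number, [(3/4)^F <= exp (- F / 4) <= delta l / 12], and
    [3/2 * delta l / 12 = delta l / 8] is below the [2/15 delta l] that [pca_terminates] asks for at
    accuracy [delta / 2]. *)
Definition max_rounds : nat := `|Num.ceil (4 * ln (12 / (delta * l)))|%N.

Lemma max_rounds_le : max_rounds%:R <= 10 ^+ 4 * H.
Proof.
have [h1 _ _ h4 _] := hidden_log_bounds.
have dl0 : 0 < delta * l by rewrite mulr_gt0.
have dl1 : delta * l <= 1 by apply: mulr_ile1; [exact: ltW|exact: ltW|exact: ltW|exact: le_trans ll _].
have l12 : 0 <= ln (12 / (delta * l)).
  by rewrite ln_ge0 // ler_pdivlMr // mul1r; apply: le_trans dl1 _; lra.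
have /andP[_ /ltW h] : 4 * ln (12 / (delta * l)) <= max_rounds%:R <
    4 * ln (12 / (delta * l)) + 1 by apply: natr_absz_ceil; rewrite mulr_ge0.
apply: le_trans h _; rewrite ln_div // invfM lnM ?posrE ?invr_gt0 //.
have : ln (12 : R) <= 12 by apply: ln_le.
by move=> *; lra.
Qed.

Lemma max_rounds_enough : (3 / 4) ^+ max_rounds * (3 / 2) <= 4 / 15 * (dl * l).
Proof.
have dl0 : 0 < delta * l by rewrite mulr_gt0.
have dl1 : delta * l <= 1 by apply: mulr_ile1; [exact: ltW|exact: ltW|exact: ltW|exact: le_trans ll _].
have l12 : 0 <= ln (12 / (delta * l)).
  by rewrite ln_ge0 // ler_pdivlMr // mul1r; apply: le_trans dl1 _; lra.
have /andP[h _] : 4 * ln (12 / (delta * l)) <= max_rounds%:R <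
    4 * ln (12 / (delta * l)) + 1 by apply: natr_absz_ceil; rewrite mulr_ge0.
have -> : 3 / 4 = 1 - 1 / 4 :> R by field.
have h2 : (1 - 1 / 4) ^+ max_rounds <= (12 / (delta * l))^-1 :> R.
  apply: exprn_le_inv; first by apply/andP; split; lra.
    by rewrite divr_gt0.
  by lra.
have h12 : (12 / (delta * l))^-1 = delta * l / 12 by exact: invf_div.
have h32 : (0 : R) <= 3 / 2 by rewrite divr_ge0.
rewrite h12 in h2.
apply: (le_trans (ler_wpM2r h32 h2)); clear h h2 l12; lra.
Qed.

Lemma ln_delta12 : ln (12 / delta) <= 12 + H.
Proof.
have [h1 _ h3 _ h5] := hidden_log_bounds.
rewrite ln_div //; have : ln (12 : R) <= 12 by apply: ln_le.
by lra.
Qed.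

(** The inverse accuracy is [64 m1 (12 / delta)^m1]; its logarithm contains the product
    [m1 ln (12 / delta)] of two logarithms, hence the square of [H]. *)
Lemma ln_pca_eps1 : ln (pca_eps1 d dl pp)^-1 <= 10 ^+ 6 * H ^+ 2.
Proof.
have [h1 _ _ _ _] := hidden_log_bounds.
have m0 : 0 < (pca_m1 d pp)%:R :> R by rewrite ltr0n pca_m1_gt0 ?pp_gt0 ?pp_le1.
have mle := pca_m1_le; have hd := ln_delta12.
rewrite /pca_eps1; move: (pca_m1 d pp) m0 mle => m m0 mle.
have d60 : 0 < dl / 6 by rewrite !divr_gt0.
rewrite invfM invrK -exprVn lnM ?posrE ?mulr_gt0 ?exprn_gt0 ?invr_gt0 //.
rewrite lnXn ?invr_gt0 // (_ : (dl / 6)^-1 = 12 / delta); last first.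
  by field; rewrite gt_eqF.
have h2 : ln (64 * m%:R : R) <= 64 * m%:R by apply: (@ln_le); apply: mulr_gt0.
have h3 : ln (12 / delta) *+ m <= (12 + H) * (10 ^+ 4 * H).
  rewrite -[ln (12 / delta) *+ m]mulr_natr.
  apply: le_trans (ler_wpM2r (ltW m0) hd) _; rewrite ler_wpM2l //; lra.
have h4 : H <= H ^+ 2 by rewrite expr2 ler_peMl // (le_trans ler01).
move: h2 h3 h4; rewrite expr2; move: mle h1; set h := H.
move: (ln (12 / delta) *+ _) (ln (_ * _)) => y x; lra.
Qed.

Lemma ln_pca_eps2 : ln (pca_eps2 d dl eps pp)^-1 <= 10 ^+ 6 * H ^+ 2.
Proof.
have [h1 _ _ h0 h5] := hidden_log_bounds.
have ld : 0 <= ln delta^-1.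
  by rewrite ln_ge0 // -[1]invr1 lef_pV2 ?posrE ?ltW.
have m0 : 0 < (pca_m2 d eps pp)%:R :> R by rewrite ltr0n pca_m2_gt0.
have /andP[_ mle] := pca_m2_bounds; have hd := ln_delta12.
rewrite /pca_eps2; move: (pca_m2 d eps pp) m0 mle => m m0 mle.
have d60 : 0 < dl / 6 by rewrite !divr_gt0.
rewrite invfM invf_div -exprVn lnM ?posrE ?divr_gt0 ?mulr_gt0 ?exprn_gt0 ?invr_gt0 //.
rewrite lnXn ?invr_gt0 // (_ : (dl / 6)^-1 = 12 / delta); last first.
  by field; rewrite gt_eqF.
rewrite ln_div // ?mulr_gt0 //.
have h2 : ln (8 * m%:R : R) <= 8 * m%:R by apply: (@ln_le); apply: mulr_gt0.
have h3 : ln (12 / delta) *+ m <= (12 + H) * (10 ^+ 4 * H).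
  rewrite -[ln (12 / delta) *+ m]mulr_natr.
  apply: le_trans (ler_wpM2r (ltW m0) hd) _; rewrite ler_wpM2l //; lra.
have h4 : H <= H ^+ 2 by rewrite expr2 ler_peMl // (le_trans ler01).
move: h2 h3 h4; rewrite expr2; move: mle h1 ld h5; set h := H.
move: (ln (12 / delta) *+ _) (ln (_ * _)) => y x; lra.
Qed.

Lemma pca_eps1_pos : 0 < pca_eps1 d dl pp.
Proof. by apply: pca_eps1_gt0 => //; [rewrite divr_gt0|exact: pp_gt0|exact: pp_le1]. Qed.

Lemma pca_eps2_pos : 0 < pca_eps2 d dl eps pp.
Proof.
rewrite /pca_eps2 mulr_gt0 ?divr_gt0 ?mulr_gt0 ?ltr0n ?pca_m2_gt0 //.
by rewrite exprn_gt0 // !divr_gt0.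
Qed.

Lemma log_factor_le (lam D eta : R) : 0 < lam -> dl * lam / 27 <= D -> 0 < eta ->
  ln eta^-1 <= 10 ^+ 6 * H ^+ 2 -> log_factor lam eta D <= 10 ^+ 7 * H ^+ 2.
Proof.
move=> lam0 hD eta0 heta; have [h1 _ h3 _ h5] := hidden_log_bounds.
have h2 : 1 <= H ^+ 2 by rewrite exprn_ege1.
have h4 : H <= H ^+ 2 by rewrite expr2 ler_peMl // (le_trans ler01).
have D0 : 0 < D by apply: lt_le_trans hD; rewrite !divr_gt0 ?mulr_gt0 ?divr_gt0.
rewrite /log_factor ge_max; apply/andP; split; first lra.
have : ln (lam / (eta * D)) <= ln (54 / delta / eta).
  rewrite ler_ln ?posrE ?divr_gt0 ?mulr_gt0 //.
  rewrite ler_pdivrMr ?mulr_gt0 // mulrA divfK ?gt_eqF //.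
  by rewrite mulrAC ler_pdivlMr //; lra.
have -> : ln (54 / delta / eta) = ln 54 + ln delta^-1 + ln eta^-1.
  by rewrite !ln_div // divr_gt0.
have : ln (54 : R) <= 54 by apply: ln_le.
by move: heta h2 h4; set u := H ^+ 2; lra.
Qed.

(** [lam / D <= 54 / delta], and 54 is rounded up to [8 ^+ 2]. *)
Lemma sqrt_ratio_le (lam D : R) : 0 < lam -> dl * lam / 27 <= D ->
  Num.sqrt lam / Num.sqrt D <= 8 / Num.sqrt delta.
Proof.
move=> lam0 hD.
have D0 : 0 < D by apply: lt_le_trans hD; rewrite !divr_gt0 ?mulr_gt0 ?divr_gt0.
rewrite ler_pdivrMr ?sqrtr_gt0 // mulrAC ler_pdivlMr ?sqrtr_gt0 //.
have -> : 8 * Num.sqrt D = Num.sqrt (8 ^+ 2 * D).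
  by rewrite sqrtrM ?sqr_ge0 // sqrtr_sqr ger0_norm.
rewrite -sqrtrM; last exact: ltW.
rewrite ler_sqrt; first by rewrite expr2; lra.
by rewrite mulr_ge0 ?sqr_ge0 // ltW.
Qed.

(** A column takes [(f + 1) (m1 + 1) + m2] calls, which is [O(H^2)]. The remaining operations are
    [O(d)] per round and per projection, with [s + n] projections for column [s]; they sum to the
    term in [k d (k + n)]. *)
Lemma total_time_le (f K : nat -> nat) n :
  (forall s, (s < k)%N -> (f s <= max_rounds)%N) ->
  (\sum_(s < k) ((f s).+1 * ((pca_m1 d pp).+1 * K s + (8 * d + 15))
         + pca_m2 d eps pp * K s + (13 * d + 7 + (s + n) * (4 * d + 2))))%N%:R
  <= 10 ^+ 9 * H ^+ 2 * \sum_(s < k) (K s)%:R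
     + 10 ^+ 6 * H ^+ 2 * (k * d * (k + n))%:R.
Proof.
move=> hf; have [h1 _ _ _ _] := hidden_log_bounds.
have m1le := pca_m1_le; have /andP[_ m2le] := pca_m2_bounds.
have Fle := max_rounds_le.
move: (pca_m1 d pp) (pca_m2 d eps pp) m1le m2le => m1 m2 m1le m2le.
have -> : (k * d * (k + n))%:R = \sum_(s < k) (d * (k + n))%:R :> R.
  by rewrite sumr_const card_ord -[RHS]mulr_natr -natrM [in RHS]mulnC mulnA.
rewrite natr_sum !mulr_sumr -big_split; apply: ler_sum => s _.
have fs : (f s)%:R <= 10 ^+ 4 * H by apply: le_trans Fle; rewrite ler_nat hf.
have d1 : 1 <= d%:R :> R by rewrite ler1n.
have sk : s%:R + 1 <= k%:R :> R by rewrite natr1 ler_nat.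
have s0 : 0 <= s%:R :> R by [].
rewrite !(natrD, natrM) -[(f s).+1%:R]natr1 -[m1.+1%:R]natr1.
move: (f s)%:R m1%:R m2%:R (K s)%:R d%:R s%:R k%:R n%:R
  (ler0n R (f s)) (ler0n R m1) (ler0n R (K s)) (ler0n R n) fs m1le m2le d1 sk s0.
move=> fr mr m2r Kr dr sr kr nr f0 m0 K0 n0 fs m1le m2le d1 sk s0.
move: H h1 fs m1le m2le => h h1 fs m1le m2le.
have hh : h <= h ^+ 2 by rewrite expr2 ler_peMl // (le_trans ler01).
have a1 : (fr + 1) * (mr + 1) <= ((10 ^+ 4 + 1) * h) * ((10 ^+ 4 + 1) * h).
  by rewrite ler_pM //; lra.
have a2 : (fr + 1) * (mr + 1) + m2r <= 10 ^+ 9 * h ^+ 2.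
  by move: a1 hh; rewrite expr2; lra.
have a3 : ((fr + 1) * (mr + 1) + m2r) * Kr <= 10 ^+ 9 * h ^+ 2 * Kr by rewrite ler_wpM2r.
have a4 : (fr + 1) * (8 * dr + 15) <= ((10 ^+ 4 + 1) * h) * (23 * dr).
  by rewrite ler_pM //; lra.
have b1 : h * dr <= h ^+ 2 * dr by rewrite ler_wpM2r //; lra.
have b2 : dr <= h ^+ 2 * dr by rewrite ler_peMl //; lra.
have kn1 : 1 <= kr + nr by lra.
have b3 : h ^+ 2 * dr <= h ^+ 2 * (dr * (kr + nr)).
  by rewrite ler_wpM2l ?sqr_ge0 // ler_peMr //; lra.
have b4 : (sr + nr) * (4 * dr + 2) <= (kr + nr) * (6 * dr).
  by rewrite ler_pM //; lra.
have b5 : dr * (kr + nr) <= h ^+ 2 * (dr * (kr + nr)).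
  by rewrite ler_peMl ?mulr_ge0 //; lra.
have e : (fr + 1) * ((mr + 1) * Kr + (8 * dr + 15)) + m2r * Kr +
   (13 * dr + 7 + (sr + nr) * (4 * dr + 2)) =
   ((fr + 1) * (mr + 1) + m2r) * Kr + (fr + 1) * (8 * dr + 15) +
   (13 * dr + 7) + (sr + nr) * (4 * dr + 2) by ring.
rewrite e; apply: (@le_trans _ _
  (10 ^+ 9 * h ^+ 2 * Kr + 10 ^+ 6 * h ^+ 2 * (dr * (kr + nr)))); last by [].
have e1 : (10 ^+ 4 + 1) * h * (23 * dr) = 23 * (10 ^+ 4 + 1) * (h * dr) by ring.
have e2 : (kr + nr) * (6 * dr) = 6 * (dr * (kr + nr)) by ring.
rewrite e1 in a4; rewrite e2 in b4; rewrite -[10 ^+ 6 * _ * _]mulrA.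
move: a3 a4 b1 b2 b3 b4 b5 d1; clear.
move: (((fr + 1) * (mr + 1) + m2r) * Kr) ((fr + 1) * (8 * dr + 15)) => A1 A2.
move: ((sr + nr) * (4 * dr + 2)) => A3.
move: (10 ^+ 9 * h ^+ 2 * Kr) => B1.
move: (h ^+ 2 * (dr * (kr + nr))) => B2.
move: (h * dr) (h ^+ 2 * dr) (dr * (kr + nr)) => B3 B4 B5; lra.
Qed.

End Bounds.

(** * From the program to the running time, for any presentation of the matrix *)

Section Assembly.
Variable R : realType.

Definition last_round d (A : method R d) (M : 'M[R]_d) k delta eps p
    (w0 v : nat -> 'cV[R]_d) s f : Prop :=
  [/\ pca_stop A (deflate M v s) (delta / 2) (p / k%:R) (w0 s) f,
      forall i, (i < f)%N ->
        ~~ pca_stop A (deflate M v s) (delta / 2) (p / k%:R) (w0 s) i &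
      v s = new_column v s (pca_power A (deflate M v s) (w0 s)
        (pca_shift A (deflate M v s) (delta / 2) (p / k%:R) (w0 s) f.+1)
        (pca_eps2 d (delta / 2) eps (p / k%:R)) (pca_m2 d eps (p / k%:R)))].

Lemma lazysvd_rounds d (A : method R d) (M : 'M[R]_d) k delta eps p w0 v :
  lazysvd A M k delta eps p w0 v ->
  exists f, forall s, (s < k)%N -> last_round A M k delta eps p w0 v s (f s).
Proof.
move=> run.
suff /choice[f hf] : forall s, exists f, (s < k)%N ->
    last_round A M k delta eps p w0 v s f by exists f.
move=> s; have [sk|] := ltnP s k; last by exists 0%N.
by have [v' [f [f1 f2 ->]] vs] := run s sk; exists f.
Qed.

(** Used to identify the exit round read off from LazySVD with the one bounded on the good event. *)
Lemma first_unique (P : pred nat) i j : P i -> (forall r, (r < i)%N -> ~~ P r) ->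
  P j -> (forall r, (r < j)%N -> ~~ P r) -> i = j.
Proof.
move=> Pi ni Pj nj; case: (ltngtP i j) => // [/nj|/ni].
  by rewrite Pi.
by rewrite Pj.
Qed.

Lemma spectrum_head d (M : 'M[R]_d) k lam : (0 < k <= d)%N -> spectrum M lam ->
  all (fun x => 0 <= x <= 1) lam -> lam`_k.-1 <= lam`_0 /\ lam`_0 <= 1.
Proof.
move=> /andP[k0 kd] spM lam01; have sl := spectrum_size spM.
have d0 : (0 < d)%N by apply: leq_trans kd.
split; last by move/all_nthP: lam01 => /(_ 0 0%N); rewrite sl => /(_ d0)/andP[].
apply: (sorted_leq_nth _ _ 0 spM.1); rewrite ?inE ?sl //.
- by move=> x y z xy yz; apply: le_trans yz xy.
- by rewrite prednK.
Qed.

Section Backend.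
Variables (d : nat) (inp : input R d) (Q : Type).
Variable call : method R d -> state R d -> Q ->
  R -> 'cV[R]_d -> R -> 'cV[R]_d -> nat -> Prop.
Variables (M : 'M[R]_d) (k n : nat) (a : 'I_n -> 'cV[R]_d).
Variables (delta eps p : R) (desc : nat -> Q) (tcall : nat -> nat).
Hypothesis call_spec : forall A v s st lam b eta, (s < k)%N ->
  holds_columns a v s st ->
  call A st (desc s) lam b eta (answer A lam (deflate M v s) b eta)
    (Defs.count A lam (deflate M v s) b eta * tcall s)%N.
Hypotheses (in0 : in_reg inp n = 0) (ina : forall i : 'I_n, in_reg inp i = a i).

Local Notation code := (lazysvd_prog d k n delta eps p desc k).

Lemma lazysvd_prog_implements :
  implements_lazysvd inp call M k delta eps p code (out_reg n).
Proof.
move=> A w0 v /lazysvd_rounds[f hf].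
have [st [t [e o _]]] := exec_lazysvd (f := f) (w0 := w0) (v := v) (@call_spec A v)
  (fun s sk => let: And3 h _ _ := hf s sk in h)
  (fun s sk => let: And3 _ h _ := hf s sk in h)
  (fun s sk => let: And3 _ _ h := hf s sk in h) in0 ina.
by exists t, st.
Qed.

Variables (lam : seq R) (is_method : method R d -> Prop) (KR : nat -> R).
Local Notation l := lam`_k.-1.
Local Notation H := (hidden_log k d delta eps p lam`_0 l).
Hypothesis is_accurate : forall A, is_method A -> accurate A.
(** The interface with the cost of a method: calls whose gap [D] is of order [delta x] take time at
    most [KR s]. The columns are known to have norm at most 1, so that SVRG receives vectors in the
    unit ball. *)
Hypothesis count_le : forall A v s (x D : R) b (eta : R), is_method A -> (s < k)%N ->
  (forall j, (j < s)%N -> l2norm (v j) <= 1) ->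
  0 < x -> l <= x -> 0 < D -> delta / 2 * x / 27 <= D ->
  psd (x%:M - deflate M v s - D%:M) -> 0 < eta ->
  ln eta^-1 <= 10 ^+ 6 * H ^+ 2 ->
  (Defs.count A x (deflate M v s) b eta * tcall s)%:R <= KR s.
Hypotheses (kd : (0 < k <= d)%N) (delta01 : 0 < delta < 1) (eps01 : 0 < eps < 1).
Hypotheses (p01 : 0 < p < 1) (symM : sym M) (spM : spectrum M lam).
Hypotheses (lam01 : all (fun x => 0 <= x <= 1) lam) (l0 : 0 < l).

Lemma lazysvd_prog_runs : runs_in_time inp call M k delta eps p code (out_reg n)
  is_method (10 ^+ 9 * H ^+ 2 * \sum_(s < k) KR s
     + 10 ^+ 6 * H ^+ 2 * (k * d * (k + n))%:R).
Proof.
move=> dsp T P A w0 v mA run.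
have bM := spectrum_bounds symM spM lam01.
have pM : psd M by split=> // x; case/andP: (bM x).
have M1 (x : 'cV[R]_d) : dot x (M *m x) <= dot x x by case/andP: (bM x).
have /andP[k0 kd'] := kd; have d0 : (0 < d)%N by apply: leq_trans kd'.
have /andP[dl0 dl1] := delta01; have /andP[e0 e1] := eps01; have /andP[p0 p1] := p01.
have [ll lam11] := spectrum_head kd spM lam01.
have [] := hidden_log_bounds k0 d0 dl0 dl1 e0 e1 p0 p1 l0 ll lam11 => H1 _ _ _ _.
have mm s (W : 'M[R]_(s, d)) : (s < k)%N -> exists2 y : 'cV[R]_d, y != 0 &
     W *m y = 0 /\ l * dot y y <= dot y (M *m y).
  by move=> sk; apply: spectrum_minmax => //; rewrite sk.
have [E [mE PE hE]] := lazysvd_good_event kd delta01 p01 l0 pM M1 mm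
  (max_rounds_enough dl0 dl1 l0 ll lam11) (fun w => is_accurate (mA w)) run.
exists E; split=> // w Ew; have [lsvd fast] := hE w Ew; split=> //.
have [f hf] := lazysvd_rounds lsvd.
have [st [t [e o b]]] := exec_lazysvd (f := f) (w0 := w0^~ w) (v := v^~ w) (@call_spec (A w) (v^~ w))
  (fun s sk => let: And3 h _ _ := hf s sk in h)
  (fun s sk => let: And3 _ h _ := hf s sk in h)
  (fun s sk => let: And3 _ _ h := hf s sk in h) in0 ina.
exists t; first by exists st.
have v1 j : (j < k)%N -> l2norm (v j w) <= 1.
  by move=> jk; have [_ _ ->] := hf j jk; apply: l2norm_normalize_le1.
have fmax s : (s < k)%N -> (f s <= max_rounds delta l)%N /\ exists mu, l <= mu /\
    forall i, (i <= (f s).+1)%N ->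
      let x := pca_shift (A w) (deflate M (v^~ w) s) (delta / 2) (p / k%:R) (w0 s w) i in
      [/\ mu < x, x <= 3 / 2, delta / 2 * x / 27 <= x - mu &
          psd (x%:M - deflate M (v^~ w) s - (x - mu)%:M)].
  move=> sk; have [f' [f1 f2 f3 f4]] := fast s sk; have [g2 g3 _] := hf s sk.
  by have -> : f s = f' by apply: first_unique g2 g3 f2 f3.
have bnd s : (s < k)%N -> forall i eta, (i <= (f s).+1)%N -> 0 < eta ->
    ln eta^-1 <= 10 ^+ 6 * H ^+ 2 -> call_bound M tcall (A w) (v^~ w) s
      (pca_shift (A w) (deflate M (v^~ w) s) (delta / 2) (p / k%:R) (w0 s w) i)
      eta (Num.truncn (KR s)).
  move=> sk i eta ifs eta0 heta x; have [_ [mu [lmu /(_ i ifs)[h1 _ h3 h4]]]] := fmax s sk.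
  have mu0 : 0 < mu by apply: lt_le_trans lmu.
  have D0 : 0 < pca_shift (A w) (deflate M (v^~ w) s) (delta / 2) (p / k%:R) (w0 s w) i - mu.
    by rewrite subr_gt0.
  have h := count_le x (mA w) sk (fun j js => v1 j (ltn_trans js sk))
    (lt_trans mu0 h1) (le_trans lmu (ltW h1)) D0 h3 h4 eta0 heta.
  by rewrite truncn_ge_nat // (le_trans _ h).
have := b (fun s => Num.truncn (KR s)); rewrite -(ler_nat R) => /(_ _)/le_trans; apply.
  move=> s sk; split=> [i ifs|].
    apply: bnd => //; first exact: leqW.
      exact: (pca_eps1_pos k0 d0 dl0 p0 p1).
    exact: (ln_pca_eps1 k0 d0 dl0 dl1 e0 e1 p0 p1 l0 ll lam11).
  apply: bnd => //; first exact: (pca_eps2_pos k0 d0 dl0 dl1 e0 e1 p0 p1 l0 ll lam11).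
  exact: (ln_pca_eps2 k0 d0 dl0 dl1 e0 e1 p0 p1 l0 ll lam11).
apply: le_trans (total_time_le k0 d0 dl0 dl1 e0 e1 p0 p1 l0 ll lam11
  (fun s => Num.truncn (KR s)) n (fun s sk => (fmax s sk).1)) _.
rewrite lerD2r; apply: ler_wpM2l; first by rewrite mulr_ge0 ?sqr_ge0 ?exprn_ge0.
(* What is left is [0 <= KR s]; it holds because [KR s] bounds the time of a call at the initial
   shift. *)
apply: ler_sum => s _; rewrite truncn_le.
have [_ [mu [lmu /(_ 0%N isT)[h1 _ h3 h4]]]] := fmax s (ltn_ord s).
have mu0 : 0 < mu by apply: lt_le_trans lmu.
apply: le_trans (count_le (v := v^~ w) 0 (mA w) (ltn_ord s) _ (lt_trans mu0 h1)
  (le_trans lmu (ltW h1)) _ h3 h4 (pca_eps1_pos k0 d0 dl0 p0 p1) _) => //.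
- by move=> j js; apply: v1; apply: ltn_trans (ltn_ord s).
- by rewrite subr_gt0.
exact: (ln_pca_eps1 k0 d0 dl0 dl1 e0 e1 p0 p1 l0 ll lam11).
Qed.
End Backend.

Lemma runs_in_time_le d (inp : input R d) Q call M k delta eps p
    (code : prog R Q) out is_method (b b' : R) : b <= b' ->
  runs_in_time inp call M k delta eps p code out is_method b ->
  runs_in_time inp call M k delta eps p code out is_method b'.
Proof.
move=> bb h dsp T P A w0 v mA run; have [E [mE PE hE]] := h _ _ _ _ _ _ mA run.
exists E; split=> // w /hE[h1 [t h2 h3]]; split=> //; exists t => //.
exact: le_trans bb.
Qed.

End Assembly.

(** * Accelerated gradient descent *)

Section AGD.
Variables (R : realType) (c : nat).

(* [deflate M v s.+1 = P (deflate M v s) P] with [P = 1 - v_s v_s^T]; the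
   routine works on registers 4 and 5. *)
Fixpoint deflated_mul s : seq (instr R) :=
  if s is s'.+1 then
    code_project R 4 (out_reg 0 s') 4 ++ deflated_mul s'
      ++ code_project R 5 (out_reg 0 s') 5
  else [:: VInMul R 5 4].

Lemma deflated_mulS s : deflated_mul s.+1 =
  code_project R 4 (out_reg 0 s) 4 ++ deflated_mul s
    ++ code_project R 5 (out_reg 0 s) 5.
Proof. by []. Qed.

Definition agd_routine s : routine R := Routine (deflated_mul s) 4 5.

Variables (d k : nat) (delta eps p : R) (inp : input R d) (M : 'M[R]_d) (nz : nat).
Hypotheses (inM : forall x, in_mul inp x = M *m x) (in0 : in_reg inp = fun=> 0).
(** Covers both inputs: [2 nnz M + d] for an explicit matrix and [4 nnz A + d] for a factored
    one. *)
Hypothesis inC : (in_cost inp <= 4 * nz + d)%N.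

Lemma deflated_mul_spec (st : state R d) v s :
  (forall j, (j < s)%N -> vreg st (out_reg 0 j) = v j) ->
  vreg (steps inp st (deflated_mul s)) 5 = deflate M v s *m vreg st 4 /\
  forall r, (5 < r)%N -> vreg (steps inp st (deflated_mul s)) r = vreg st r.
Proof.
elim: s st => [|s IH] st hv.
  split; first by rewrite /= inM.
  by move=> r hr; rewrite /=; have -> : (r == 5) = false by lia.
rewrite deflated_mulS !steps_cat.
set st1 := steps inp st (code_project R 4 (out_reg 0 s) 4).
have v1 : vreg st1 = fun r => if r == 4 then project_out (v s) (vreg st 4) else vreg st r.
  by rewrite steps_project hv.
have o1 j : (j < s.+1)%N -> vreg st1 (out_reg 0 j) = v j.
  by move=> js; rewrite v1; have -> : (out_reg 0 j == 4) = false by []; apply: hv.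
have [i1 i2] := IH st1 (fun j js => o1 j (ltnW js)).
set st2 := steps inp st1 (deflated_mul s) in i1 i2 *.
have os : vreg st2 (out_reg 0 s) = v s by rewrite i2 // o1.
split=> [|r hr]; rewrite steps_project.
  rewrite eqxx os i1 v1 eqxx.
  rewrite -/(project_out _ _) -!project_outE /=.
  by rewrite !mulmxA.
have [r5 r4] : (r == 5) = false /\ (r == 4) = false by split; lia.
by rewrite r5 i2 // v1 r4.
Qed.

Lemma deflated_mul_cost s :
  steps_cost inp (deflated_mul s) = (in_cost inp + s * (8 * d + 4))%N.
Proof.
elim: s => [|s IH]; first by rewrite /steps_cost big_seq1 mul0n addn0.
rewrite deflated_mulS !steps_cost_cat IH /steps_cost !(big_cons, big_nil) /=.
by lia.
Qed.

Definition agd_call_time s : nat := (c * d + steps_cost inp (deflated_mul s))%N.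

Lemma agd_call_spec A v s st lam b eta : (s < k)%N ->
  holds_columns (fun _ : 'I_0 => 0 : 'cV[R]_d) v s st ->
  agd_call inp c A st (agd_routine s) lam b eta
    (answer A lam (deflate M v s) b eta)
    (Defs.count A lam (deflate M v s) b eta * agd_call_time s)%N.
Proof.
move=> sk [_ ho _]; exists (deflate M v s); split=> // y.
have hy j : (j < s)%N -> vreg (set_vreg st 4 y) (out_reg 0 j) = v j by apply: ho.
by have [-> _] := deflated_mul_spec hy.
Qed.

(** An iteration for column [s] costs one product with [M], [2 s] projections and [c d]; summed over
    [s], the projections give [k^2 d]. *)
Lemma agd_call_time_sum : (0 < k)%N -> (0 < d)%N ->
  (\sum_(s < k) agd_call_time s <= (c + 17) * (k * nz + k ^ 2 * d))%N.
Proof.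
move=> k0 d0; apply: (@leq_trans (\sum_(s < k) (c * d + (4 * nz + d) + k * (12 * d)))%N).
  apply: leq_sum => s _; rewrite /agd_call_time deflated_mul_cost.
  have : (s * (8 * d + 4) <= k * (12 * d))%N.
    by rewrite leq_mul //; [exact: ltnW|lia].
  by have := inC; lia.
rewrite sum_nat_const card_ord -mulnn.
have : (k * d <= k * k * d)%N by rewrite leq_mul2r leq_pmulr ?orbT.
move=> h1; have h2 : (c * (k * d) <= c * (k * k * d))%N by rewrite leq_mul2l h1 orbT.
by move: h1 h2; clear; nia.
Qed.

Variable lam : seq R.
Local Notation H := (hidden_log k d delta eps p lam`_0 lam`_k.-1).
Hypotheses (kd : (0 < k <= d)%N) (delta01 : 0 < delta < 1) (eps01 : 0 < eps < 1).
Hypotheses (p01 : 0 < p < 1) (symM : sym M) (spM : spectrum M lam).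
Hypotheses (lam01 : all (fun x => 0 <= x <= 1) lam) (l0 : 0 < lam`_k.-1).

(** [8 * 10 ^+ 16] is [10 ^+ 9] from the number of calls, times [10 ^+ 7] from the logarithm, times
    8 from the ratio of square roots. *)
Lemma agd_lazysvd :
  let code := lazysvd_prog d k 0 delta eps p agd_routine k in
  implements_lazysvd inp (agd_call inp c) M k delta eps p code (out_reg 0) /\
  runs_in_time inp (agd_call inp c) M k delta eps p code (out_reg 0) (is_agd c)
    ((8 * 10 ^+ 16 * c%:R * (c + 17)%:R + 10 ^+ 6) * H ^+ 4 *
     ((k * nz + k ^ 2 * d)%:R / Num.sqrt delta)).
Proof.
have /andP[k0 kd'] := kd; have d0 : (0 < d)%N by apply: leq_trans kd'.
have /andP[dl0 dl1] := delta01; have /andP[e0 e1] := eps01; have /andP[p0 p1] := p01.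
have [ll lam11] := spectrum_head kd spM lam01.
have [H1 _ _ _ _] := hidden_log_bounds k0 d0 dl0 dl1 e0 e1 p0 p1 l0 ll lam11.
have pM : psd M by split=> // x; case/andP: (spectrum_bounds symM spM lam01 x).
have in00 : in_reg inp 0 = 0 by rewrite in0.
have ina (i : 'I_0) : in_reg inp i = (fun _ : 'I_0 => 0) i by rewrite in0.
split; first exact: (lazysvd_prog_implements agd_call_spec in00 ina).
pose KR s : R := c%:R * (8 / Num.sqrt delta) * (10 ^+ 7 * H ^+ 2) * (agd_call_time s)%:R.
have sd : 0 < Num.sqrt delta by rewrite sqrtr_gt0.
have run := @lazysvd_prog_runs _ _ _ _ _ _ _ _ _ _ _ _ _ _ agd_call_spec in00 ina
  lam (is_agd c) KR _ _ kd delta01 eps01 p01 symM spM lam01 l0.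
apply: (runs_in_time_le _ (run _ _)) => [|A []//|A v s x D b eta]; last first.
  move=> [_ agdA] sk v1 x0 lx D0 hD psdD eta0 heta.
  rewrite natrM ler_wpM2r //.
  apply: le_trans (agdA _ _ _ _ _ (deflate_psd _ _ pM) x0 D0 eta0 psdD) _.
  rewrite ler_pM //.
  - by rewrite /log_factor le_max ler01.
  - by rewrite ler_wpM2l // sqrt_ratio_le.
  exact: (log_factor_le k0 d0 dl0 dl1 e0 e1 p0 p1 l0 ll lam11).
rewrite -mulr_sumr -natr_sum.
have hT : (\sum_(s < k) agd_call_time s)%:R <= (c + 17)%:R * (k * nz + k ^ 2 * d)%:R :> R.
  by rewrite -natrM ler_nat; apply: agd_call_time_sum.
have hW : (k * d * (k + 0))%:R <= (k * nz + k ^ 2 * d)%:R :> R.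
  by rewrite ler_nat addn0 -mulnn mulnAC leq_addl.
have S1 : 1 <= (Num.sqrt delta)^-1.
  rewrite -[1]invr1 lef_pV2 ?posrE // -sqrtr1 ler_sqrt // ltW //.
move: (\sum_(s < k) _)%:R (k * d * (k + 0))%:R (k * nz + k ^ 2 * d)%:R (c + 17)%:R
  (ler0n R (k * d * (k + 0))) (ler0n R (k * nz + k ^ 2 * d)) (ler0n R c) hT hW.
move: (Num.sqrt delta)^-1 S1 c%:R => S S1 cr t Z W c17 Z0 W0 c0 hT hW.
move: H H1 {run} => h H1.
have h2 : 1 <= h ^+ 2 by rewrite exprn_ege1.
have a1 : 8 * 10 ^+ 16 * cr * h ^+ 4 * S * t <= 8 * 10 ^+ 16 * cr * h ^+ 4 * S * (c17 * W).
  by rewrite ler_wpM2l // !mulr_ge0 ?exprn_ge0 //; lra.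
have a2 : h ^+ 2 * Z <= h ^+ 4 * (W * S).
  rewrite ler_pM ?sqr_ge0 //; first by rewrite ler_weXn2l.
  by apply: le_trans hW _; rewrite ler_peMr.
have a3 : 10 ^+ 6 * (h ^+ 2 * Z) <= 10 ^+ 6 * (h ^+ 4 * (W * S)) by rewrite ler_wpM2l // exprn_ge0.
have -> : (8 * 10 ^+ 16 * cr * c17 + 10 ^+ 6) * h ^+ 4 * (W * S) =
  8 * 10 ^+ 16 * cr * h ^+ 4 * S * (c17 * W) + 10 ^+ 6 * (h ^+ 4 * (W * S)) by ring.
apply: le_trans (lerD a1 a3); rewrite le_eqVlt; apply/orP; left; apply/eqP.
by ring.
Qed.

End AGD.

(** * Accelerated SVRG *)

Section SVRG.
Variables (R : realType) (c d n k : nat) (delta eps p : R) (a : 'I_n -> 'cV[R]_d).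
Hypothesis a1 : forall i, l2norm (a i) <= 1.

Lemma cov_sym m (b : 'I_m -> 'cV[R]_d) : sym (cov b).
Proof.
rewrite /sym /cov linearZ /= linear_sum; congr (_ *: _); apply: eq_bigr => i _.
by rewrite /= trmx_mul trmxK.
Qed.

Lemma dot_cov m (b : 'I_m -> 'cV[R]_d) x :
  dot x (cov b *m x) = m%:R^-1 * \sum_i dot (b i) x ^+ 2.
Proof.
rewrite /cov -scalemxAl dotZr mulmx_suml; congr (_ * _).
rewrite dotE mulmx_sumr summxE; apply: eq_bigr => i _.
by rewrite -dotE dot_outer expr2.
Qed.

Lemma svrg_call_spec A v s st lam b eta : (s < k)%N ->
  holds_columns a v s st ->
  svrg_call A st (fun i : 'I_n => i : nat) lam b eta
    (answer A lam (deflate (cov a) v s) b eta)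
    (Defs.count A lam (deflate (cov a) v s) b eta * 1)%N.
Proof.
move=> sk [_ _ ha]; rewrite muln1 /svrg_call.
suff -> : cov (fun i : 'I_n => vreg st i) = deflate (cov a) v s by [].
by rewrite deflate_cov; congr cov; apply/funext.
Qed.

Variable lam : seq R.
Local Notation l := lam`_k.-1.
Local Notation H := (hidden_log k d delta eps p lam`_0 l).
Hypotheses (kd : (0 < k <= d)%N) (delta01 : 0 < delta < 1) (eps01 : 0 < eps < 1).
Hypotheses (p01 : 0 < p < 1) (spM : spectrum (cov a) lam).
Hypotheses (lam01 : all (fun x => 0 <= x <= 1) lam) (l0 : 0 < l).

(** If [n < k], min-max yields a nonzero [y] orthogonal to all [a i], which contradicts [lam_k > 0].
    This lets the [k^2 d] operations spent on orthogonalization be absorbed in [k n d]. *)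
Lemma cov_rank_le : (k <= n)%N.
Proof.
rewrite leqNgt; apply/negP => nk; have /andP[_ kd'] := kd.
have nkd : (n < k <= d)%N by rewrite nk.
have [y y0 [Wy]] := spectrum_minmax (\matrix_(i < n, j < d) a i j 0) (cov_sym a) spM nkd.
rewrite dot_cov big1 ?mulr0 => [|i _].
  by rewrite leNgt mulr_gt0 ?dot_gt0.
have -> : dot (a i) y = 0; last by rewrite expr0n.
move/matrixP/(_ i 0): Wy; rewrite !mxE => h; rewrite -[RHS]h.
by apply: eq_bigr => j _; rewrite mxE.
Qed.

Local Notation X := (n%:R `^ (3 / 4) * d%:R / (l `^ (1 / 4) * Num.sqrt delta)).

(** [x^(1/4) / sqrt D = (sqrt x / sqrt D) / x^(1/4)]; the first factor is at most [8 / sqrt delta],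
    and [x >= l] is how [lam_k^(1/4)] enters the denominator. *)
Lemma svrg_factor_le (x D : R) : l <= x -> delta / 2 * x / 27 <= D ->
  Num.max (n * d)%:R (n%:R `^ (3 / 4) * d%:R * x `^ (1 / 4) / Num.sqrt D)
  <= (n * d)%:R + 8 * X.
Proof.
move=> lx hD; have x0 : 0 < x by apply: lt_le_trans lx.
have /andP[dl0 _] := delta01.
have D0 : 0 < D by apply: lt_le_trans hD; rewrite !divr_gt0 ?mulr_gt0 ?divr_gt0.
have l4 : 0 < l `^ (1 / 4) by rewrite powR_gt0.
have x4 : 0 < x `^ (1 / 4) by rewrite powR_gt0.
have sD : 0 < Num.sqrt D by rewrite sqrtr_gt0.
have sd : 0 < Num.sqrt delta by rewrite sqrtr_gt0.
have X0 : 0 <= X.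
  by rewrite divr_ge0 ?mulr_ge0 ?powR_ge0 ?sqrtr_ge0.
rewrite ge_max; apply/andP; split; first by rewrite lerDl mulr_ge0.
apply: (@le_trans _ _ (8 * X)); last by rewrite lerDr.
have -> : 8 * X = n%:R `^ (3 / 4) * d%:R * ((8 / Num.sqrt delta) / l `^ (1 / 4)).
  by move: (n%:R `^ _) => u; field; rewrite !gt_eqF.
rewrite -mulrA ler_wpM2l ?mulr_ge0 ?powR_ge0 //.
have sx : x `^ (1 / 4) * x `^ (1 / 4) = Num.sqrt x.
  rewrite -powRD; last by rewrite gt_eqF // implybT.
  by rewrite -powR12_sqrt ?ltW //; congr (_ `^ _); field.
have -> : x `^ (1 / 4) / Num.sqrt D = (Num.sqrt x / Num.sqrt D) / x `^ (1 / 4).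
  by rewrite -sx; move: (x `^ _) (Num.sqrt D) x4 sD => u w u0 w0; field; rewrite !gt_eqF.
rewrite ler_pM ?invr_ge0 ?(ltW x4) ?divr_ge0 ?sqrtr_ge0 //.
  exact: sqrt_ratio_le.
rewrite lef_pV2 ?posrE //; apply: ge0_ler_powR => //; rewrite ?nnegrE; exact: ltW.
Qed.

Lemma svrg_lazysvd :
  let code := lazysvd_prog d k n delta eps p (fun=> fun i : 'I_n => i : nat) k in
  implements_lazysvd (cov_input a) (@svrg_call R d n) (cov a) k delta eps p code (out_reg n) /\
  runs_in_time (cov_input a) (@svrg_call R d n) (cov a) k delta eps p code (out_reg n)
    (is_svrg n c)
    ((8 * 10 ^+ 16 * c%:R + 2 * 10 ^+ 6) * H ^+ 4 *
     ((k * n * d)%:R + k%:R * n%:R `^ (3 / 4) * d%:R / (l `^ (1 / 4) * Num.sqrt delta))).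
Proof.
have /andP[k0 kd'] := kd; have d0 : (0 < d)%N by apply: leq_trans kd'.
have /andP[dl0 dl1] := delta01; have /andP[e0 e1] := eps01; have /andP[p0 p1] := p01.
have [ll lam11] := spectrum_head kd spM lam01.
have [H1 _ _ _ _] := hidden_log_bounds k0 d0 dl0 dl1 e0 e1 p0 p1 l0 ll lam11.
have in0 : in_reg (cov_input a) n = 0 by rewrite /= insubF ?ltnn.
have ina (i : 'I_n) : in_reg (cov_input a) i = a i by rewrite /= valK.
split; first exact: (lazysvd_prog_implements svrg_call_spec in0 ina).
pose KR (s : nat) : R := c%:R * ((n * d)%:R + 8 * X) * (10 ^+ 7 * H ^+ 2).
have run := @lazysvd_prog_runs _ _ _ _ _ _ _ _ _ _ _ _ _ _ svrg_call_spec in0 ina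
  lam (is_svrg n c) KR _ _ kd delta01 eps01 p01 (cov_sym a) spM lam01 l0.
apply: (runs_in_time_le _ (run _ _)) => [|A []//|A v s x D b eta]; last first.
  move=> [_ svrgA] sk v1 x0 lx D0 hD psdD eta0 heta.
  rewrite muln1 deflate_cov; rewrite deflate_cov in psdD.
  have b1 i : l2norm (project_out_all v s (a i)) <= 1.
    exact: le_trans (l2norm_project_out_all _ v1) (a1 i).
  apply: le_trans (svrgA _ _ _ _ _ b1 x0 D0 eta0 psdD) _.
  rewrite ler_pM //.
  - by rewrite /log_factor le_max ler01.
  - by rewrite ler_wpM2l // svrg_factor_le.
  exact: (log_factor_le k0 d0 dl0 dl1 e0 e1 p0 p1 l0 ll lam11).
rewrite sumr_const card_ord -[KR 0%N *+ k]mulr_natr /KR.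
have -> : k%:R * n%:R `^ (3 / 4) * d%:R / (l `^ (1 / 4) * Num.sqrt delta) = k%:R * X.
  by rewrite !mulrA.
have X0 : 0 <= X by rewrite divr_ge0 ?mulr_ge0 ?powR_ge0 ?sqrtr_ge0.
have hW : (k * d * (k + n))%:R <= 2 * (k * n * d)%:R :> R.
  rewrite -natrM ler_nat; have := cov_rank_le => kn.
  by rewrite mulnDr mul2n -addnn (mulnAC k n d) leq_add // leq_mul2l kn orbT.
have -> : (k * n * d)%:R = k%:R * (n * d)%:R :> R by rewrite -natrM mulnA.
have {hW} : (k * d * (k + n))%:R <= 2 * (k%:R * (n * d)%:R) :> R.
  by rewrite -natrM mulnA.
move: X X0 (k * d * (k + n))%:R (n * d)%:R (ler0n R (n * d)) k%:R (ler0n R k) c%:R (ler0n R c).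
move=> x x0 Z W W0 kr kr0 cr c0 hW.
move: H H1 {run KR} => h H1.
have h24 : h ^+ 2 <= h ^+ 4 by rewrite ler_weXn2l.
have q0 : 0 <= kr * (W + x) by rewrite mulr_ge0 // addr_ge0.
have b1 : h ^+ 2 * Z <= h ^+ 4 * (2 * (kr * (W + x))).
  apply: le_trans (ler_wpM2l (sqr_ge0 h) hW) _.
  rewrite ler_pM ?sqr_ge0 ?mulr_ge0 // ler_wpM2l // ler_wpM2l // lerDl //.
have b2 : cr * kr * (W + 8 * x) <= cr * kr * (8 * (W + x)).
  by rewrite ler_wpM2l ?mulr_ge0 //; lra.
have b3 : 10 ^+ 16 * h ^+ 4 * (cr * kr * (W + 8 * x)) <=
    10 ^+ 16 * h ^+ 4 * (cr * kr * (8 * (W + x))).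
  by rewrite ler_wpM2l // mulr_ge0 ?exprn_ge0 // (le_trans ler01).
have b4 : 10 ^+ 6 * (h ^+ 2 * Z) <= 10 ^+ 6 * (h ^+ 4 * (2 * (kr * (W + x)))).
  by rewrite ler_wpM2l ?exprn_ge0.
have -> : (8 * 10 ^+ 16 * cr + 2 * 10 ^+ 6) * h ^+ 4 * (kr * W + kr * x) =
  10 ^+ 16 * h ^+ 4 * (cr * kr * (8 * (W + x)))
  + 10 ^+ 6 * (h ^+ 4 * (2 * (kr * (W + x)))) by ring.
apply: le_trans (lerD b3 b4); rewrite le_eqVlt; apply/orP; left; apply/eqP.
by ring.
Qed.

End SVRG.

Theorem theorem4p2 (R : realType) (c : nat) :
  [/\ (* AGD, M given explicitly *)
    exists (C : R) (q : nat),
    forall (d k : nat) (delta eps p : R),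
      (0 < k <= d)%N -> 0 < delta < 1 -> 0 < eps < 1 -> 0 < p < 1 ->
    exists (code : prog R (routine R)) (out : nat -> nat),
    forall (M : 'M[R]_d) (lam : seq R),
      sym M -> spectrum M lam -> all (fun x => 0 <= x <= 1) lam ->
      0 < lam`_k.-1 ->
      let inp := explicit_input M in
      let call := agd_call inp c in
      implements_lazysvd inp call M k delta eps p code out /\
      runs_in_time inp call M k delta eps p code out (is_agd c)
        (C * hidden_log k d delta eps p lam`_0 lam`_k.-1 ^+ q *
         ((k * nnz M + k ^ 2 * d)%:R / Num.sqrt delta)),
    (* AGD, M given as A A^T *)
    exists (C : R) (q : nat),
    forall (d n k : nat) (delta eps p : R),
      (0 < k <= d)%N -> 0 < delta < 1 -> 0 < eps < 1 -> 0 < p < 1 ->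
    exists (code : prog R (routine R)) (out : nat -> nat),
    forall (A : 'M[R]_(d, n)) (lam : seq R),
      let M := A *m A^T in
      spectrum M lam -> all (fun x => 0 <= x <= 1) lam ->
      0 < lam`_k.-1 ->
      let inp := factored_input A in
      let call := agd_call inp c in
      implements_lazysvd inp call M k delta eps p code out /\
      runs_in_time inp call M k delta eps p code out (is_agd c)
        (C * hidden_log k d delta eps p lam`_0 lam`_k.-1 ^+ q *
         ((k * nnz A + k ^ 2 * d)%:R / Num.sqrt delta)) &
    (* accelerated SVRG, M given as an average of rank one matrices *)
    exists (C : R) (q : nat),
    forall (d n k : nat) (delta eps p : R),
      (0 < k <= d)%N -> 0 < delta < 1 -> 0 < eps < 1 -> 0 < p < 1 ->
    exists (code : prog R ('I_n -> nat)) (out : nat -> nat),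
    forall (a : 'I_n -> 'cV[R]_d) (lam : seq R),
      (forall i, l2norm (a i) <= 1) ->
      let M := cov a in
      spectrum M lam -> all (fun x => 0 <= x <= 1) lam ->
      0 < lam`_k.-1 ->
      let inp := cov_input a in
      let call := @svrg_call R d n in
      implements_lazysvd inp call M k delta eps p code out /\
      runs_in_time inp call M k delta eps p code out (is_svrg n c)
        (C * hidden_log k d delta eps p lam`_0 lam`_k.-1 ^+ q *
         ((k * n * d)%:R +
          k%:R * n%:R `^ (3 / 4) * d%:R
            / (lam`_k.-1 `^ (1 / 4) * Num.sqrt delta)))].
Proof.
split.
- exists (8 * 10 ^+ 16 * c%:R * (c + 17)%:R + 10 ^+ 6), 4 => d k delta eps p kd dl e p01.
  exists (lazysvd_prog d k 0 delta eps p (agd_routine R) k), (out_reg 0).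
  move=> M lam sM sp l01 l0 /=; apply: agd_lazysvd => //=.
  by rewrite leq_add2r leq_mul2r orbT.
- exists (8 * 10 ^+ 16 * c%:R * (c + 17)%:R + 10 ^+ 6), 4 => d n k delta eps p kd dl e p01.
  exists (lazysvd_prog d k 0 delta eps p (agd_routine R) k), (out_reg 0).
  move=> A lam M sp l01 l0 /=; apply: agd_lazysvd => //=.
    by move=> x; rewrite mulmxA.
  by rewrite /sym /M trmx_mul trmxK.
exists (8 * 10 ^+ 16 * c%:R + 2 * 10 ^+ 6), 4 => d n k delta eps p kd dl e p01.
exists (lazysvd_prog d k n delta eps p (fun=> fun i : 'I_n => i : nat) k), (out_reg n).
by move=> a lam a1 M sp l01 l0 /=; apply: svrg_lazysvd.
Qed.
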